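(* Let $(v,\theta)$ be a weak solution on $[0,T]$ of the three-dimensional inviscid Boussinesq system with initial data $(v_{\mathrm{in}},\theta_{\mathrm{in}})$. Let $1\le p\le\infty$ and $\frac1p+\frac1{p'}=1$. Suppose $v\in L^\infty([0,T];B^{1/3}_{\infty,c(\mathbb{N})}(\mathbb{T}^3))$ and - if $1\le p<2$: $\theta\in C([0,T];L^p(\mathbb{T}^3))\cap L^2([0,T];B^{1/3}_{p',c(\mathbb{N})}(\mathbb{T}^3))$; - if $p\ge 2$: $\theta\in C([0,T];L^p(\mathbb{T}^3))\cap L^p([0,T];B^{1/3}_{p,c(\mathbb{N})}(\mathbb{T}^3))$. Then for all $t\in[0,T]$, $\|v(t)\|_{L^2(\mathbb{T}^3)}^2=\|v_{\mathrm{in}}\|_{L^2(\mathbb{T}^3)}^2+2\int_0^t\int_{\mathbb{T}^3}\theta(x,s)v_3(x,s)\,dx\,ds$ and $\|\theta(t)\|_{L^p(\mathbb{T}^3)}=\|\theta_{\mathrm{in}}\|_{L^p(\mathbb{T}^3)}$.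
   Context: $\mathbb{T}^3=\mathbb{R}^3/\mathbb{Z}^3$, $e_3=(0,0,1)^T$. The inviscid Boussinesq system is $\partial_t v+(v\cdot\nabla)v+\nabla p=\theta e_3$, $\partial_t\theta+v\cdot\nabla\theta=0$, $\nabla\cdot v=0$ on $\mathbb{T}^3\times(0,T)$, with $(v,\theta)|_{t=0}=(v_{\mathrm{in}},\theta_{\mathrm{in}})$. Weak solution: $(v_{\mathrm{in}},\theta_{\mathrm{in}})\in C^\infty(\mathbb{T}^3)$, $v_{\mathrm{in}}$ divergence-free; $(v,\theta)\in C(\mathbb{T}^3\times[0,T])$ with $v(\cdot,t)$ distributionally divergence-free for a.e. $t$, and for all divergence-free $\phi\in C_c^\infty([0,T);(C^\infty(\mathbb{T}^3))^3)$: $-\int v_{\mathrm{in}}\cdot\phi(x,0)\,dx-\int_0^T\!\int\partial_s\phi\cdot v=\int_0^T\!\int(\nabla\phi:v\otimes v+\theta e_3\cdot\phi)$, and for all $\varphi\in C_c^\infty([0,T);C^\infty(\mathbb{T}^3))$: $-\int\theta_{\mathrm{in}}\varphi(x,0)\,dx-\int_0^T\!\int\partial_s\varphi\,\theta=\int_0^T\!\int v\cdot\nabla\varphi\,\theta$ (integrals over $\mathbb{T}^3$). Littlewood–Paley on $\mathbb{T}^3$: let $\chi,\varphi$ be smooth radial functions on $\mathbb{R}^3$ with values in $[0,1]$, $\mathrm{supp}\,\chi\subset\{|\xi|\le 4/3\}$, $\chi\equiv1$ on $|\xi|\le3/4$, $\mathrm{supp}\,\varphi\subset\{3/4\le|\xi|\le8/3\}$,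 and $\chi(\xi)+\sum_{j\ge0}\varphi(2^{-j}\xi)=1$. For a distribution $f=\sum_{k\in\mathbb{Z}^3}\hat f(k)e^{2\pi i k\cdot x}$, set $\Delta_j f=0$ for $j\le-2$, $\Delta_{-1}f=\sum_k\chi(k)\hat f(k)e^{2\pi ik\cdot x}$, $\Delta_jf=\sum_k\varphi(2^{-j}k)\hat f(k)e^{2\pi ik\cdot x}$ for $j\ge0$. For $s\in\mathbb{R}$, $1\le p\le\infty$: $B^s_{p,\infty}(\mathbb{T}^3)$ is the set of periodic distributions with $\sup_j 2^{js}\|\Delta_ju\|_{L^p(\mathbb{T}^3)}<\infty$, and $B^s_{p,c(\mathbb{N})}(\mathbb{T}^3)=\{u\in B^s_{p,\infty}(\mathbb{T}^3):2^{js}\|\Delta_ju\|_{L^p(\mathbb{T}^3)}\to0\text{ as }j\to\infty\}$. *)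

(* Defs.v *)
From HB Require Import structures.
From mathcomp Require Import all_boot all_order all_algebra.
From mathcomp Require Import all_classical all_reals all_analysis.
Set Implicit Arguments. Unset Strict Implicit. Unset Printing Implicit Defensive.
Import Order.TTheory GRing.Theory Num.Theory.
Import numFieldNormedType.Exports.
Local Open Scope classical_set_scope.
Local Open Scope ring_scope.

Section Boussinesq.
Variable R : realType.

Local Notation mu := (@lebesgue_measure R).
Local Notation pt := 'rV[R]_3.

Definition e3 (i : 'I_3) : pt := delta_mx 0 i.

Definition vec3 (a b c : R) : pt :=
  \row_(i < 3) (if nat_of_ord i == 0%N then a
                else if nat_of_ord i == 1%N then b else c).

Definition eucl (x : pt) : R := Num.sqrt (\sum_(i < 3) x 0 i ^+ 2).

(* spatial integral over T^3 = [0,1]^3 of a periodic function (iterated) *)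
Definition unitI : set R := [set a | 0 <= a <= 1].
Definition intT3 (f : pt -> R) : R :=
  \int[mu]_(a in unitI) \int[mu]_(b in unitI) \int[mu]_(c in unitI) f (vec3 a b c).

Definition cube : set pt := [set x | forall i, 0 <= x 0 i <= 1].

Definition periodic3 (g : pt -> R) : Prop := forall x i, g (x + e3 i) = g x.

Definition dirD (d : option 'I_3) (f : pt -> R -> R) : pt -> R -> R :=
  match d with
  | Some i => fun x s => 'D_(e3 i) (fun y => f y s) x
  | None => fun x s => 'D_1 (f x) s
  end.
Definition derivable_dir (d : option 'I_3) (f : pt -> R -> R) (x : pt) (s : R) : Prop :=
  match d with
  | Some i => derivable (fun y => f y s) x (e3 i)
  | None => derivable (f x) s 1
  end.
Fixpoint iterD (l : seq (option 'I_3)) (f : pt -> R -> R) : pt -> R -> R :=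
  match l with [::] => f | d :: l' => dirD d (iterD l' f) end.

Definition smooth_xt (f : pt -> R -> R) : Prop :=
  forall l : seq (option 'I_3),
    continuous (fun p : pt * R => iterD l f p.1 p.2) /\
    forall d x s, derivable_dir d (iterD l f) x s.
Definition smooth_x (g : pt -> R) : Prop := smooth_xt (fun x _ => g x).

Definition dx (i : 'I_3) (f : pt -> R -> R) : pt -> R -> R := dirD (Some i) f.
Definition dt (f : pt -> R -> R) : pt -> R -> R := dirD None f.
Definition dx0 (i : 'I_3) (g : pt -> R) : pt -> R := fun x => 'D_(e3 i) g x.

Definition test_scalar (T : R) (phi : pt -> R -> R) : Prop :=
  smooth_xt phi /\ (forall s, periodic3 (phi^~ s)) /\
  exists T', T' < T /\ forall x s, T' <= s -> phi x s = 0.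

Definition test_vector (T : R) (phi : 'I_3 -> pt -> R -> R) : Prop :=
  (forall i, smooth_xt (phi i) /\ forall s, periodic3 ((phi i)^~ s)) /\
  (exists T', T' < T /\ forall i x s, T' <= s -> phi i x s = 0) /\
  (forall x s, 0 <= s -> \sum_(i < 3) dx i (phi i) x s = 0).

Definition timeI (a b : R) : set R := [set s | a <= s <= b].

Definition ae_on (T : R) (P : R -> Prop) : Prop :=
  exists N : set R, mu.-negligible N /\ forall t, 0 <= t <= T -> ~ N t -> P t.

Definition cont_T3 (T : R) (f : pt -> R -> R) : Prop :=
  {within [set p : pt * R | 0 <= p.2 <= T], continuous (fun p : pt * R => f p.1 p.2)} /\
  forall s, 0 <= s <= T -> periodic3 (f^~ s).

Definition weak_solution (T : R) (vin : 'I_3 -> pt -> R) (thin : pt -> R)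
    (v : 'I_3 -> pt -> R -> R) (th : pt -> R -> R) : Prop :=
  (forall i, smooth_x (vin i) /\ periodic3 (vin i)) /\
  (smooth_x thin /\ periodic3 thin) /\
  (forall x, \sum_(i < 3) dx0 i (vin i) x = 0) /\
  (forall i, cont_T3 T (v i)) /\ cont_T3 T th /\
  ae_on T (fun t => forall psi, smooth_x psi -> periodic3 psi ->
     intT3 (fun x => \sum_(i < 3) v i x t * dx0 i psi x) = 0) /\
  (forall phi, test_vector T phi ->
     - intT3 (fun x => \sum_(i < 3) vin i x * phi i x 0)
     - \int[mu]_(s in timeI 0 T) intT3 (fun x => \sum_(i < 3) dt (phi i) x s * v i x s)
     = \int[mu]_(s in timeI 0 T) intT3 (fun x =>
          \sum_(i < 3) \sum_(j < 3) dx j (phi i) x s * (v i x s * v j x s)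
          + th x s * phi ord_max x s)) /\
  (forall phi, test_scalar T phi ->
     - intT3 (fun x => thin x * phi x 0)
     - \int[mu]_(s in timeI 0 T) intT3 (fun x => dt phi x s * th x s)
     = \int[mu]_(s in timeI 0 T) intT3 (fun x =>
          (\sum_(i < 3) v i x s * dx i phi x s) * th x s)).

(* L^q(T^3) norm, 1 <= q <= oo, for continuous periodic functions
   (for continuous f the essential sup equals the sup over the unit cube) *)
Definition Lq (q : \bar R) (f : pt -> R) : R :=
  match q with
  | +oo%E => sup [set `|f x| | x in cube]
  | r%:E => (intT3 (fun x => `|f x| `^ r)) `^ r^-1
  | -oo%E => 0
  end.

Definition conj_exp (p : \bar R) : \bar R :=
  match p with
  | r%:E => if r == 1 then +oo%E else (r / (r - 1))%:E
  | _ => 1%:E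
  end.

Definition LP_pair (chi vphi : pt -> R) : Prop :=
  smooth_x chi /\ smooth_x vphi /\
  (forall x y, eucl x = eucl y -> chi x = chi y /\ vphi x = vphi y) /\
  (forall x, 0 <= chi x <= 1 /\ 0 <= vphi x <= 1) /\
  (forall x, chi x != 0 -> eucl x <= 4 / 3) /\
  (forall x, eucl x <= 3 / 4 -> chi x = 1) /\
  (forall x, vphi x != 0 -> 3 / 4 <= eucl x <= 8 / 3) /\
  (forall x, (fun N : nat => chi x + \sum_(j < N) vphi ((2 ^- j) *: x)) @ \oo --> (1:R)).

(* Delta_j u for j = n - 1 (n : nat), so n = 0 is Delta_{-1}; the Fourier
   multiplier applied to the real-valued u, written in real form
   sum_k m(k) \int u(y) cos(2 pi k.(x-y)) dy  (m is even, being radial).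
   The sum over k in Z^3 is over a box containing the support of m. *)
Definition LPmult (chi vphi : pt -> R) (n : nat) (k : pt) : R :=
  match n with 0%N => chi k | m.+1 => vphi ((2 ^- m) *: k) end.

Definition LPblock (chi vphi : pt -> R) (n : nat) (u : pt -> R) (x : pt) : R :=
  let N := (3 * 2 ^ n.+1)%N in
  \sum_(a < (2 * N).+1) \sum_(b < (2 * N).+1) \sum_(c < (2 * N).+1)
    let k := vec3 (a%:R - N%:R) (b%:R - N%:R) (c%:R - N%:R) in
    LPmult chi vphi n k *
    intT3 (fun y => u y * cos (2 * pi * \sum_(i < 3) k 0 i * (x 0 i - y 0 i))).

(* 2^{j/3} with j = n - 1 *)
Definition wgt (n : nat) : R := 2 `^ ((n%:R - 1) / 3).

Definition besov_c (chi vphi : pt -> R) (q : \bar R) (u : pt -> R) : Prop :=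
  (exists M : R, forall n, wgt n * Lq q (LPblock chi vphi n u) <= M) /\
  (fun n => wgt n * Lq q (LPblock chi vphi n u)) @ \oo --> (0:R).

Definition besov_norm (chi vphi : pt -> R) (q : \bar R) (u : pt -> R) : \bar R :=
  ereal_sup (range (fun n => (wgt n * Lq q (LPblock chi vphi n u))%:E)).

Definition Ltime (r : \bar R) (T : R) (g : R -> \bar R) : Prop :=
  match r with
  | +oo%E => exists M : R, ae_on T (fun t => (g t <= M%:E)%E)
  | r'%:E => (\int[mu]_(t in timeI 0 T) (g t `^ r')%E < +oo)%E
  | -oo%E => False
  end.

Definition L_besov (chi vphi : pt -> R) (r q : \bar R) (T : R) (f : pt -> R -> R) : Prop :=
  ae_on T (fun t => besov_c chi vphi q (f^~ t)) /\
  Ltime r T (fun t => besov_norm chi vphi q (f^~ t)).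

Definition C_Lq (q : \bar R) (T : R) (f : pt -> R -> R) : Prop :=
  forall t0, 0 <= t0 <= T ->
    (fun t => Lq q (fun x => f x t - f x t0)) @ within (timeI 0 T) (nbhs t0) --> (0:R).

End Boussinesq.

(* Main.v *)
Require Import Defs.
From HB Require Import structures.
From mathcomp Require Import all_boot all_order all_algebra.
From mathcomp Require Import all_classical all_reals all_analysis.
From mathcomp Require Import measurable_realfun zify ring lra.
Import Order.TTheory GRing.Theory Num.Theory.
Import numFieldNormedType.Exports.
Local Open Scope classical_set_scope.
Local Open Scope ring_scope.
Set Implicit Arguments. Unset Strict Implicit. Unset Printing Implicit Defensive.

(** Mollify by convolution with the Jackson kernel of order [N = 2 ^ J]: it is nonnegative,
    even, of mass one and a trigonometric polynomial, so the Littlewood-Paley sum of a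
    mollified function is finite and Bernstein's inequality applies to every block.  Testing
    the weak formulation with [bump s * jackson N (x - y)] makes the mollified temperature
    [th_N] an integral in time, so that for smooth [b] the mean of [b(th_N)] changes by the
    time integral of the flux [sum_i int b''(th_N) d_i th_N (v_i th)_N].  Since [v_N] is
    divergence free, [(v_i th)_N] may be replaced by the Constantin-E-Titi commutator
    [(v_i th)_N - (v_i)_N th_N].  With [a_n] the weighted L^2 norms of the blocks of [th], [A]
    their supremum and [V] the Besov bound on [v], its L^2 norm is [O(V A N^(-2/3))], while
    that of [d_i th_N] is at most [C N^(2/3) sum_n 2^(-|n - J|/3) a_n].  The product tends to
    zero at almost every time because [a_n] does, and it is dominated by [C V A^2].
    The velocity is treated with the test field [K * K * v(tau)] frozen at time [tau], [K] the
    kernel, differentiating [int v_N(t) v_N(tau)] along the diagonal.  Finally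
    [b(z) = (z^2 + d)^(p/2)] with [d -> 0] gives finite [p], and the even moments determine
    the sup norm. *)

(** * Continuity and derivatives *)

Section ContinuousFun.
Variables (R : realType) (X Y Z : topologicalType).

Lemma continuous_fun_id : continuous (fun x : X => x).
Proof. by move=> x; exact: cvg_id. Qed.

Lemma continuous_fun_cst (c : Y) : continuous (fun _ : X => c).
Proof. by move=> x; exact: cst_continuous. Qed.

Lemma continuous_fun_pair (g : X -> Y) (h : X -> Z) :
  continuous g -> continuous h -> continuous (fun x => (g x, h x)).
Proof. by move=> cg ch x; apply: cvg_pair; [exact: cg|exact: ch]. Qed.

Lemma continuous_fun_fst (h : X -> Y * Z) :
  continuous h -> continuous (fun x => (h x).1).
Proof. by move=> ch x; apply: (cvg_comp h fst); [exact: ch|exact: cvg_fst]. Qed.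

Lemma continuous_fun_snd (h : X -> Y * Z) :
  continuous h -> continuous (fun x => (h x).2).
Proof. by move=> ch x; apply: (cvg_comp h snd); [exact: ch|exact: cvg_snd]. Qed.

Lemma continuous_fun_comp (g : Y -> Z) (h : X -> Y) :
  continuous g -> continuous h -> continuous (fun x => g (h x)).
Proof. by move=> cg ch x; apply: (cvg_comp h g); [exact: ch|exact: cg]. Qed.

Lemma continuous_funD (V : normedModType R) (f g : X -> V) :
  continuous f -> continuous g -> continuous (fun x => f x + g x).
Proof. by move=> cf cg x; apply: cvgD; [exact: cf|exact: cg]. Qed.

Lemma continuous_funN (V : normedModType R) (f : X -> V) :
  continuous f -> continuous (fun x => - f x).
Proof. by move=> cf x; apply: cvgN; exact: cf. Qed.

Lemma continuous_funZ (V : normedModType R) (f : X -> R) (g : X -> V) :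
  continuous f -> continuous g -> continuous (fun x => f x *: g x).
Proof. by move=> cf cg x; apply: cvgZ; [exact: cf|exact: cg]. Qed.

Lemma continuous_funM (f g : X -> R) :
  continuous f -> continuous g -> continuous (fun x => f x * g x).
Proof. by move=> cf cg x; apply: cvgM; [exact: cf|exact: cg]. Qed.

Lemma continuous_fun_norm (f : X -> R) : continuous f -> continuous (fun x => `|f x|).
Proof. by move=> cf x; apply: cvg_norm; exact: cf. Qed.

Lemma continuous_funX (f : X -> R) n : continuous f -> continuous (fun x => f x ^+ n).
Proof.
move=> cf; elim: n => [|n IH] x; first exact: cvg_cst.
by under eq_fun do rewrite exprS; apply: cvgM; [exact: cf|exact: IH].
Qed.

Lemma continuous_fun_sum (I : Type) (r : seq I) (F : I -> X -> R) :
  (forall i, continuous (F i)) -> continuous (fun x => \sum_(i <- r) F i x).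
Proof. by move=> cF; apply: continuous_big => //; exact: add_continuous. Qed.

Lemma continuous_fun_prod (I : Type) (r : seq I) (F : I -> X -> R) :
  (forall i, continuous (F i)) -> continuous (fun x => \prod_(i <- r) F i x).
Proof. by move=> cF; apply: continuous_big => //; exact: mul_continuous. Qed.

Lemma continuous_fun_coord n (f : X -> 'rV[R]_n.+1) i :
  continuous f -> continuous (fun x => f x 0 i).
Proof.
by move=> cf x; apply: (cvg_comp f (fun y => y 0 i)); [exact: cf|exact: coord_continuous].
Qed.

Lemma continuous_fun_cos (f : X -> R) : continuous f -> continuous (fun x => cos (f x)).
Proof. by move=> cf x; apply: (cvg_comp f cos); [exact: cf|exact: continuous_cos]. Qed.

Lemma continuous_fun_sin (f : X -> R) : continuous f -> continuous (fun x => sin (f x)).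
Proof. by move=> cf x; apply: (cvg_comp f sin); [exact: cf|exact: continuous_sin]. Qed.

End ContinuousFun.

Lemma continuous_fun_comp2 (X Y Z V : topologicalType) (g : Y -> Z -> V) (h : X -> Y) (k : X -> Z) :
  continuous (fun p : Y * Z => g p.1 p.2) -> continuous h -> continuous k ->
  continuous (fun x => g (h x) (k x)).
Proof.
move=> cg ch ck.
apply: (@continuous_fun_comp _ _ _ (fun p : Y * Z => g p.1 p.2) (fun x => (h x, k x))) => //.
exact: continuous_fun_pair.
Qed.

Lemma continuous_slice (X Y Z : topologicalType) (F : X -> Y -> Z) (x : X) :
  continuous (fun p : X * Y => F p.1 p.2) -> continuous (F x).
Proof. by move=> cF; apply: (continuous_fun_comp2 cF) => y; [exact: cvg_cst|exact: cvg_id]. Qed.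

Section Vectors.
Variable R : realType.
Local Notation pt := 'rV[R]_3.

Lemma ord3P (P : 'I_3 -> Prop) : P ord0 -> P (lift ord0 ord0) -> P ord_max -> forall i, P i.
Proof.
move=> P0 P1 P2 i; case: i => -[|[|[|i]]] Hi //.
- by rewrite (_ : Ordinal Hi = ord0) //; apply: val_inj.
- by rewrite (_ : Ordinal Hi = lift ord0 ord0) //; apply: val_inj.
- by rewrite (_ : Ordinal Hi = ord_max) //; apply: val_inj.
Qed.

Lemma big_ord3 (F : 'I_3 -> R) :
  \sum_(i < 3) F i = F ord0 + F (lift ord0 ord0) + F ord_max.
Proof.
rewrite !big_ord_recl big_ord0 addr0 addrA; congr (_ + _ + F _); exact: val_inj.
Qed.

Lemma vec3_coord (x : pt) : x = vec3 (x 0 ord0) (x 0 (lift ord0 ord0)) (x 0 ord_max).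
Proof. by apply/rowP; elim/ord3P; rewrite !mxE. Qed.

Lemma vec3_basis (a b c : R) :
  vec3 a b c = a *: e3 R ord0 + b *: e3 R (lift ord0 ord0) + c *: e3 R ord_max.
Proof. by apply/rowP; elim/ord3P; rewrite !mxE /= ?mulr1 ?mulr0 ?addr0 ?add0r. Qed.

Lemma vec3D (x : pt) (a b c : R) :
  vec3 a b c + x = vec3 (a + x 0 ord0) (b + x 0 (lift ord0 ord0)) (c + x 0 ord_max).
Proof. by apply/rowP; elim/ord3P; rewrite !mxE. Qed.

Lemma continuous_fun_vec3 (X : topologicalType) (f g h : X -> R) :
  continuous f -> continuous g -> continuous h ->
  continuous (fun x => vec3 (f x) (g x) (h x)).
Proof.
move=> cf cg ch; under eq_fun do rewrite vec3_basis.
by do ![apply: continuous_funD|apply: continuous_funZ|exact: continuous_fun_cst|done].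
Qed.

End Vectors.

Section Periodic.
Variable R : realType.
Local Notation pt := 'rV[R]_3.

Definition cperiodic (f : pt -> R) : Prop := continuous f /\ periodic3 f.

Definition cperiodic_flow (f : pt -> R -> R) : Prop :=
  continuous (fun p : pt * R => f p.1 p.2) /\ forall s, periodic3 (f^~ s).

Lemma cperiodic_at (f : pt -> R -> R) s : cperiodic_flow f -> cperiodic (f^~ s).
Proof.
move=> [cf pf]; split; last exact: pf.
by apply: (continuous_fun_comp2 cf); [exact: continuous_fun_id|exact: continuous_fun_cst].
Qed.

End Periodic.

Create HintDb continuity.

Ltac continuity_known :=
  first
  [ match goal with
    | H : continuous ?f |- continuous ?f => exact: H
    | H : cperiodic ?f |- continuous ?f => exact: (proj1 H)
    | H : cperiodic_flow ?f |- continuous (fun z => ?f z.1 z.2) => exact: (proj1 H)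
    | H : forall i, continuous (?f i) |- continuous (?f ?j) => exact: (H j)
    | H : forall i, cperiodic (?f i) |- continuous (?f ?j) => exact: (proj1 (H j))
    | H : forall i, continuous (fun z => ?f i z.1 z.2) |- continuous (fun z => ?f ?j z.1 z.2) =>
        exact: (H j)
    | H : forall i, cperiodic_flow (?f i) |- continuous (fun z => ?f ?j z.1 z.2) =>
        exact: (proj1 (H j))
    end
  | solve [auto 3 with continuity nocore] ].

(* A hook, redefined once the integrals depending on a parameter are known to be continuous. *)
Ltac continuity_integral := fail.

Ltac continuity_step :=
  lazymatch goal with
  | |- continuous (fun x => x) => exact: continuous_fun_id
  | |- continuous (fun _ => ?c) => exact: continuous_fun_cst
  | |- continuous fst => by move=> ?; exact: cvg_fst
  | |- continuous snd => by move=> ?; exact: cvg_snd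
  | |- continuous (fun _ => (_, _)) => apply: continuous_fun_pair
  | |- continuous (fun _ => fst _) => apply: continuous_fun_fst
  | |- continuous (fun _ => snd _) => apply: continuous_fun_snd
  | |- continuous (fun _ => GRing.add _ _) => apply: continuous_funD
  | |- continuous (fun _ => GRing.opp _) => apply: continuous_funN
  | |- continuous (fun _ => GRing.scale _ _) => apply: continuous_funZ
  | |- continuous (fun _ => GRing.mul _ _) => apply: continuous_funM
  | |- continuous (fun _ => GRing.exp _ _) => apply: continuous_funX
  | |- continuous (fun _ => Num.norm _) => apply: continuous_fun_norm
  | |- continuous (fun _ => \sum_(i <- _) _) => apply: continuous_fun_sum => ?
  | |- continuous (fun _ => \prod_(i <- _) _) => apply: continuous_fun_prod => ?
  | |- continuous (fun _ => fun_of_matrix _ _ _) => apply: continuous_fun_coord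
  | |- continuous (fun _ => vec3 _ _ _) => apply: continuous_fun_vec3
  | |- continuous (fun _ => cos _) => apply: continuous_fun_cos
  | |- continuous (fun _ => sin _) => apply: continuous_fun_sin
  | |- _ => first
      [ continuity_known
      | continuity_integral
      | match goal with
        | |- continuous (fun x => ?f (@?h x)) =>
            let cf := fresh in
            have cf : continuous f; [continuity_known|];
            apply: (@continuous_fun_comp _ _ _ f h cf); clear cf
        | |- continuous (fun x => ?f (@?h x) (@?k x)) =>
            let cf := fresh in
            match type of f with
            | ?Y -> ?Z -> _ => have cf : continuous (fun z : Y * Z => f z.1 z.2)
            end; [continuity_known|];
            apply: (@continuous_fun_comp2 _ _ _ _ f h k cf); clear cf
        end
      | lazymatch goal with
        | |- continuous (fun _ => _) => fail
        | |- continuous ?f => change (continuous (fun z => f z))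
        end ]
  end.

Ltac continuity := repeat continuity_step.

(* [is_derive] without its type-class behaviour *)
Definition has_derive (R : realType) (V : normedModType R) (f : V -> R) (x v : V) (l : R) : Prop :=
  is_derive x v f l.

Definition is_deriv (R : realType) (f df : R -> R) : Prop :=
  forall x : R, has_derive f x (1 : R) (df x).

Section HasDerive.
Variables (R : realType) (V : normedModType R).
Implicit Types (f g : V -> R) (x v : V).

Lemma has_derive_cst (c : R) x v : has_derive (fun _ => c) x v 0.
Proof. exact: is_derive_cst. Qed.

Lemma has_deriveD f g x v a b :
  has_derive f x v a -> has_derive g x v b -> has_derive (fun y => f y + g y) x v (a + b).
Proof. exact: is_deriveD. Qed.

Lemma has_deriveN f x v a : has_derive f x v a -> has_derive (fun y => - f y) x v (- a).
Proof. exact: is_deriveN. Qed.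

Lemma has_deriveM f g x v a b :
  has_derive f x v a -> has_derive g x v b ->
  has_derive (fun y => f y * g y) x v (a * g x + f x * b).
Proof.
by move=> da db; rewrite addrC [X in _ + X]mulrC; exact: (@is_deriveM _ _ f g x v a b da db).
Qed.

Lemma has_deriveZ f x v a c : has_derive f x v a -> has_derive (fun y => c * f y) x v (c * a).
Proof. by move=> da; exact: (@is_deriveZ _ _ _ f c x v a da). Qed.

Lemma has_derive_sum n (F : 'I_n -> V -> R) (dF : 'I_n -> R) x v :
  (forall i, has_derive (F i) x v (dF i)) ->
  has_derive (fun y => \sum_(i < n) F i y) x v (\sum_(i < n) dF i).
Proof.
move=> FdF; have -> : (fun y => \sum_(i < n) F i y) = \sum_(i < n) F i.
  by apply: funext => y; rewrite fct_sumE.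
exact: is_derive_sum.
Qed.

Lemma has_derive_derivable f x v l : has_derive f x v l -> derivable f x v.
Proof. by case. Qed.

Lemma has_derive_val f x v l : has_derive f x v l -> 'D_v f x = l.
Proof. by case. Qed.

Lemma has_derive_unique f x v a b : has_derive f x v a -> has_derive f x v b -> a = b.
Proof. by move=> [_ <-] [_ <-]. Qed.

Lemma has_derive_slope_near f x v (q : R -> R) :
  (\forall h \near (0 : R), f (h *: v + x) - f x = h * q h) -> {for 0, continuous q} ->
  has_derive f x v (q 0).
Proof.
move=> fq cq.
have slope_cvg : (fun h : R => h^-1 *: (f (h *: v + x) - f x)) @ 0^' --> q 0.
  apply: (@cvg_trans _ (q @ 0^')); last exact: cvg_within_filter.
  apply: near_eq_cvg; near=> h.
  have -> : f (h *: v + x) - f x = h * q h by near: h; exact: nbhs_dnbhs.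
  rewrite /GRing.scale /= mulrA mulVf ?mul1r //.
  by near: h; exact: nbhs_dnbhs_neq.
split; first by apply/cvg_ex; exists (q 0).
exact: cvg_lim slope_cvg.
Unshelve. all: by end_near. Qed.

Lemma has_derive_slope f x v (q : R -> R) :
  (forall h, f (h *: v + x) - f x = h * q h) -> {for 0, continuous q} ->
  has_derive f x v (q 0).
Proof. by move=> fq; apply: has_derive_slope_near; exact: filterE. Qed.

Lemma has_derive_line f x v (l : R) :
  has_derive (fun s : R => f (s *: v + x)) 0 (1 : R) l <-> has_derive f x v l.
Proof.
have quotientE : (fun h : R =>
    h^-1 *: (((fun s : R => f (s *: v + x)) \o shift (0 : R)) (h *: (1 : R)) - f (0 *: v + x)))
  = (fun h : R => h^-1 *: ((f \o shift x) (h *: v) - f x)).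
  by apply: funext => h /=; rewrite addr0 [h *: 1]mulr1 scale0r add0r.
split => -[d e]; split.
- by move: d; rewrite /derivable quotientE.
- by move: e; rewrite /derive quotientE.
- by rewrite /derivable quotientE.
- by rewrite /derive quotientE.
Qed.

End HasDerive.

Section Deriv.
Variable R : realType.
Implicit Types (f g df : R -> R) (x : R).

Lemma has_derive_id x : has_derive (fun y => y) x (1 : R) 1.
Proof. exact: is_derive_id. Qed.

Lemma has_derive_comp f g x (a b : R) :
  has_derive f x (1 : R) a -> has_derive g (f x) (1 : R) b ->
  has_derive (fun y => g (f y)) x (1 : R) (b * a).
Proof. by move=> fa gb; exact: (@is_derive1_comp _ g f x b a gb fa). Qed.

Lemma has_derive_expn n x : has_derive (fun z : R => z ^+ n) x (1 : R) (n%:R * x ^+ n.-1).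
Proof.
elim: n => [|n IH]; first by rewrite mul0r; exact: has_derive_cst.
have -> : n.+1%:R * x ^+ n.+1.-1 = 1 * x ^+ n + x * (n%:R * x ^+ n.-1).
  rewrite -natr1 /=; case: n IH => [|n] IH /=; first by ring.
  by rewrite [X in _ = _ + X]mulrCA -exprS; ring.
have := has_deriveM (has_derive_id x) IH; congr has_derive.
by apply: funext => y; rewrite exprS.
Qed.

Lemma has_derive_inv f x (a : R) : f x != 0 -> has_derive f x (1 : R) a ->
  has_derive (fun y => (f y)^-1) x (1 : R) (- (f x) ^- 2 * a).
Proof. by move=> fx [d <-]; split; [exact: derivableV|exact: deriveV]. Qed.

Lemma has_derive_affine (s h x : R) : has_derive (fun y : R => s + y * h) x (1 : R) h.
Proof.
rewrite -[X in has_derive _ _ _ X](_ : 0 + (1 * h + x * 0) = h); last by ring.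
by apply: has_deriveD; [|apply: has_deriveM; [exact: has_derive_id|]]; exact: has_derive_cst.
Qed.

Lemma has_derive_cos f x (a : R) : has_derive f x (1 : R) a ->
  has_derive (fun y => cos (f y)) x (1 : R) (- sin (f x) * a).
Proof. by move=> fa; apply: (has_derive_comp fa); exact: is_derive_cos. Qed.

Lemma has_derive_sin f x (a : R) : has_derive f x (1 : R) a ->
  has_derive (fun y => sin (f y)) x (1 : R) (cos (f x) * a).
Proof. by move=> fa; apply: (has_derive_comp fa); exact: is_derive_sin. Qed.

Lemma is_deriv_continuous f df : is_deriv f df -> continuous f.
Proof.
by move=> fdf x; apply: differentiable_continuous; apply/derivable1_diffP; case: (fdf x).
Qed.

End Deriv.

(** * Integrals of continuous functions *)

(* Locked: conversion would otherwise unfold the Lebesgue integral. *)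
HB.lock Definition segint (R : realType) (a b : R) (f : R -> R) : R :=
  \int[@lebesgue_measure R]_(x in timeI a b) f x.
Arguments segint {R}.

Section SegmentIntegral.
Variable R : realType.
Local Notation mu := (@lebesgue_measure R).
Implicit Types (a b c : R) (f g : R -> R).

Lemma segintE a b f : segint a b f = \int[mu]_(x in timeI a b) f x.
Proof. by rewrite segint.unlock. Qed.

Lemma timeIE a b : timeI a b = `[a, b]%classic.
Proof. by apply/seteqP; split=> x /=; rewrite /timeI /= in_itv. Qed.

Lemma measurable_timeI a b : measurable (timeI a b).
Proof. by rewrite timeIE; exact: measurable_itv. Qed.

Lemma compact_timeI a b : compact (timeI a b).
Proof. by rewrite timeIE; exact: segment_compact. Qed.

Lemma continuous_integrable_timeI a b f :
  continuous f -> mu.-integrable (timeI a b) (EFin \o f).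
Proof.
move=> cf; rewrite timeIE; apply: continuous_compact_integrable; first exact: segment_compact.
exact: continuous_subspaceT.
Qed.

Lemma eq_segint a b f g : (forall x, a <= x <= b -> f x = g x) -> segint a b f = segint a b g.
Proof. by move=> fg; rewrite !segintE; apply: eq_Rintegral => x /[!inE] /= ?; apply: fg. Qed.

Lemma segint_set1 a f : segint a a f = 0.
Proof. by rewrite segintE timeIE set_itv1 Rintegral_set1. Qed.

Lemma segintD a b f g : continuous f -> continuous g ->
  segint a b (fun x => f x + g x) = segint a b f + segint a b g.
Proof.
move=> cf cg; rewrite !segintE.
by apply: RintegralD; [exact: measurable_timeI| |]; exact: continuous_integrable_timeI.
Qed.

Lemma segintZl a b c f : continuous f -> segint a b (fun x => c * f x) = c * segint a b f.
Proof.
move=> cf; rewrite !segintE.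
by apply: RintegralZl; [exact: measurable_timeI|exact: continuous_integrable_timeI].
Qed.

Lemma le_segint a b f g : continuous f -> continuous g ->
  (forall x, a <= x <= b -> f x <= g x) -> segint a b f <= segint a b g.
Proof.
move=> cf cg fg; rewrite !segintE; apply: le_Rintegral => //; first exact: measurable_timeI.
- exact: continuous_integrable_timeI.
- exact: continuous_integrable_timeI.
Qed.

Lemma segint_FTC a b f F : a <= b -> continuous f -> continuous F ->
  (forall x : R, a < x < b -> has_derive F x (1 : R) (f x)) -> segint a b f = F b - F a.
Proof.
rewrite le_eqVlt => /predU1P[<-|ab] cf cF dF; first by rewrite segint_set1 subrr.
rewrite segintE /Rintegral timeIE (@continuous_FTC2 _ f F a b) //.
- exact: continuous_subspaceT.
- split; first by move=> x; rewrite in_itv /= => /dF [].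
  + by apply: cvg_at_right_filter; exact: cF.
  + by apply: cvg_at_left_filter; exact: cF.
- by move=> x; rewrite in_itv /= => /dF [? <-]; rewrite derive1E.
Qed.

Lemma segint_deriv a b f F : a <= b -> continuous f -> is_deriv F f ->
  segint a b f = F b - F a.
Proof. by move=> ab cf dF; apply: segint_FTC => //; exact: is_deriv_continuous dF. Qed.

Lemma segint_cst a b c : a <= b -> segint a b (fun _ => c) = c * (b - a).
Proof.
move=> ab; rewrite (@segint_deriv a b _ (fun x => 0 + x * c)) //.
- by rewrite !add0r mulrBr ![c * _]mulrC.
- exact: continuous_fun_cst.
- exact: has_derive_affine.
Qed.

Lemma segint01_cst c : segint 0 1 (fun _ => c) = c.
Proof. by rewrite segint_cst // subr0 mulr1. Qed.

Lemma has_derive_segint a x f :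
  continuous f -> a < x -> has_derive (fun t => segint a t f) x (1 : R) (f x).
Proof.
move=> cf ax; have := @continuous_FTC1_closed R f a x (x + 1).
have -> : (fun t => (\int[mu]_(t0 in `[a, t]) f t0)) = (fun t => segint a t f).
  by apply: funext => t; rewrite segintE timeIE.
move=> [] //; [by rewrite ltrDl|rewrite -timeIE; exact: continuous_integrable_timeI|exact: cf|].
by move=> d; rewrite derive1E => e; split.
Qed.

Lemma segintB a b x f : continuous f -> a <= x -> x <= b ->
  segint a b f - segint a x f = segint x b f.
Proof.
move=> cf ax xb; rewrite !segintE !timeIE Rintegral_itvB //; last first.
  by rewrite -timeIE; exact: continuous_integrable_timeI.
rewrite Rintegral_itv_obnd_cbnd //.
apply: (@integrableS _ _ _ mu (timeI x b)); last exact: continuous_integrable_timeI.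
- exact: measurable_timeI.
- exact: measurable_itv.
- by rewrite timeIE; apply: subset_itvr; rewrite bnd_simp.
Qed.

Lemma ex_primitive f : continuous f -> exists F, is_deriv F f.
Proof.
move=> cf; pose F t := if 0 <= t then segint 0 t f else - segint t 0 f.
exists F => x; pose B := `|x| + 1.
have Bx : - B < x by rewrite /B; have := ler_norm (- x); rewrite normrN; lra.
have B0 : - B <= 0 by rewrite /B; have := normr_ge0 x; lra.
have near_F : \forall t \near x, segint (- B) t f - segint (- B) 0 f = F t.
  near=> t; have Bt : - B < t by near: t; exact: lt_nbhsr.
  rewrite /F; case: ifPn => t0; first by rewrite segintB.
  by rewrite -[RHS]/(- segint t 0 f) -(@segintB (- B) 0 t) ?opprB // ltW // ltNge.
apply: (near_eq_is_derive near_F); rewrite -[X in is_derive _ _ _ X]addr0.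
exact: has_deriveD (has_derive_segint cf Bx) (has_derive_cst (- segint (- B) 0 f) x (1 : R)).
Unshelve. all: by end_near. Qed.

Lemma segint_slope f F s h : continuous f -> is_deriv F f ->
  F (s + h) - F s = h * segint 0 1 (fun y => f (s + y * h)).
Proof.
move=> cf dF; have cfa : continuous (fun y : R => f (s + y * h)) by continuity.
rewrite -segintZl // (@segint_deriv 0 1 _ (fun y => F (s + y * h))) ?ler01 //.
- by rewrite mul1r mul0r addr0.
- by continuity.
- by move=> x; rewrite mulrC; apply: has_derive_comp; [exact: has_derive_affine|exact: dF].
Qed.

(* The primitive vanishing at [0]; unlike [segint 0 t f] it is meaningful for negative [t]. *)
Definition primitive f t : R := t * segint 0 1 (fun s => f (s * t)).

Lemma primitiveE f F t : continuous f -> is_deriv F f -> primitive f t = F t - F 0.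
Proof.
move=> cf dF; rewrite -[t in F t]add0r (segint_slope _ _ cf dF); congr (_ * _).
by apply: eq_segint => s _; rewrite add0r.
Qed.

Lemma is_deriv_primitive f : continuous f -> is_deriv (primitive f) f.
Proof.
move=> cf x; have [F dF] := ex_primitive cf.
have -> : primitive f = (fun t => F t - F 0) by apply: funext => t; exact: primitiveE.
by rewrite -[f x]addr0; apply: has_deriveD; [exact: dF|exact: has_derive_cst].
Qed.

Lemma segint_primitive a b f : a <= b -> continuous f ->
  segint a b f = primitive f b - primitive f a.
Proof. by move=> ab cf; apply: segint_deriv => //; exact: is_deriv_primitive. Qed.

Lemma segint_shift f h : continuous f -> (forall x, f (x + 1) = f x) ->
  segint 0 1 (fun x => f (x + h)) = segint 0 1 f.
Proof.
move=> cf pf; pose F := primitive f; have dF : is_deriv F f := is_deriv_primitive cf.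
have FE s : F (s + 1) - F s = segint 0 1 (fun x => f (x + s)).
  rewrite (segint_slope _ _ cf dF) mul1r; apply: eq_segint => x _.
  by rewrite mulr1 addrC.
rewrite -FE; have -> : segint 0 1 f = F (0 + 1) - F 0.
  by rewrite FE; apply: eq_segint => x _; rewrite addr0.
apply: (is_derive_0_is_cst (f := fun s => F (s + 1) - F s)) => s.
have -> : 0 = f (s + 1) * 1 - f s :> R by rewrite pf mulr1 subrr.
apply: has_deriveD; last by apply: has_deriveN; exact: dF.
apply: (@has_derive_comp R (fun s => s + 1) F); last exact: dF.
by rewrite -[X in has_derive _ _ _ X]addr0; apply: has_deriveD;
  [exact: has_derive_id|exact: has_derive_cst].
Qed.

Lemma near_uniform_compact (X Y : topologicalType) (F : X -> Y -> R) (K : set Y) x0 (e : R) :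
  compact K -> continuous (fun p : X * Y => F p.1 p.2) -> 0 < e ->
  \forall x \near x0, forall y, K y -> `|F x y - F x0 y| <= e.
Proof.
move=> cK cF e0.
apply: (proj1 (compact_near_coveringP K) cK X (nbhs x0) (fun x y => `|F x y - F x0 y| <= e)).
move=> y Ky; have e2 : 0 < e / 2 by rewrite divr_gt0.
have cF' : continuous (fun p : Y * X => F p.2 p.1) by continuity.
have cF0 : continuous (fun p : Y * X => F x0 p.1) by continuity.
have /cvgrPdist_lt/(_ _ e2) := cF' (y, x0).
have /cvgrPdist_lt/(_ _ e2) := cF0 (y, x0).
apply: filterS2 => -[y' x'] /= close0 close.
rewrite (_ : _ - _ = (F x0 y - F x0 y') - (F x0 y - F x' y')); last by ring.
by apply: le_trans (ler_normB _ _) _; rewrite (splitr e); apply: lerD; exact: ltW.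
Qed.

Lemma segint_norm_le a b (M : R) f : a <= b -> continuous f ->
  (forall x, a <= x <= b -> `|f x| <= M) -> `|segint a b f| <= M * (b - a).
Proof.
move=> ab cf fM; rewrite ler_norml -mulNr -!segint_cst //; apply/andP; split.
- by apply: le_segint; [continuity|by []|move=> x /fM; rewrite ler_norml => /andP[]].
- by apply: le_segint; [by []|continuity|move=> x /fM; rewrite ler_norml => /andP[]].
Qed.

Lemma continuous_segint (X : topologicalType) a b (F : X -> R -> R) : a <= b ->
  continuous (fun p : X * R => F p.1 p.2) -> continuous (fun x => segint a b (F x)).
Proof.
move=> ab cF x0; apply/cvgrPdist_le => e e0.
have ba1 : 0 < b - a + 1 by rewrite ltr_wpDl // subr_ge0.
have e1 : 0 < e / (b - a + 1) by rewrite divr_gt0.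
have cFx x : continuous (F x) by exact: continuous_slice cF.
have := near_uniform_compact x0 (@compact_timeI a b) cF e1; apply: filterS => x close.
rewrite distrC -mulN1r -segintZl // -segintD //; last by continuity.
apply: le_trans (segint_norm_le ab _ (M := e / (b - a + 1)) _) _.
- by continuity.
- by move=> t abt; rewrite mulN1r; exact: close.
- by rewrite mulrAC ler_pdivrMr // ler_wpM2l ?lerDl // ltW.
Qed.

End SegmentIntegral.
(* [L] is integration against a compactly supported measure: a positive linear functional on
   continuous functions under which continuous dependence on a parameter is preserved. *)
Record radon (R : realType) (X : topologicalType) (L : (X -> R) -> R) : Prop := Radon {
  radonD : forall f g : X -> R, continuous f -> continuous g -> L (fun x => f x + g x) = L f + L g;
  radonZl : forall (c : R) (f : X -> R), continuous f -> L (fun x => c * f x) = c * L f;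
  le_radon : forall f g : X -> R, continuous f -> continuous g ->
    (forall x, f x <= g x) -> L f <= L g;
  continuous_radon : forall (Y : topologicalType) (F : Y -> X -> R),
    continuous (fun p : Y * X => F p.1 p.2) -> continuous (fun y => L (F y))
}.

Lemma quadratic_form_ge0_discr (R : realFieldType) (a b c : R) : 0 <= a -> 0 <= c ->
  (forall s, 0 <= a - 2 * s * b + s ^+ 2 * c) -> b ^+ 2 <= a * c.
Proof.
rewrite [0 <= c]le_eqVlt => a0 /predU1P[<-|c0] form_ge0.
  rewrite mulr0; have [->|b0] := eqVneq b 0; first by rewrite expr0n.
  have := form_ge0 ((a + 1) / (2 * b)); rewrite mulr0 addr0.
  by rewrite (_ : 2 * _ * b = a + 1); [lra|field].
have := form_ge0 (b / c).
have -> : a - 2 * (b / c) * b + (b / c) ^+ 2 * c = (a * c - b ^+ 2) / c.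
  by field; exact: lt0r_neq0.
by rewrite pmulr_lge0 ?invr_gt0 // subr_ge0.
Qed.

Section Radon.
Variables (R : realType) (X : topologicalType) (L : (X -> R) -> R).
Hypothesis radonL : radon L.
Implicit Types f g w : X -> R.

Lemma radon0 : L (fun _ => 0) = 0.
Proof.
have -> : (fun _ : X => 0) = (fun _ => 0 * 0) :> (X -> R) by apply: funext => x; rewrite mul0r.
by rewrite (radonZl radonL) ?mul0r //; continuity.
Qed.

Lemma radonN f : continuous f -> L (fun x => - f x) = - L f.
Proof.
by move=> cf; rewrite -mulN1r -(radonZl radonL) //; congr L; apply: funext => x; rewrite mulN1r.
Qed.

Lemma radonB f g : continuous f -> continuous g -> L (fun x => f x - g x) = L f - L g.
Proof. by move=> cf cg; rewrite (radonD radonL) ?radonN //; continuity. Qed.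

Lemma radon_sum (I : Type) (r : seq I) (F : I -> X -> R) : (forall i, continuous (F i)) ->
  L (fun x => \sum_(i <- r) F i x) = \sum_(i <- r) L (F i).
Proof.
move=> cF; elim: r => [|i r IH].
  by rewrite big_nil -[RHS]radon0; congr L; apply: funext => x; rewrite big_nil.
rewrite big_cons -IH -(radonD radonL) //; last by continuity.
by congr L; apply: funext => x; rewrite big_cons.
Qed.

Lemma radon_ge0 f : continuous f -> (forall x, 0 <= f x) -> 0 <= L f.
Proof. by move=> cf f0; rewrite -radon0; apply: (le_radon radonL) => //; continuity. Qed.

Lemma radon_norm f : continuous f -> `|L f| <= L (fun x => `|f x|).
Proof.
move=> cf; rewrite ler_norml; apply/andP; split.
  rewrite lerNl -radonN //; apply: (le_radon radonL); [continuity|continuity|move=> x].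
  by rewrite -normrN ler_norm.
by apply: (le_radon radonL); [continuity|continuity|move=> x; exact: ler_norm].
Qed.

Lemma radon_CauchySchwarz w f g : continuous w -> continuous f -> continuous g ->
  (forall x, 0 <= w x) ->
  (L (fun x => w x * (f x * g x))) ^+ 2 <=
  L (fun x => w x * f x ^+ 2) * L (fun x => w x * g x ^+ 2).
Proof.
move=> cw cf cg w0; apply: quadratic_form_ge0_discr => [||s].
- by apply: radon_ge0 => [|x]; [continuity|rewrite mulr_ge0 // sqr_ge0].
- by apply: radon_ge0 => [|x]; [continuity|rewrite mulr_ge0 // sqr_ge0].
- have : 0 <= L (fun x => w x * (f x - s * g x) ^+ 2).
    by apply: radon_ge0 => [|x]; [continuity|rewrite mulr_ge0 // sqr_ge0].
  have -> : (fun x => w x * (f x - s * g x) ^+ 2) = (fun x => w x * f x ^+ 2 +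
      ((- (2 * s)) * (w x * (f x * g x)) + s ^+ 2 * (w x * g x ^+ 2))).
    by apply: funext => x; ring.
  by rewrite !(radonD radonL) ?(radonZl radonL) ?mulNr ?addrA //; continuity.
Qed.

Lemma has_derive_radon (F dF : R -> X -> R) :
  (forall y, is_deriv (F^~ y) (dF^~ y)) ->
  continuous (fun p : R * X => F p.1 p.2) -> continuous (fun p : R * X => dF p.1 p.2) ->
  is_deriv (fun s => L (F s)) (fun s => L (dF s)).
Proof.
move=> derF cF cdF s; pose Q h y := segint 0 1 (fun r => dF (s + r * h) y).
have -> : L (dF s) = L (Q 0).
  congr L; apply: funext => y; rewrite -[LHS]segint01_cst.
  by apply: eq_segint => r _; rewrite mulr0 addr0.
have cQ : continuous (fun p : R * X => Q p.1 p.2).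
  apply: (@continuous_segint _ (R * X)%type 0 1 (fun p r => dF (s + r * p.1) p.2)) => //.
  by continuity.
apply: (@has_derive_slope _ _ (fun s => L (F s)) s 1 (fun h => L (Q h))).
  move=> h; rewrite -(radonZl radonL); last exact: continuous_slice cQ.
  have cFs r : continuous (F r) by exact: continuous_slice cF.
  rewrite -radonB //; congr L; apply: funext => y; rewrite [_ *: _]mulr1 (addrC h).
  by apply: (segint_slope (f := fun s => dF s y) (F := F^~ y)) => //; continuity.
exact: (continuous_radon radonL cQ).
Qed.

Lemma radon_segint a b (F : X -> R -> R) : a <= b -> continuous (fun p : X * R => F p.1 p.2) ->
  L (fun x => segint a b (F x)) = segint a b (fun s => L (F^~ s)).
Proof.
move=> ab cF; have cFx x : continuous (F x) := continuous_slice cF.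
pose P t x := primitive (F x) t.
have cP : continuous (fun p : R * X => P p.1 p.2).
  apply: continuous_funM; first by continuity.
  apply: (@continuous_segint _ (R * X)%type 0 1 (fun p s => F p.2 (s * p.1))) => //.
  by continuity.
have cPt t : continuous (P t) := continuous_slice cP.
have dP : is_deriv (fun t => L (P t)) (fun t => L (F^~ t)).
  apply: has_derive_radon => // [x|]; first exact: is_deriv_primitive.
  by continuity.
have -> : (fun x => segint a b (F x)) = (fun x => P b x - P a x).
  by apply: funext => x; rewrite segint_primitive.
rewrite radonB // (segint_deriv ab _ dP) //.
by apply: (continuous_radon radonL); continuity.
Qed.

End Radon.

Section RadonInstances.
Variables (R : realType) (X Y : topologicalType).

Lemma radon_eval (x : X) : radon (fun f : X -> R => f x).
Proof. by split => // Z F cF z; apply: (continuous_fun_comp2 cF); continuity. Qed.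

Lemma segint_is_radon (a b : R) : a <= b -> radon (segint a b).
Proof.
move=> ab; split => [||f g cf cg fg|Z F].
- exact: segintD.
- by move=> c f; exact: segintZl.
- by apply: le_segint => // x _.
- exact: continuous_segint.
Qed.

Lemma radon_pushforward (phi : X -> Y) (L : (X -> R) -> R) :
  continuous phi -> radon L -> radon (fun f : Y -> R => L (fun x => f (phi x))).
Proof.
move=> cphi rL; split => [f g cf cg|c f cf|f g cf cg fg|Z F cF].
- by rewrite (radonD rL) //; exact: continuous_fun_comp.
- by rewrite (radonZl rL) //; exact: continuous_fun_comp.
- by apply: (le_radon rL) => //; exact: continuous_fun_comp.
- by apply: (continuous_radon rL (F := fun z x => F z (phi x))); continuity.
Qed.

Lemma radon_product (L : (X -> R) -> R) (M : (Y -> R) -> R) :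
  radon L -> radon M -> radon (fun f : X * Y -> R => L (fun x => M (fun y => f (x, y)))).
Proof.
move=> rL rM.
have cM (f : X * Y -> R) : continuous f -> continuous (fun x => M (fun y => f (x, y))).
  by move=> cf; apply: (continuous_radon rM (F := fun x y => f (x, y))); continuity.
have cf_ x (f : X * Y -> R) : continuous f -> continuous (fun y => f (x, y)).
  by move=> cf; continuity.
split => [f g cf cg|c f cf|f g cf cg fg|Z F cF].
- rewrite -(radonD rL); [|exact: cM|exact: cM].
  by congr L; apply: funext => x; rewrite (radonD rM) //; exact: cf_.
- rewrite -(radonZl rL); last exact: cM.
  by congr L; apply: funext => x; rewrite (radonZl rM) //; exact: cf_.
- apply: (le_radon rL); [exact: cM|exact: cM|move=> x].
  by apply: (le_radon rM) => //; exact: cf_.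
- apply: (continuous_radon rL (F := fun z x => M (fun y => F z (x, y)))).
  by apply: (continuous_radon rM (F := fun p y => F p.1 (p.2, y))); continuity.
Qed.

End RadonInstances.

HB.lock Definition torint (R : realType) (f : 'rV[R]_3 -> R) : R := intT3 f.
Arguments torint {R}.

Section TorusIntegral.
Variable R : realType.
Local Notation pt := 'rV[R]_3.
Implicit Types (f g : pt -> R).

Lemma torintE f : torint f = intT3 f.
Proof. by rewrite torint.unlock. Qed.

Lemma segint_torintE (a b : R) (F : R -> 'rV[R]_3 -> R) :
  segint a b (fun s => torint (F s)) = \int[@lebesgue_measure R]_(s in timeI a b) intT3 (F s).
Proof. by rewrite segintE; congr Rintegral; apply: funext => s; rewrite torintE. Qed.

Lemma torint_segint f : torint f =
  segint 0 1 (fun a => segint 0 1 (fun b => segint 0 1 (fun c => f (vec3 a b c)))).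
Proof.
rewrite torintE /intT3 segintE; apply: eq_Rintegral => a _.
by rewrite segintE; apply: eq_Rintegral => b _; rewrite segintE.
Qed.

Lemma torint_is_radon : radon (@torint R).
Proof.
have r01 := segint_is_radon (@ler01 R).
have := radon_pushforward _ (radon_product r01 (radon_product r01 r01)).
move=> /(_ _ (fun p : R * (R * R) => vec3 p.1 p.2.1 p.2.2)).
rewrite (funext torint_segint); apply.
by continuity.
Qed.

Lemma cube_vec3 (a b c : R) : 0 <= a <= 1 -> 0 <= b <= 1 -> 0 <= c <= 1 -> cube (vec3 a b c).
Proof. by move=> ha hb hc; elim/ord3P; rewrite !mxE. Qed.

Lemma eq_torint f g : (forall x, cube x -> f x = g x) -> torint f = torint g.
Proof.
move=> fg; rewrite !torint_segint; apply: eq_segint => a a01; apply: eq_segint => b b01.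
by apply: eq_segint => c c01; apply: fg; exact: cube_vec3.
Qed.

Lemma continuous_torint (X : topologicalType) (F : X -> pt -> R) :
  continuous (fun p : X * pt => F p.1 p.2) -> continuous (fun x => torint (F x)).
Proof. exact: (continuous_radon torint_is_radon). Qed.

Definition conv (K u : pt -> R) (x : pt) : R := torint (fun y => K y * u (x + y)).

Lemma continuous_fun_conv (X : topologicalType) K (u : X -> pt -> R) (h : X -> pt) :
  continuous K -> continuous (fun p : X * pt => u p.1 p.2) -> continuous h ->
  continuous (fun x => conv K (u x) (h x)).
Proof.
move=> cK cu ch; apply: (@continuous_torint X (fun x y => K y * u x (h x + y))).
by continuity.
Qed.

End TorusIntegral.

Ltac continuity_integral ::=
  lazymatch goal with
  | |- continuous (fun x => segint ?a ?b (@?F x)) =>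
      apply: (@continuous_segint _ _ a b F); [by []|cbv beta]
  | |- continuous (fun x => torint (@?F x)) =>
      apply: (@continuous_torint _ _ F); cbv beta
  | |- continuous (fun x => conv ?K (@?u x) (@?h x)) =>
      apply: (@continuous_fun_conv _ _ K u h); cbv beta
  end.

Section TorusIntegralTheory.
Variable R : realType.
Local Notation pt := 'rV[R]_3.
Implicit Types (f g : pt -> R).

Lemma torintD f g : continuous f -> continuous g ->
  torint (fun x => f x + g x) = torint f + torint g.
Proof. exact: (radonD (torint_is_radon R)). Qed.

Lemma torintZl (c : R) f : continuous f -> torint (fun x => c * f x) = c * torint f.
Proof. exact: (radonZl (torint_is_radon R)). Qed.

Lemma torintN f : continuous f -> torint (fun x => - f x) = - torint f.
Proof. exact: (radonN (torint_is_radon R)). Qed.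

Lemma torintB f g : continuous f -> continuous g ->
  torint (fun x => f x - g x) = torint f - torint g.
Proof. exact: (radonB (torint_is_radon R)). Qed.

Lemma torint_sum (I : Type) (r : seq I) (F : I -> pt -> R) : (forall i, continuous (F i)) ->
  torint (fun x => \sum_(i <- r) F i x) = \sum_(i <- r) torint (F i).
Proof. exact: (radon_sum (torint_is_radon R)). Qed.

Lemma torint_cst (c : R) : torint (fun _ => c) = c.
Proof. by rewrite torint_segint !segint01_cst. Qed.

Lemma torint0 (f : pt -> R) : (forall x, f x = 0) -> torint f = 0.
Proof. by move=> f0; rewrite -[RHS]torint_cst; apply: eq_torint => x _. Qed.

Lemma le_torint f g : continuous f -> continuous g ->
  (forall x, cube x -> f x <= g x) -> torint f <= torint g.
Proof.
move=> cf cg fg; rewrite !torint_segint; apply: le_segint; [continuity..|move=> a a01].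
apply: le_segint; [continuity..|move=> b b01].
by apply: le_segint; [continuity..|move=> c c01]; apply: fg; exact: cube_vec3.
Qed.

Lemma torint_ge0 f : continuous f -> (forall x, 0 <= f x) -> 0 <= torint f.
Proof. exact: (radon_ge0 (torint_is_radon R)). Qed.

Lemma torint_norm f : continuous f -> `|torint f| <= torint (fun x => `|f x|).
Proof. exact: (radon_norm (torint_is_radon R)). Qed.

Lemma torint_norm_le f (M : R) : continuous f -> (forall x, cube x -> `|f x| <= M) ->
  `|torint f| <= M.
Proof.
move=> cf fM; apply: le_trans (torint_norm cf) _; rewrite -[leRHS]torint_cst.
by apply: le_torint => //; continuity.
Qed.

Lemma radon_torint (X : topologicalType) (L : (X -> R) -> R) (F : X -> pt -> R) :
  radon L -> continuous (fun p : X * pt => F p.1 p.2) ->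
  L (fun x => torint (F x)) = torint (fun y => L (F^~ y)).
Proof.
move=> rL cF; rewrite (funext (fun x => torint_segint (F x))) torint_segint.
rewrite (radon_segint rL) //; last by continuity.
apply: eq_segint => a _; rewrite (radon_segint rL) //; last by continuity.
apply: eq_segint => b _; rewrite (radon_segint rL) //; last by continuity.
Qed.

Lemma torint_shift f (h : pt) : cperiodic f -> torint (fun x => f (x + h)) = torint f.
Proof.
move=> [cf pf].
have vecS0 a b c : vec3 (a + 1) b c = vec3 a b c + e3 R ord0.
  by apply/rowP; elim/ord3P; rewrite !mxE /= ?addr0.
have vecS1 a b c : vec3 a (b + 1) c = vec3 a b c + e3 R (lift ord0 ord0).
  by apply/rowP; elim/ord3P; rewrite !mxE /= ?addr0.
have vecS2 a b c : vec3 a b (c + 1) = vec3 a b c + e3 R ord_max.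
  by apply/rowP; elim/ord3P; rewrite !mxE /= ?addr0.
rewrite !torint_segint -[RHS](segint_shift (h 0 ord0)); last 2 first.
- by continuity.
- by move=> a; apply: eq_segint => b _; apply: eq_segint => c _; rewrite vecS0 pf.
apply: eq_segint => a _; rewrite -[RHS](segint_shift (h 0 (lift ord0 ord0))); last 2 first.
- by continuity.
- by move=> b; apply: eq_segint => c _; rewrite vecS1 pf.
apply: eq_segint => b _; rewrite -[RHS](segint_shift (h 0 ord_max)); last 2 first.
- by continuity.
- by move=> c; rewrite vecS2 pf.
by apply: eq_segint => c _; rewrite vec3D.
Qed.

End TorusIntegralTheory.
Definition is_partial (R : realType) (i : 'I_3) (f df : 'rV[R]_3 -> R) : Prop :=
  forall x : 'rV[R]_3, has_derive f x (e3 R i) (df x).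

Section Partial.
Variable R : realType.
Local Notation pt := 'rV[R]_3.
Implicit Types (f g df dg : pt -> R) (i : 'I_3) (x y : pt).

Lemma is_partial_shift i f df y : is_partial i f df ->
  is_partial i (fun x => f (x + y)) (fun x => df (x + y)).
Proof.
move=> pf x; apply/has_derive_line; have /has_derive_line := pf (x + y).
by under eq_fun do rewrite addrA.
Qed.

Lemma is_partial_reflect i f df y : is_partial i f df ->
  is_partial i (fun x => f (y - x)) (fun x => - df (y - x)).
Proof.
move=> pf x; apply/has_derive_line; have /has_derive_line df0 := pf (y - x).
rewrite -[X in has_derive _ _ _ X]mulrN1.
have := @has_derive_comp R (fun s => - s) (fun s => f (s *: e3 R i + (y - x))) 0 (-1) (df (y - x)).
rewrite oppr0 => /(_ (has_deriveN (has_derive_id 0)) df0); congr has_derive.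
by apply: funext => s; rewrite scaleNr opprD addrCA.
Qed.

Lemma is_partial_line i f df x : is_partial i f df ->
  is_deriv (fun s : R => f (x + s *: e3 R i)) (fun s => df (x + s *: e3 R i)).
Proof.
move=> pf s; apply/has_derive_line; have /has_derive_line := pf (x + s *: e3 R i).
congr has_derive; apply: funext => r.
by rewrite [r *: 1]mulr1 scalerDl addrCA.
Qed.

Lemma is_partial_val i f df : is_partial i f df -> (fun x => 'D_(e3 R i) f x) = df.
Proof. by move=> pf; apply: funext => x; exact: has_derive_val (pf x). Qed.

Lemma is_partial_unique i f df dg : is_partial i f df -> is_partial i f dg -> df = dg.
Proof. by move=> /is_partial_val <- /is_partial_val <-. Qed.

Lemma is_partial_ext i f g df : (forall x, f x = g x) -> is_partial i f df -> is_partial i g df.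
Proof. by move=> fg pf; rewrite -(funext fg). Qed.

Lemma is_partial_cst i (c : R) : is_partial i (fun _ => c) (fun _ => 0).
Proof. by move=> x; exact: has_derive_cst. Qed.

Lemma is_partialD i f g df dg : is_partial i f df -> is_partial i g dg ->
  is_partial i (fun x => f x + g x) (fun x => df x + dg x).
Proof. by move=> pf pg x; apply: has_deriveD. Qed.

Lemma is_partialB i f g df dg : is_partial i f df -> is_partial i g dg ->
  is_partial i (fun x => f x - g x) (fun x => df x - dg x).
Proof. by move=> pf pg x; apply: has_deriveD; [|exact: has_deriveN]. Qed.

Lemma is_partialM i f g df dg : is_partial i f df -> is_partial i g dg ->
  is_partial i (fun x => f x * g x) (fun x => df x * g x + f x * dg x).
Proof. by move=> pf pg x; apply: has_deriveM. Qed.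

Lemma is_partialZ i c f df : is_partial i f df ->
  is_partial i (fun x => c * f x) (fun x => c * df x).
Proof. by move=> pf x; apply: has_deriveZ. Qed.

Lemma is_partialZr i c f df : is_partial i f df ->
  is_partial i (fun x => f x * c) (fun x => df x * c).
Proof.
by move=> pf x; rewrite [X in has_derive _ _ _ X]mulrC; under eq_fun do rewrite mulrC;
  exact: has_deriveZ.
Qed.

Lemma is_partial_comp i (b db : R -> R) f df : is_deriv b db -> is_partial i f df ->
  is_partial i (fun x => b (f x)) (fun x => db (f x) * df x).
Proof.
move=> dbb pf x; apply/has_derive_line.
apply: (@has_derive_comp _ (fun s : R => f (s *: e3 R i + x)) b); first exact/has_derive_line.
by rewrite scale0r add0r; exact: dbb.
Qed.

Lemma is_partial_incr i f df x (h : R) : is_partial i f df -> continuous df ->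
  f (x + h *: e3 R i) - f x = segint 0 1 (fun s => h * df (x + s *: (h *: e3 R i))).
Proof.
move=> pf cdf.
have cline : continuous (fun s : R => df (x + s *: e3 R i)) by continuity.
have := segint_slope 0 h cline (is_partial_line x pf).
rewrite !add0r scale0r addr0 => ->; rewrite -segintZl; last by continuity.
by apply: eq_segint => s _; rewrite add0r scalerA.
Qed.

Lemma is_partial_radon (X : topologicalType) (L : (X -> R) -> R) i (F dF : X -> pt -> R) :
  radon L -> (forall z, is_partial i (F z) (dF z)) ->
  continuous (fun p : X * pt => F p.1 p.2) -> continuous (fun p : X * pt => dF p.1 p.2) ->
  is_partial i (fun x => L (F^~ x)) (fun x => L (dF^~ x)).
Proof.
move=> rL pF cF cdF x; apply/has_derive_line.
have := @has_derive_radon _ _ _ rL (fun s z => F z (x + s *: e3 R i))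
  (fun s z => dF z (x + s *: e3 R i)).
move=> /(_ (fun z => is_partial_line x (pF z)) _ _ 0); rewrite scale0r addr0.
under [X in has_derive X]eq_fun do rewrite addrC.
by apply; continuity.
Qed.

End Partial.

(** * Periodic functions and convolution *)

Section PeriodicTheory.
Variable R : realType.
Local Notation pt := 'rV[R]_3.
Implicit Types (f g : pt -> R) (x h : pt).

Lemma cperiodic_cst (c : R) : cperiodic (fun _ : pt => c).
Proof. by split => //; continuity. Qed.

Lemma cperiodicD f g : cperiodic f -> cperiodic g -> cperiodic (fun x => f x + g x).
Proof. by move=> Hf Hg; split=> [|x i]; [continuity|rewrite Hf.2 Hg.2]. Qed.

Lemma cperiodicN f : cperiodic f -> cperiodic (fun x => - f x).
Proof. by move=> Hf; split=> [|x i]; [continuity|rewrite Hf.2]. Qed.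

Lemma cperiodicB f g : cperiodic f -> cperiodic g -> cperiodic (fun x => f x - g x).
Proof. by move=> Hf Hg; apply: cperiodicD => //; exact: cperiodicN. Qed.

Lemma cperiodicM f g : cperiodic f -> cperiodic g -> cperiodic (fun x => f x * g x).
Proof. by move=> Hf Hg; split=> [|x i]; [continuity|rewrite Hf.2 Hg.2]. Qed.

Lemma cperiodic_comp (b : R -> R) f : continuous b -> cperiodic f -> cperiodic (fun x => b (f x)).
Proof. by move=> cb Hf; split=> [|x i]; [continuity|rewrite Hf.2]. Qed.

Lemma cperiodic_sum (I : Type) (r : seq I) (F : I -> pt -> R) :
  (forall i, cperiodic (F i)) -> cperiodic (fun x => \sum_(i <- r) F i x).
Proof.
by move=> HF; split=> [|x j]; [continuity|apply: eq_bigr => i _; exact: (HF i).2].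
Qed.

Lemma cperiodic_shift f h : cperiodic f -> cperiodic (fun x => f (x + h)).
Proof. by move=> Hf; split=> [|x i]; [continuity|rewrite addrAC Hf.2]. Qed.

Lemma cperiodic_reflect f h : cperiodic f -> cperiodic (fun x => f (h - x)).
Proof.
move=> Hf; split=> [|x i]; first by continuity.
by rewrite -(Hf.2 (h - (x + e3 R i)) i) opprD !addrA subrK.
Qed.

Lemma cperiodic_incr f h : cperiodic f -> cperiodic (fun x => f (x + h) - f x).
Proof. by move=> Hf; apply: cperiodicB => //; exact: cperiodic_shift. Qed.

Lemma cperiodic_flow_cst f : cperiodic f -> cperiodic_flow (fun x (_ : R) => f x).
Proof. by move=> Hf; split=> [|s]; [continuity|exact: Hf.2]. Qed.

Lemma periodic3_int f i (z : int) x : periodic3 f -> f (x + z%:~R *: e3 R i) = f x.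
Proof.
move=> pf; have shift_nat n y : f (y + n%:R *: e3 R i) = f y.
  elim: n y => [|n IH] y; first by rewrite scale0r addr0.
  by rewrite -natr1 scalerDl scale1r addrA pf.
case: z => n; first exact: shift_nat.
by rewrite NegzE -[LHS](shift_nat n.+1) -addrA -scalerDl -[X in _ + X%:R]/(n.+1) mulrNz addNr
  scale0r addr0.
Qed.

Lemma periodic3_int_vec f (z : 'I_3 -> int) x (y : pt) : periodic3 f ->
  (forall i, y 0 i = x 0 i + (z i)%:~R) -> f y = f x.
Proof.
move=> pf yE.
have -> : y = x + (z ord0)%:~R *: e3 R ord0 + (z (lift ord0 ord0))%:~R *: e3 R (lift ord0 ord0)
    + (z ord_max)%:~R *: e3 R ord_max.
  by apply/rowP; elim/ord3P; rewrite !mxE yE /= ?mulr0 ?addr0 ?mulr1.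
by rewrite !periodic3_int.
Qed.

Lemma cube_representative x : exists2 y, cube y & forall f, periodic3 f -> f x = f y.
Proof.
exists (\row_i (x 0 i - (Num.floor (x 0 i))%:~R)).
  move=> i; rewrite mxE; have := floor_le (x 0 i); have := floorD1_gt (x 0 i).
  by rewrite intrD; lra.
move=> f pf; apply: (periodic3_int_vec (z := fun i => Num.floor (x 0 i)) pf) => i.
by rewrite mxE subrK.
Qed.

Lemma cube0 : cube (0 : pt).
Proof. by move=> i; rewrite mxE lexx ler01. Qed.

Lemma cube_compact : compact (@cube R).
Proof.
have -> : @cube R = [set v : pt | forall i, (fun _ => `[0, 1]%classic) i (v 0 i)].
  by apply/seteqP; split => x /= cx i; have := cx i; rewrite /= in_itv.
by apply: (@rV_compact R 3 (fun _ => `[0, 1]%classic)) => i; exact: segment_compact.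
Qed.

Lemma continuous_compact_norm_le (X : topologicalType) (K : set X) (f : X -> R) :
  compact K -> continuous f -> exists M, forall z, K z -> `|f z| <= M.
Proof.
move=> cK cf.
have [M [_ fM]] := compact_bounded (continuous_compact (continuous_subspaceT cf) cK).
by exists (M + 1) => z Kz; apply: (fM (M + 1)); [rewrite ltrDl|exists z].
Qed.

Lemma compact_le_epsilon_add (X : topologicalType) (K : set X) (g d : X -> R) (e : R) :
  compact K -> continuous g -> continuous d -> (forall z, 0 <= d z) ->
  (forall z, K z -> d z = 0 -> g z = 0) -> 0 < e ->
  exists2 C, 0 <= C & forall z, K z -> g z <= e + C * d z.
Proof.
move=> cK cg cd d0 dg e0.
have cK' : compact (K `&` [set z | e <= g z]).
  apply: compact_closedI => //.
  rewrite (_ : [set z | e <= g z] = g @^-1` [set r | e <= r]) //.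
  exact: closed_comp (@closed_ge R e).
have [[z0 Kz0]|K'0] := pselect (K `&` [set z | e <= g z] !=set0); last first.
  exists 0 => // z Kz; rewrite mul0r addr0 leNgt; apply/negP => /ltW ez.
  by apply: K'0; exists z.
have [z1 /[!inE] -[Kz1 ez1] dmin] := @compact_EVT_min _ R d _ (ex_intro _ z0 Kz0) cK'
  (continuous_subspaceT cd).
have dz1 : 0 < d z1.
  rewrite lt_neqAle eq_sym d0 andbT; apply: contraTneq (e0) => /(dg z1 Kz1) gz1.
  by rewrite -leNgt -gz1.
have [M gM] := continuous_compact_norm_le cK cg.
have M0 : 0 <= M by exact: le_trans (gM _ Kz1).
exists (M / d z1) => [|z Kz]; first by rewrite divr_ge0.
have [gz|ez] := ltP (g z) e; first by rewrite (le_trans (ltW gz)) // lerDl mulr_ge0 ?divr_ge0.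
apply: (@le_trans _ _ (M / d z1 * d z)); last by rewrite lerDr ltW.
rewrite mulrAC ler_pdivlMr //; apply: ler_pM => //; first exact: le_trans (ltW e0) ez.
- exact: le_trans (ler_norm _) (gM z Kz).
- by apply: dmin; rewrite inE.
Qed.

Lemma cperiodic_flow_bounded (T : R) (f : pt -> R -> R) : cperiodic_flow f ->
  exists M, forall s x, 0 <= s <= T -> `|f x s| <= M.
Proof.
move=> [cf pf].
have [M fM] := continuous_compact_norm_le (compact_setX cube_compact (@compact_timeI R 0 T)) cf.
exists M => s x sT; have [y cy E] := cube_representative x.
by have {}E := E _ (pf s); rewrite /= in E; rewrite E; exact: (fM (y, s)).
Qed.

Lemma cperiodic_bounded f : cperiodic f -> exists M, forall x, `|f x| <= M.
Proof.
move=> /cperiodic_flow_cst /(cperiodic_flow_bounded 0)[M fM].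
by exists M => x; apply: (fM 0); rewrite lexx.
Qed.

Lemma torint_partial i f df : is_partial i f df -> cperiodic f -> continuous df -> torint df = 0.
Proof.
move=> pf Hf cdf.
have := @has_derive_radon _ _ _ (torint_is_radon R) (fun s y => f (y + s *: e3 R i))
  (fun s y => df (y + s *: e3 R i)) (fun y => is_partial_line y pf).
rewrite (_ : (fun s : R => torint _) = (fun _ => torint f)); last first.
  by apply: funext => s; exact: torint_shift.
move=> /(_ _ _ 0); rewrite (_ : torint (fun y => df _) = torint df); last first.
  by apply: eq_torint => y _; rewrite scale0r addr0.
by move=> d0; apply: (has_derive_unique (d0 _ _) (has_derive_cst _ _ _)); continuity.
Qed.

Lemma torint_by_parts i f g df dg : is_partial i f df -> is_partial i g dg ->
  cperiodic f -> cperiodic g -> continuous df -> continuous dg ->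
  torint (fun x => f x * dg x) = - torint (fun x => df x * g x).
Proof.
move=> pf pg Hf Hg cdf cdg.
have := torint_partial (is_partialM pf pg) (cperiodicM Hf Hg).
rewrite torintD; [|continuity..].
by move=> sum0; apply/eqP; rewrite -addr_eq0 addrC sum0 //; continuity.
Qed.

End PeriodicTheory.

Definition even3 (R : realType) (K : 'rV[R]_3 -> R) : Prop := forall y, K (- y) = K y.

Definition even_kernel (R : realType) (K : 'rV[R]_3 -> R) : Prop := cperiodic K /\ even3 K.

Section Convolution.
Variable R : realType.
Local Notation pt := 'rV[R]_3.
Implicit Types (f g K L dK u du : pt -> R).

Lemma cperiodic_conv K u : continuous K -> cperiodic u -> cperiodic (conv K u).
Proof.
move=> cK Hu; split=> [|x i]; first by rewrite /conv; continuity.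
by apply: eq_torint => y _; rewrite addrAC Hu.2.
Qed.

Lemma convE K u x : even_kernel K -> cperiodic u ->
  conv K u x = torint (fun y => K (x - y) * u y).
Proof.
move=> [HK eK] Hu; rewrite -[RHS](torint_shift x); last first.
  by apply: cperiodicM => //; exact: cperiodic_reflect.
by apply: eq_torint => y _; rewrite opprD addrCA subrr addr0 eK (addrC y).
Qed.

Lemma conv_adjoint K f g : even_kernel K -> cperiodic f -> cperiodic g ->
  torint (fun x => conv K f x * g x) = torint (fun x => f x * conv K g x).
Proof.
move=> HK Hf Hg; have [HK0 eK] := HK.
transitivity (torint (fun x => torint (fun y => K (x - y) * f y * g x))).
  apply: eq_torint => x _; rewrite convE // mulrC -torintZl; last by continuity.
  by apply: eq_torint => y _; rewrite mulrC.
rewrite (radon_torint (torint_is_radon R)); last by continuity.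
apply: eq_torint => y _; rewrite (convE y) // -torintZl; last by continuity.
by apply: eq_torint => x _; rewrite -(eK (x - y)) opprB; ring.
Qed.

Lemma convD K f g x : continuous K -> continuous f -> continuous g ->
  conv K (fun x => f x + g x) x = conv K f x + conv K g x.
Proof.
move=> cK cf cg; rewrite -torintD; [|continuity..].
by apply: eq_torint => y _; rewrite mulrDr.
Qed.

Lemma convB K f g x : continuous K -> continuous f -> continuous g ->
  conv K (fun x => f x - g x) x = conv K f x - conv K g x.
Proof.
move=> cK cf cg; rewrite -torintB; [|continuity..].
by apply: eq_torint => y _; rewrite mulrBr.
Qed.

Lemma convZ K c f x : continuous K -> continuous f -> conv K (fun x => c * f x) x = c * conv K f x.
Proof.
move=> cK cf; rewrite -torintZl; last by continuity.
by apply: eq_torint => y _; rewrite mulrCA.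
Qed.

Lemma conv_sum K (I : Type) (r : seq I) (F : I -> pt -> R) x :
  continuous K -> (forall i, continuous (F i)) ->
  conv K (fun x => \sum_(i <- r) F i x) x = \sum_(i <- r) conv K (F i) x.
Proof.
move=> cK cF; rewrite /conv -torint_sum => [|i]; last by continuity.
by apply: eq_torint => y _; rewrite mulr_sumr.
Qed.

Lemma conv_kernel_sum (I : Type) (r : seq I) (K : I -> pt -> R) (c : I -> R) u x :
  (forall i, continuous (K i)) -> continuous u ->
  conv (fun y => \sum_(i <- r) c i * K i y) u x = \sum_(i <- r) c i * conv (K i) u x.
Proof.
move=> cK cu; rewrite (eq_bigr (fun i => torint (fun y => c i * (K i y * u (x + y))))).
  rewrite -torint_sum => [|i]; last by continuity.
  by apply: eq_torint => y _; rewrite mulr_suml; apply: eq_bigr => i _; rewrite mulrA.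
by move=> i _; rewrite -torintZl //; continuity.
Qed.

Lemma conv_incr K f y x : continuous K -> continuous f ->
  conv K (fun x => f (x + y) - f x) x = conv K f (x + y) - conv K f x.
Proof.
move=> cK cf; rewrite convB //; last by continuity.
by congr (_ - _); apply: eq_torint => z _; rewrite addrAC.
Qed.

Lemma conv0 K u x : (forall y, u y = 0) -> conv K u x = 0.
Proof. by move=> u0; apply: torint0 => y; rewrite u0 mulr0. Qed.

Lemma conv_comm K L u x : continuous K -> continuous L -> continuous u ->
  conv K (conv L u) x = conv L (conv K u) x.
Proof.
move=> cK cL cu; transitivity (torint (fun y => torint (fun z => K y * (L z * u (x + y + z))))).
  by apply: eq_torint => y _; rewrite -torintZl //; continuity.
rewrite (radon_torint (torint_is_radon R)); last by continuity.
apply: eq_torint => z _; rewrite -torintZl; last by continuity.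
by apply: eq_torint => y _; rewrite mulrCA addrAC.
Qed.

Lemma is_partial_conv i K u du : continuous K -> continuous u -> continuous du ->
  is_partial i u du -> is_partial i (conv K u) (conv K du).
Proof.
move=> cK cu cdu pu.
apply: (is_partial_radon (torint_is_radon R) (F := fun y x => K y * u (x + y))
  (dF := fun y x => K y * du (x + y))); [|continuity..].
by move=> y; apply: is_partialZ; exact: is_partial_shift.
Qed.

Lemma is_partial_conv_kernel i K dK u : even_kernel K -> continuous dK -> cperiodic u ->
  is_partial i K dK -> is_partial i (conv K u) (fun x => torint (fun y => dK (x - y) * u y)).
Proof.
move=> HK cdK Hu pK; have [HK0 _] := HK.
apply: (is_partial_ext (f := fun x => torint (fun y => K (x - y) * u y))).
  by move=> x; rewrite convE.
apply: (is_partial_radon (torint_is_radon R) (F := fun y x : pt => K (x - y) * u y)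
  (dF := fun y x : pt => dK (x - y) * u y)); [|continuity..].
by move=> y; apply: is_partialZr; exact: is_partial_shift.
Qed.

End Convolution.

(** * Translation-invariant norms *)

Record transl_norm (R : realType) (nrm : ('rV[R]_3 -> R) -> R) : Prop := TranslNorm {
  tnorm_ge0 : forall f, 0 <= nrm f;
  tnormD : forall f g, cperiodic f -> cperiodic g -> nrm (fun x => f x + g x) <= nrm f + nrm g;
  tnorm_average : forall (X : topologicalType) (L : (X -> R) -> R) (W : X -> R)
      (tau : X -> 'rV[R]_3) (f : 'rV[R]_3 -> R),
    radon L -> continuous W -> continuous tau -> cperiodic f ->
    nrm (fun x => L (fun y => W y * f (x + tau y))) <= L (fun y => `|W y|) * nrm f;
  tnorm_le_sup : forall f M, continuous f -> (forall x, cube x -> `|f x| <= M) -> nrm f <= M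
}.

Section TranslNormTheory.
Variable R : realType.
Local Notation pt := 'rV[R]_3.
Variable nrm : (pt -> R) -> R.
Hypothesis tnorm : transl_norm nrm.
Implicit Types (f K : pt -> R).

Lemma tnorm_shift (h : pt) f : cperiodic f -> nrm (fun x => f (x + h)) <= nrm f.
Proof.
move=> Hf; have rL := radon_eval R (0 : R).
have := tnorm_average tnorm (W := fun _ => 1) (tau := fun _ => h) rL _ _ Hf.
rewrite normr1 mul1r; under [X in nrm X]eq_fun do rewrite mul1r.
by apply; continuity.
Qed.

Lemma tnormN f : cperiodic f -> nrm (fun x => - f x) <= nrm f.
Proof.
move=> Hf; have rL := radon_eval R (0 : R).
have := tnorm_average tnorm (W := fun _ => -1) (tau := fun _ => 0) rL _ _ Hf.
rewrite normrN1 mul1r; under [X in nrm X]eq_fun do rewrite mulN1r addr0.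
by apply; continuity.
Qed.

Lemma tnorm0 : nrm (fun _ => 0) <= 0.
Proof. by apply: (tnorm_le_sup tnorm); [continuity|move=> x _; rewrite normr0]. Qed.

Lemma tnorm_sum n (F : 'I_n -> pt -> R) : (forall i, cperiodic (F i)) ->
  nrm (fun x => \sum_(i < n) F i x) <= \sum_(i < n) nrm (F i).
Proof.
elim: n F => [|n IH] F HF.
  by rewrite big_ord0; under eq_fun do rewrite big_ord0; exact: tnorm0.
under eq_fun do rewrite big_ord_recl; rewrite big_ord_recl.
apply: le_trans (tnormD tnorm _ _) _ => //; first exact: cperiodic_sum.
by rewrite lerD2l; exact: IH.
Qed.

Lemma tnorm_conv K f : continuous K -> cperiodic f ->
  nrm (conv K f) <= torint (fun y => `|K y|) * nrm f.
Proof.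
by move=> cK Hf; apply: (tnorm_average tnorm (torint_is_radon R) cK _ Hf); continuity.
Qed.

Lemma tnorm_incr f (h : pt) : cperiodic f -> nrm (fun x => f (x + h) - f x) <= 2 * nrm f.
Proof.
move=> Hf; rewrite (_ : 2 * nrm f = nrm f + nrm f); last by ring.
apply: le_trans (tnormD tnorm (cperiodic_shift h Hf) (cperiodicN Hf)) _.
by apply: lerD; [exact: tnorm_shift|exact: tnormN].
Qed.

Lemma tnorm_incr_partial i f df (h : R) : is_partial i f df -> cperiodic df ->
  nrm (fun x => f (x + h *: e3 R i) - f x) <= `|h| * nrm df.
Proof.
move=> pf Hdf; under [X in nrm X]eq_fun do rewrite (is_partial_incr _ _ pf Hdf.1).
have := tnorm_average tnorm (W := fun _ => h) (tau := fun s : R => s *: (h *: e3 R i))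
  (segint_is_radon (@ler01 R)) _ _ Hdf.
by rewrite segint01_cst; apply; continuity.
Qed.

End TranslNormTheory.

Section Norms.
Variable R : realType.
Local Notation pt := 'rV[R]_3.
Implicit Types (f g : pt -> R).

Lemma Lq_oo_ub f : cperiodic f -> forall x, `|f x| <= Lq +oo f.
Proof.
move=> Hf x; have [y cy ->] := cube_representative x; last exact: Hf.2.
apply: ub_le_sup; last by exists y.
by have [M fM] := cperiodic_bounded Hf; exists M => _ [z _ <-].
Qed.

Lemma Lq_oo_le f M : (forall x, cube x -> `|f x| <= M) -> Lq +oo f <= M.
Proof.
move=> fM; apply: ge_sup; last by move=> _ [x cx <-]; exact: fM.
by exists `|f 0|, 0 => //; exact: cube0.
Qed.

Lemma Lq_oo_ge0 f : 0 <= Lq +oo f.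
Proof.
rewrite /Lq; have [fb|fb] := pselect (has_sup [set `|f x| | x in @cube R]); last by rewrite sup_out.
apply: le_trans (normr_ge0 (f 0)) _; apply: ub_le_sup; first exact: fb.2.
by exists 0 => //; exact: cube0.
Qed.

Lemma Lq_oo_transl_norm : transl_norm (@Lq R +oo%E).
Proof.
split.
- exact: Lq_oo_ge0.
- move=> f g Hf Hg; apply: Lq_oo_le => x _; apply: le_trans (ler_normD _ _) _.
  by apply: lerD; exact: Lq_oo_ub.
- move=> X L W tau f rL cW ctau Hf; apply: Lq_oo_le => x _.
  apply: le_trans (radon_norm rL _) _; first by continuity.
  rewrite mulrC -(radonZl rL); last by continuity.
  apply: (le_radon rL); [continuity..|move=> y].
  by rewrite normrM mulrC ler_wpM2r //; exact: Lq_oo_ub.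
- by move=> f M _ fM; exact: Lq_oo_le.
Qed.

Definition l2norm f : R := Num.sqrt (torint (fun x => f x ^+ 2)).

Lemma l2norm_ge0 f : 0 <= l2norm f. Proof. exact: sqrtr_ge0. Qed.

Lemma sqr_l2norm f : continuous f -> l2norm f ^+ 2 = torint (fun x => f x ^+ 2).
Proof.
move=> cf; rewrite sqr_sqrtr //; apply: torint_ge0 => [|x]; last exact: sqr_ge0.
by continuity.
Qed.

Lemma l2norm_le f (M : R) : 0 <= M -> torint (fun x => f x ^+ 2) <= M ^+ 2 -> l2norm f <= M.
Proof. by move=> M0 fM; rewrite -(ger0_norm M0) -sqrtr_sqr ler_wsqrtr. Qed.

Lemma ler_norm_sqr (a b : R) : `|a| <= b -> a ^+ 2 <= b ^+ 2.
Proof.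
by move=> ab; rewrite -real_normK ?num_real // lerXn2r ?nnegrE // (le_trans _ ab).
Qed.

Lemma le_l2normZ (C : R) f g : 0 <= C -> continuous f -> continuous g ->
  (forall x, `|f x| <= C * `|g x|) -> l2norm f <= C * l2norm g.
Proof.
move=> C0 cf cg fg; apply: l2norm_le; first by rewrite mulr_ge0 ?l2norm_ge0.
rewrite exprMn sqr_l2norm // -torintZl; last by continuity.
apply: le_torint; [continuity..|move=> x _].
by rewrite -[g x ^+ 2]real_normK ?num_real // -exprMn; exact: ler_norm_sqr.
Qed.

Lemma l2norm_CauchySchwarz f g : continuous f -> continuous g ->
  `|torint (fun x => f x * g x)| <= l2norm f * l2norm g.
Proof.
move=> cf cg; rewrite -(@ler_pXn2r _ 2) ?nnegrE ?mulr_ge0 ?l2norm_ge0 //.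
rewrite exprMn !sqr_l2norm // real_normK ?num_real //.
have mul1f (h : pt -> R) : torint (fun x => 1 * h x) = torint h.
  by apply: eq_torint => x _; rewrite mul1r.
have := radon_CauchySchwarz (torint_is_radon R) (w := fun _ => 1) _ cf cg (fun _ => ler01).
by rewrite !mul1f; apply; continuity.
Qed.

Lemma l2normD f g : continuous f -> continuous g ->
  l2norm (fun x => f x + g x) <= l2norm f + l2norm g.
Proof.
move=> cf cg; apply: l2norm_le; first by rewrite addr_ge0 ?l2norm_ge0.
have -> : torint (fun x => (f x + g x) ^+ 2) =
    l2norm f ^+ 2 + (2 * torint (fun x => f x * g x) + l2norm g ^+ 2).
  rewrite !sqr_l2norm // -torintZl; last by continuity.
  rewrite -!torintD; [|continuity..].
  by apply: eq_torint => x _; ring.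
have -> : (l2norm f + l2norm g) ^+ 2 =
  l2norm f ^+ 2 + (2 * (l2norm f * l2norm g) + l2norm g ^+ 2) by ring.
rewrite lerD2l lerD2r ler_pM2l //.
exact: le_trans (ler_norm _) (l2norm_CauchySchwarz cf cg).
Qed.

(* Cauchy-Schwarz with weight [|W|], then Fubini and translation invariance. *)
Lemma l2norm_average (X : topologicalType) (L : (X -> R) -> R) (W : X -> R) (tau : X -> pt) f :
  radon L -> continuous W -> continuous tau -> cperiodic f ->
  l2norm (fun x => L (fun y => W y * f (x + tau y))) <= L (fun y => `|W y|) * l2norm f.
Proof.
move=> rL cW ctau Hf.
have cFubini : continuous (fun p : pt * X => `|W p.2| * f (p.1 + tau p.2) ^+ 2) by continuity.
have W0 : 0 <= L (fun y => `|W y|) by apply: (radon_ge0 rL) => //; continuity.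
have pointwise (x : pt) : (L (fun y => W y * f (x + tau y))) ^+ 2 <=
    L (fun y => `|W y|) * L (fun y => `|W y| * f (x + tau y) ^+ 2).
  have := radon_CauchySchwarz rL (w := fun y => `|W y|) (f := fun _ => 1)
    (g := fun y => `|f (x + tau y)|).
  rewrite (_ : (fun y => `|W y| * 1 ^+ 2) = (fun y => `|W y|)); last first.
    by apply: funext => y; rewrite expr1n mulr1.
  rewrite (_ : (fun y => `|W y| * `|f _| ^+ 2) =
    (fun y => `|W y| * f (x + tau y) ^+ 2)); last first.
    by apply: funext => y; rewrite real_normK ?num_real.
  move=> CS; apply: le_trans (CS _ _ _ _) => //; [|continuity..].
  apply: ler_norm_sqr; apply: le_trans (radon_norm rL _) _; first by continuity.
  by apply: (le_radon rL) => [| |y]; [continuity..|rewrite mul1r normrM].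
apply: l2norm_le; first by rewrite mulr_ge0 ?l2norm_ge0.
have cLx : continuous (fun x : pt => L (fun y => W y * f (x + tau y))).
  by apply: (continuous_radon rL (F := fun (x : pt) y => W y * f (x + tau y))); continuity.
have cLx2 : continuous (fun x : pt => L (fun y => `|W y| * f (x + tau y) ^+ 2)).
  exact: (continuous_radon rL (F := fun (x : pt) y => `|W y| * f (x + tau y) ^+ 2)).
apply: (@le_trans _ _ (torint (fun x =>
    L (fun y => `|W y|) * L (fun y => `|W y| * f (x + tau y) ^+ 2)))).
  by apply: le_torint => [| |x _]; [continuity..|exact: pointwise].
rewrite torintZl // exprMn expr2 -mulrA ler_wpM2l //.
have := radon_torint (F := fun y (x : pt) => `|W y| * f (x + tau y) ^+ 2) rL.
move=> <-; last by continuity.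
rewrite sqr_l2norm; last by continuity.
rewrite mulrC -(radonZl rL); last by continuity.
have inner_integral : (fun y => torint (fun x => `|W y| * f (x + tau y) ^+ 2)) =
    (fun y => torint (fun x => f x ^+ 2) * `|W y|).
  apply: funext => y; rewrite torintZl; last by continuity.
  rewrite mulrC (torint_shift (f := fun x => f x ^+ 2)) //.
  by apply: (cperiodic_comp (b := fun z => z ^+ 2)) => //; continuity.
by rewrite inner_integral.
Qed.

Lemma l2norm_transl_norm : transl_norm l2norm.
Proof.
split.
- exact: l2norm_ge0.
- by move=> f g [cf _] [cg _]; exact: l2normD.
- exact: l2norm_average.
- move=> f M cf fM; apply: l2norm_le; first exact: le_trans (normr_ge0 (f 0)) (fM 0 (@cube0 R)).
  rewrite -[leRHS]torint_cst; apply: le_torint; [continuity..|move=> x cx].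
  exact: ler_norm_sqr (fM x cx).
Qed.

End Norms.

(** * The Fejer kernel on the circle *)

Section Kernels.
Variable R : realType.
Implicit Types (s : R) (N m : nat).

Definition dirichlet m s : R := 1 + 2 * \sum_(j < m) cos (2 * pi * (j.+1)%:R * s).

Definition fejer N s : R := \sum_(m < N) dirichlet m s.

(* Convolution with this kernel differentiates trigonometric polynomials of degree at most [N]. *)
Definition bernstein_kernel N s : R := 4 * pi * (fejer N s * sin (2 * pi * N%:R * s)).

Lemma continuous_dirichlet m : continuous (dirichlet m).
Proof. by rewrite /dirichlet; continuity. Qed.

Lemma continuous_fejer N : continuous (fejer N).
Proof. by rewrite /fejer /dirichlet; continuity. Qed.

Lemma continuous_bernstein_kernel N : continuous (bernstein_kernel N).
Proof. by rewrite /bernstein_kernel /fejer /dirichlet; continuity. Qed.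

End Kernels.

#[global] Hint Resolve continuous_dirichlet continuous_fejer continuous_bernstein_kernel :
  continuity.

Section Fejer.
Variable R : realType.
Implicit Types (s p : R) (N m : nat) (z : int).

Lemma cosD2pi_int p z : cos (p + 2 * pi * z%:~R) = cos p.
Proof.
have shift_nat n (q : R) : cos (q + 2 * pi * n%:R) = cos q.
  rewrite (_ : 2 * pi * n%:R = pi *+ 2 *+ n); first exact: (periodicn (@cosD2pi R)).
  by rewrite -[pi *+ 2]mulr_natl -[RHS]mulr_natr.
case: z => n; first exact: shift_nat.
rewrite NegzE -[LHS](shift_nat n.+1); congr cos.
by rewrite mulrNz -[n.+1%:~R]/(n.+1%:R); ring.
Qed.

Lemma sinD2pi_int p z : sin (p + 2 * pi * z%:~R) = sin p.
Proof. by rewrite -!cosBpihalf addrAC cosD2pi_int. Qed.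

Lemma segint_cos z p :
  segint 0 1 (fun s => cos (2 * pi * z%:~R * s + p)) = (z == 0)%:R * cos p.
Proof.
have [->|z0] /= := eqVneq z 0.
  by rewrite mul1r -[RHS]segint01_cst; apply: eq_segint => s _; rewrite mulr0 mul0r add0r.
rewrite mul0r; set w := 2 * pi * _.
have w0 : w != 0 by rewrite /w !mulf_neq0 ?intr_eq0 // gt_eqF // pi_gt0.
rewrite (@segint_deriv R 0 1 _ (fun s => w^-1 * sin (w * s + p))) //; last 2 first.
- by continuity.
- move=> s; rewrite -[X in has_derive _ _ _ X](_ : w^-1 * (cos (w * s + p) * (w * 1 + 0)) = _).
    apply: has_deriveZ; apply: (@has_derive_sin _ (fun s => w * s + p)).
    by apply: has_deriveD; [apply: has_deriveZ; exact: has_derive_id|exact: has_derive_cst].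
  by field.
by rewrite mulr1 mulr0 add0r (addrC w) /w sinD2pi_int subrr.
Qed.

Lemma dirichletS m s : dirichlet m.+1 s = dirichlet m s + 2 * cos (2 * pi * m.+1%:R * s).
Proof. by rewrite /dirichlet big_ord_recr /=; ring. Qed.

Lemma fejerS N s : fejer N.+1 s = fejer N s + dirichlet N s.
Proof. by rewrite /fejer big_ord_recr. Qed.

Lemma dirichletE m s : (1 - cos (2 * pi * s)) * dirichlet m s =
  cos (2 * pi * m%:R * s) - cos (2 * pi * m.+1%:R * s).
Proof.
elim: m => [|m IH].
  by rewrite /dirichlet big_ord0 mulr0 addr0 mulr1 mulr0 mul0r cos0 mulr1.
rewrite dirichletS mulrDr IH.
have -> : 2 * pi * m.+2%:R * s = 2 * pi * m.+1%:R * s + 2 * pi * s :> R.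
  by rewrite -[m.+2%:R]natr1; ring.
have -> : 2 * pi * m%:R * s = 2 * pi * m.+1%:R * s - 2 * pi * s :> R.
  by rewrite -[m.+1%:R]natr1; ring.
by rewrite cosB cosD; ring.
Qed.

Lemma fejerE N s : (1 - cos (2 * pi * s)) * fejer N s = 1 - cos (2 * pi * N%:R * s).
Proof.
elim: N => [|N IH]; first by rewrite /fejer big_ord0 !mulr0 mul0r cos0 subrr.
by rewrite fejerS mulrDr IH dirichletE addrA subrK.
Qed.

Lemma fejer_ge0 N s : 0 <= fejer N s.
Proof.
have [c1|c1] := eqVneq (cos (2 * pi * s)) 1; last first.
  have c2 : 0 < 1 - cos (2 * pi * s) by rewrite subr_gt0 lt_neqAle c1 cos_le1.
  by rewrite -(pmulr_rge0 _ c2) fejerE subr_ge0 cos_le1.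
have s1 : sin (2 * pi * s) = 0 by apply: cos1sin0; rewrite c1 normr1.
have trivial n : cos (2 * pi * n%:R * s) = 1 /\ sin (2 * pi * n%:R * s) = 0.
  elim: n => [|n [IHc IHs]]; first by rewrite mulr0 mul0r cos0 sin0.
  have -> : 2 * pi * n.+1%:R * s = 2 * pi * n%:R * s + 2 * pi * s :> R.
    by rewrite -[n.+1%:R]natr1; ring.
  by rewrite cosD sinD IHc IHs c1 s1; split; ring.
apply: sumr_ge0 => m _; rewrite addr_ge0 // mulr_ge0 // sumr_ge0 // => j _.
by rewrite (trivial j.+1).1.
Qed.

Lemma fejerN N s : fejer N (- s) = fejer N s.
Proof.
apply: eq_bigr => m _; congr (_ + 2 * _); apply: eq_bigr => j _.
by rewrite mulrN cosN.
Qed.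

Lemma fejerD1 N s : fejer N (s + 1) = fejer N s.
Proof.
apply: eq_bigr => m _; congr (_ + 2 * _); apply: eq_bigr => j _.
by rewrite mulrDr mulr1 -[j.+1%:R]/((Posz j.+1)%:~R) cosD2pi_int.
Qed.

Lemma segint_dirichlet_cos m z p :
  segint 0 1 (fun s => dirichlet m s * cos (2 * pi * z%:~R * s + p)) =
  (`|z| <= m)%N%:R * cos p.
Proof.
elim: m => [|m IH].
  rewrite leqn0 absz_eq0 -segint_cos; apply: eq_segint => s _.
  by rewrite /dirichlet big_ord0 mulr0 addr0 mul1r.
transitivity (segint 0 1 (fun s => dirichlet m s * cos (2 * pi * z%:~R * s + p) +
   (cos (2 * pi * (z + Posz m.+1)%:~R * s + p) + cos (2 * pi * (z - Posz m.+1)%:~R * s + p)))).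
  apply: eq_segint => s _; rewrite dirichletS mulrDl; congr (_ + _).
  rewrite intrD intrB -[(Posz m.+1)%:~R]/(m.+1%:R : R).
  set A := 2 * pi * m.+1%:R * s; set B := 2 * pi * z%:~R * s + p.
  have -> : 2 * pi * (z%:~R + m.+1%:R) * s + p = B + A by rewrite /A /B; ring.
  have -> : 2 * pi * (z%:~R - m.+1%:R) * s + p = B - A by rewrite /A /B; ring.
  by rewrite cosB (cosD B A); ring.
rewrite !segintD; [|continuity..]; rewrite IH !segint_cos -!mulrDl -!natrD.
by congr (_%:R * _); lia.
Qed.

Lemma segint_fejer_cos N z p :
  segint 0 1 (fun s => fejer N s * cos (2 * pi * z%:~R * s + p)) = (N - `|z|)%N%:R * cos p.
Proof.
elim: N => [|N IH].
  rewrite sub0n mul0r -[RHS]segint01_cst; apply: eq_segint => s _.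
  by rewrite /fejer big_ord0 mul0r.
under eq_segint => s _ do rewrite fejerS mulrDl.
rewrite segintD; [|continuity..]; rewrite IH segint_dirichlet_cos -mulrDl -natrD.
by congr (_%:R * _); lia.
Qed.

Lemma segint_fejer N : segint 0 1 (fejer N) = N%:R :> R.
Proof.
have := segint_fejer_cos N 0 0; rewrite subn0 cos0 mulr1 => <-; apply: eq_segint => s _.
by rewrite mulr0 mul0r addr0 cos0 mulr1.
Qed.

Lemma segint_norm_bernstein_kernel N :
  segint 0 1 (fun s => `|bernstein_kernel N s|) <= 4 * pi * N%:R.
Proof.
rewrite -(segint_fejer N) -segintZl; last by continuity.
apply: le_segint; [continuity..|move=> s _].
have pi0 : 0 <= 4 * pi :> R by rewrite mulr_ge0 ?pi_ge0.
rewrite normrM (ger0_norm pi0) ler_wpM2l // normrM ger0_norm ?fejer_ge0 //.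
by rewrite ler_piMr ?fejer_ge0 // sin_max.
Qed.

Lemma segint_bernstein_kernel_cos N z p : (`|z| <= N)%N ->
  segint 0 1 (fun s => bernstein_kernel N s * cos (2 * pi * z%:~R * s + p)) =
  - (2 * pi * z%:~R * sin p).
Proof.
move=> zN.
transitivity (segint 0 1 (fun s =>
   2 * pi * (fejer N s * cos (2 * pi * (z + Posz N)%:~R * s + (p - pi / 2))) +
   2 * pi * (fejer N s * cos (2 * pi * (z - Posz N)%:~R * s + (p + pi / 2))))).
  apply: eq_segint => s _; rewrite !addrA cosBpihalf cosDpihalf /bernstein_kernel.
  rewrite intrD intrB -[(Posz N)%:~R]/(N%:R : R).
  set A := 2 * pi * N%:R * s; set B := 2 * pi * z%:~R * s + p.
  have -> : 2 * pi * (z%:~R + N%:R) * s + p = B + A by rewrite /A /B; ring.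
  have -> : 2 * pi * (z%:~R - N%:R) * s + p = B - A by rewrite /A /B; ring.
  by rewrite sinD sinB; ring.
rewrite segintD; [|continuity..]; rewrite !segintZl; [|continuity..].
rewrite !segint_fejer_cos cosBpihalf cosDpihalf.
case: z zN => n; rewrite ?NegzE => nN.
  have -> : (N - absz (Posz n + Posz N)%R = 0)%N by lia.
  have -> : (N - absz (Posz n - Posz N)%R = n)%N by lia.
  by rewrite -[(Posz n)%:~R]/(n%:R : R); ring.
have -> : (N - absz (- Posz n.+1 + Posz N)%R = n.+1)%N by lia.
have -> : (N - absz (- Posz n.+1 - Posz N)%R = 0)%N by lia.
by rewrite mulrNz -[(Posz n.+1)%:~R]/(n.+1%:R : R); ring.
Qed.

Lemma segint_fejer_dirichlet N m : (m <= N)%N ->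
  segint 0 1 (fun s => fejer N s * dirichlet m s) =
  N%:R + 2 * N%:R * m%:R - m%:R - m%:R ^+ 2.
Proof.
elim: m => [|m IH] mN.
  rewrite !mulr0 expr0n /= addr0 !subr0 -[RHS]segint_fejer; apply: eq_segint => s _.
  by rewrite /dirichlet big_ord0 mulr0 addr0 mulr1.
transitivity (segint 0 1 (fun s => fejer N s * dirichlet m s +
   2 * (fejer N s * cos (2 * pi * (Posz m.+1)%:~R * s + 0)))).
  by apply: eq_segint => s _; rewrite dirichletS mulrDr addr0 mulrCA.
rewrite segintD; [|continuity..]; rewrite segintZl; last by continuity.
by rewrite IH 1?ltnW // segint_fejer_cos absz_nat cos0 natrB // -[m.+1%:R]natr1; ring.
Qed.

Lemma segint_fejer_sqr N : segint 0 1 (fun s => fejer N s ^+ 2) = (2 * N%:R ^+ 3 + N%:R) / 3.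
Proof.
have partial n : (n <= N)%N -> segint 0 1 (fun s => fejer N s * fejer n s) =
    n%:R * N%:R + (2 * N%:R - 1) * (n%:R * (n%:R - 1) / 2)
    - (n%:R - 1) * n%:R * (2 * n%:R - 1) / 6.
  elim: n => [|n IH] nN.
    rewrite (eq_segint (g := fun _ => 0)) ?segint01_cst; first by ring.
    by move=> s _; rewrite [X in _ * X]/fejer big_ord0 mulr0.
  under eq_segint => s _ do rewrite (fejerS n) mulrDr.
  rewrite segintD; [|continuity..].
  by rewrite IH ?segint_fejer_dirichlet; [rewrite -natr1; field|exact: ltnW..].
by under eq_segint => s _ do rewrite expr2; rewrite partial //; field.
Qed.

Lemma sin2_half s : sin (pi * s) ^+ 2 = (1 - cos (2 * pi * s)) / 2.
Proof.
have -> : 2 * pi * s = (pi * s) *+ 2 by rewrite -mulr_natr; ring.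
by rewrite cos_mulr2n sin2cos2 -mulr_natr; field.
Qed.

Lemma segint_fejer_sqr_sin_sqr N : segint 0 1 (fun s => fejer N s ^+ 2 * sin (pi * s) ^+ 2) <= N%:R.
Proof.
rewrite -(segint_fejer N); apply: le_segint; [continuity..|move=> s _].
have -> : fejer N s ^+ 2 * sin (pi * s) ^+ 2 =
    fejer N s * ((1 - cos (2 * pi * s)) * fejer N s / 2) by rewrite sin2_half; ring.
rewrite fejerE ler_piMr ?fejer_ge0 //.
have := cos_geN1 (2 * pi * N%:R * s); lra.
Qed.

(* Jordan's inequality, from [sin x = 2 sin (x / 2) cos (x / 2)] and
   [cos >= 1 / sqrt 2] on [[0, pi / 4]]. *)
Lemma le_sin_pi s : 0 <= s <= 1 / 2 -> s <= sin (pi * s).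
Proof.
move=> /andP[s0 s1]; pose y := pi * s / 2; pose c := cos (pi / 4 : R).
have pi2 := @pi_ge2 R; have pi0 := @pi_gt0 R.
have c2 : c ^+ 2 = 1 / 2.
  have := cos_mulr2n (pi / 4 : R); rewrite -/c.
  by rewrite (_ : (pi / 4) *+ 2 = pi / 2) ?cos_pihalf -mulr_natr; [lra|field].
have c0 : 0 <= c by apply: cos_ge0_pihalf; lra.
have y0 : 0 <= y by rewrite /y; nra.
have y1 : y <= pi / 4 by rewrite /y; nra.
have le_cos (r : R) : 0 <= r -> r <= pi / 4 -> c <= cos r.
  move=> r0; rewrite le_eqVlt => /predU1P[->//|r1]; rewrite ltW //.
  by rewrite ltr_cos // in_itv /=; apply/andP; split; lra.
have siny : y * c <= sin y.
  have := segint_slope 0 y (@continuous_cos R) (fun x => is_derive_sin x).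
  rewrite add0r sin0 subr0 => ->; rewrite ler_wpM2l // -[leLHS]segint01_cst.
  apply: le_segint; [continuity..|move=> r /andP[r0 r1]].
  by rewrite add0r; apply: le_cos; nra.
rewrite (_ : pi * s = y *+ 2); last by rewrite /y -mulr_natr; field.
rewrite sin_mulr2n -mulr_natr.
have sy : s <= y by rewrite /y; nra.
have yc : y * c * c <= sin y * cos y.
  by apply: ler_pM => //; [exact: mulr_ge0|exact: le_cos].
by have := c2; rewrite expr2 => cc; nra.
Qed.

End Fejer.

(** * Trigonometric polynomials and Bernstein's inequality *)

Definition dot (R : realType) (k x : 'rV[R]_3) : R := \sum_(i < 3) k 0 i * x 0 i.

Definition mode (R : realType) (k : 'rV[R]_3) (p : R) (x : 'rV[R]_3) : R :=
  cos (2 * pi * dot k x + p).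

Definition int_vec (R : realType) (k : 'rV[R]_3) : Prop := forall i, k 0 i \is a Num.int.

Definition freq_box (R : realType) (b : 'I_3 -> R) (k : 'rV[R]_3) : Prop :=
  int_vec k /\ forall i, `|k 0 i| <= b i.

Inductive trigpoly (R : realType) (b : 'I_3 -> R) : ('rV[R]_3 -> R) -> Prop :=
| trigpoly0 : trigpoly b (fun _ => 0)
| trigpoly_cons f (c : R) k p : trigpoly b f -> freq_box b k ->
    trigpoly b (fun x => f x + c * mode k p x).

Lemma continuous_mode (R : realType) (k : 'rV[R]_3) p : continuous (mode k p).
Proof. by rewrite /mode /dot; continuity. Qed.

#[global] Hint Resolve continuous_mode : continuity.

Section Modes.
Variable R : realType.
Local Notation pt := 'rV[R]_3.
Implicit Types (k l x y v : pt) (p q : R).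

Lemma dotDl k l x : dot (k + l) x = dot k x + dot l x.
Proof. by rewrite /dot -big_split; apply: eq_bigr => i _; rewrite mxE mulrDl. Qed.

Lemma dotDr k x y : dot k (x + y) = dot k x + dot k y.
Proof. by rewrite /dot -big_split; apply: eq_bigr => i _; rewrite mxE mulrDr. Qed.

Lemma dotNl k x : dot (- k) x = - dot k x.
Proof. by rewrite /dot -sumrN; apply: eq_bigr => i _; rewrite mxE mulNr. Qed.

Lemma dotNr k x : dot k (- x) = - dot k x.
Proof. by rewrite /dot -sumrN; apply: eq_bigr => i _; rewrite mxE mulrN. Qed.

Lemma dotZl k (c : R) x : dot (c *: k) x = c * dot k x.
Proof. by rewrite /dot mulr_sumr; apply: eq_bigr => i _; rewrite mxE mulrA. Qed.

Lemma dotZr k (c : R) x : dot k (c *: x) = c * dot k x.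
Proof. by rewrite /dot mulr_sumr; apply: eq_bigr => i _; rewrite mxE mulrCA. Qed.

Lemma dot0l x : dot 0 x = 0.
Proof. by rewrite -(scale0r 0) dotZl mul0r. Qed.

Lemma dot_e3r k i : dot k (e3 R i) = k 0 i.
Proof.
rewrite /dot (bigD1 i) //= big1 ?addr0; first by rewrite mxE !eqxx mulr1.
by move=> j ji; rewrite mxE (negbTE ji) andbF mulr0.
Qed.

Lemma dot_e3l i x : dot (e3 R i) x = x 0 i.
Proof. by rewrite -[RHS]dot_e3r /dot; apply: eq_bigr => j _; rewrite mulrC. Qed.

Lemma mode0 p x : mode 0 p x = cos p.
Proof. by rewrite /mode dot0l mulr0 add0r. Qed.

Lemma mode_line k p x v (s : R) :
  mode k p (x + s *: v) = cos (2 * pi * dot k v * s + (2 * pi * dot k x + p)).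
Proof. by rewrite /mode dotDr dotZr; congr cos; ring. Qed.

Lemma mode_shift k p x y : mode k p (x + y) = mode k (p + 2 * pi * dot k x) y.
Proof. by rewrite /mode dotDr; congr cos; ring. Qed.

Lemma modeN k p x : mode k p (- x) = mode (- k) p x.
Proof. by rewrite /mode dotNr dotNl. Qed.

Lemma mode_mul k p l q x : mode k p x * mode l q x =
  1 / 2 * mode (k + l) (p + q) x + 1 / 2 * mode (k - l) (p - q) x.
Proof.
rewrite /mode !dotDl dotNl.
set A := 2 * pi * dot k x + p; set B := 2 * pi * dot l x + q.
have -> : 2 * pi * (dot k x + dot l x) + (p + q) = A + B by rewrite /A /B; ring.
have -> : 2 * pi * (dot k x - dot l x) + (p - q) = A - B by rewrite /A /B; ring.
by rewrite cosB (cosD A B); field.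
Qed.

Lemma is_partial_mode i k p :
  is_partial i (mode k p) (fun x => 2 * pi * k 0 i * mode k (p + pi / 2) x).
Proof.
move=> x; apply/has_derive_line.
have -> : (fun s : R => mode k p (s *: e3 R i + x)) =
    (fun s => cos (2 * pi * k 0 i * s + (2 * pi * dot k x + p))).
  by apply: funext => s; rewrite addrC mode_line dot_e3r.
rewrite -[X in has_derive _ _ _ X](_ :
    - sin (2 * pi * k 0 i * 0 + (2 * pi * dot k x + p)) * (2 * pi * k 0 i * 1 + 0) = _).
  apply: (@has_derive_cos _ (fun s => 2 * pi * k 0 i * s + (2 * pi * dot k x + p))).
  by apply: has_deriveD; [apply: has_deriveZ; exact: has_derive_id|exact: has_derive_cst].
by rewrite /mode (addrA _ p) cosDpihalf mulr0 add0r; ring.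
Qed.

Lemma int_vecN k : int_vec k -> int_vec (- k).
Proof. by move=> ik i; rewrite mxE rpredN. Qed.

Lemma int_vecD k l : int_vec k -> int_vec l -> int_vec (k + l).
Proof. by move=> ik il i; rewrite mxE rpredD. Qed.

Lemma cperiodic_mode k p : int_vec k -> cperiodic (mode k p).
Proof.
move=> ik; split=> [|x i]; first exact: continuous_mode.
rewrite /mode dotDr dot_e3r; have /intrP[z ->] := ik i.
by rewrite mulrDr addrAC cosD2pi_int.
Qed.

Lemma even_kernel_mode k : int_vec k -> even_kernel (mode k 0).
Proof.
move=> ik; split=> [|y]; first exact: cperiodic_mode.
by rewrite modeN /mode dotNl -cosN; congr cos; ring.
Qed.

Lemma torint_mode k p : int_vec k -> torint (mode k p) = (k == 0)%:R * cos p.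
Proof.
move=> ik; have [->|k0] := eqVneq k 0.
  by rewrite mul1r -[RHS]torint_cst; apply: eq_torint => x _; exact: mode0.
rewrite mul0r; have [i ki] : exists i, k 0 i != 0.
  apply/existsP; apply: contraNT k0 => /existsPn ki0; apply/eqP/rowP => j.
  by rewrite mxE; have := ki0 j; rewrite negbK => /eqP.
(* half a period of the mode in the direction [i] *)
have shifted := torint_shift ((2 * k 0 i)^-1 *: e3 R i) (cperiodic_mode p ik).
have opposite : torint (fun x => mode k p (x + (2 * k 0 i)^-1 *: e3 R i)) = - torint (mode k p).
  rewrite -torintN; last by continuity.
  apply: eq_torint => x _; rewrite mode_line dot_e3r /mode.
  have -> : 2 * pi * k 0 i * (2 * k 0 i)^-1 = pi by field.
  by rewrite addrC cosDpi.
by move: shifted; rewrite opposite; lra.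
Qed.

Lemma conv_mode l k p x : int_vec l -> int_vec k -> conv (mode l 0) (mode k p) x =
  1 / 2 * ((l == k)%:R + (l == - k)%:R) * mode k p x.
Proof.
move=> il ik; set q := p + 2 * pi * dot k x.
transitivity (torint (fun y => 1 / 2 * mode (l + k) (0 + q) y + 1 / 2 * mode (l - k) (0 - q) y)).
  by apply: eq_torint => y _; rewrite mode_shift mode_mul.
rewrite torintD; [|continuity..]; rewrite !torintZl; [|continuity..].
rewrite !torint_mode; [|exact: int_vecD il (int_vecN ik)|exact: int_vecD].
rewrite add0r sub0r cosN addr_eq0 subr_eq0 /mode -/q addrC /q.
by rewrite (addrC p); ring.
Qed.

End Modes.

Section TrigPoly.
Variable R : realType.
Local Notation pt := 'rV[R]_3.
Implicit Types (f g u : pt -> R) (k x : pt) (b : 'I_3 -> R).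

Lemma freq_boxN b k : freq_box b k -> freq_box b (- k).
Proof. by move=> [ik bk]; split=> [|i]; [exact: int_vecN|rewrite mxE normrN]. Qed.

Lemma freq_boxD b1 b2 k l :
  freq_box b1 k -> freq_box b2 l -> freq_box (fun i => b1 i + b2 i) (k + l).
Proof.
move=> [ik bk] [il bl]; split=> [|i]; first exact: int_vecD.
by rewrite mxE (le_trans (ler_normD _ _)) // lerD.
Qed.

Lemma trigpoly_ext b f g : (forall x, f x = g x) -> trigpoly b f -> trigpoly b g.
Proof. by move=> fg; rewrite (funext fg). Qed.

Lemma trigpolyD b f g : trigpoly b f -> trigpoly b g -> trigpoly b (fun x => f x + g x).
Proof.
move=> Tf; elim=> [|h c k p _ IH bk]; first by apply: trigpoly_ext Tf => x; rewrite addr0.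
by apply: trigpoly_ext (trigpoly_cons c p IH bk) => x; rewrite addrA.
Qed.

Lemma trigpolyZ b c f : trigpoly b f -> trigpoly b (fun x => c * f x).
Proof.
elim=> [|h d k p _ IH bk]; first by apply: trigpoly_ext (trigpoly0 b) => x; rewrite mulr0.
by apply: trigpoly_ext (trigpoly_cons (c * d) p IH bk) => x; rewrite mulrDr mulrA.
Qed.

Lemma trigpoly_mode b k p : freq_box b k -> trigpoly b (mode k p).
Proof.
by move=> bk; apply: trigpoly_ext (trigpoly_cons 1 p (trigpoly0 b) bk) => x; rewrite add0r mul1r.
Qed.

Lemma trigpoly_sum b (I : Type) (r : seq I) (F : I -> pt -> R) :
  (forall i, trigpoly b (F i)) -> trigpoly b (fun x => \sum_(i <- r) F i x).
Proof.
move=> TF; elim: r => [|i r IH].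
  by apply: trigpoly_ext (trigpoly0 b) => x; rewrite big_nil.
by apply: trigpoly_ext (trigpolyD (TF i) IH) => x; rewrite big_cons.
Qed.

Lemma trigpoly_le b1 b2 f : (forall i, b1 i <= b2 i) -> trigpoly b1 f -> trigpoly b2 f.
Proof.
move=> b12; elim=> [|h c k p _ IH [ik bk]]; first exact: trigpoly0.
by apply: trigpoly_cons => //; split=> // i; exact: le_trans (bk i) (b12 i).
Qed.

Lemma trigpolyM b1 b2 f g : trigpoly b1 f -> trigpoly b2 g ->
  trigpoly (fun i => b1 i + b2 i) (fun x => f x * g x).
Proof.
move=> Tf Tg; elim: Tf => [|h c k p _ IH bk].
  by apply: trigpoly_ext (trigpoly0 _) => x; rewrite mul0r.
suff Tkg : trigpoly (fun i => b1 i + b2 i) (fun x => mode k p x * g x).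
  by apply: trigpoly_ext (trigpolyD IH (trigpolyZ c Tkg)) => x; rewrite mulrDl mulrA.
elim: Tg => [|h' d l q _ IH' bl].
  by apply: trigpoly_ext (trigpoly0 _) => x; rewrite mulr0.
have Tkl := trigpolyD (trigpolyZ (1 / 2) (trigpoly_mode (p + q) (freq_boxD bk bl)))
  (trigpolyZ (1 / 2) (trigpoly_mode (p - q) (freq_boxD bk (freq_boxN bl)))).
apply: trigpoly_ext (trigpolyD IH' (trigpolyZ d Tkl)) => x.
by rewrite [in RHS]mulrDr [X in _ = _ + X]mulrCA (mode_mul k).
Qed.

Lemma cperiodic_trigpoly b f : trigpoly b f -> cperiodic f.
Proof.
elim=> [|h c k p _ Hh [ik _]]; first exact: cperiodic_cst.
by apply: cperiodicD => //; apply: cperiodicM; [exact: cperiodic_cst|exact: cperiodic_mode].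
Qed.

Lemma is_partial_trigpoly b f i : trigpoly b f -> exists2 df, trigpoly b df & is_partial i f df.
Proof.
elim=> [|h c k p _ [dh Tdh pdh] bk].
  by exists (fun _ => 0); [exact: trigpoly0|exact: is_partial_cst].
exists (fun x => dh x + c * (2 * pi * k 0 i * mode k (p + pi / 2) x)).
  by apply: trigpolyD => //; do 2 apply: trigpolyZ; exact: trigpoly_mode.
by apply: is_partialD => //; apply: is_partialZ; exact: is_partial_mode.
Qed.

Lemma continuous_partial_trigpoly b i (A dA : pt -> R) :
  trigpoly b A -> is_partial i A dA -> continuous dA.
Proof.
move=> TA pA; have [B TB pB] := is_partial_trigpoly i TA.
by rewrite (is_partial_unique pA pB); have [] := cperiodic_trigpoly TB.
Qed.

Lemma trigpoly_reflect b f x : trigpoly b f -> trigpoly b (fun y => f (x - y)).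
Proof.
elim=> [|h c k p _ IH bk]; first exact: trigpoly0.
apply: trigpoly_ext
  (trigpolyD IH (trigpolyZ c (trigpoly_mode (p + 2 * pi * dot k x) (freq_boxN bk)))) => y.
by rewrite mode_shift modeN.
Qed.

(* The addition formula [cos (a - b) = cos a * cos b + sin a * sin b] separates the variables. *)
Lemma trigpoly_conv b K u : trigpoly b K -> even3 K -> cperiodic u -> trigpoly b (conv K u).
Proof.
move=> TK eK Hu; have HK := cperiodic_trigpoly TK.
apply: (trigpoly_ext (f := fun x => torint (fun y => K (x - y) * u y))).
  by move=> x; rewrite convE.
elim: TK => [|h c k p Th IH bk].
  by apply: trigpoly_ext (trigpoly0 _) => x; rewrite torint0 // => y; rewrite mul0r.
have Hh := cperiodic_trigpoly Th.
pose a q := c * torint (fun y => mode k q y * u y).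
apply: trigpoly_ext (trigpolyD IH (trigpolyD (trigpolyZ (a 0) (trigpoly_mode p bk))
   (trigpolyZ (a (- (pi / 2))) (trigpoly_mode (p - pi / 2) bk)))) => x.
rewrite ![a _ * _]mulrC /a !mulrA -!torintZl; [|continuity..].
rewrite -!torintD; [|continuity..].
apply: eq_torint => y _; rewrite /mode !dotDr !dotNr.
set A := 2 * pi * dot k x + p; set B := 2 * pi * dot k y.
have -> : 2 * pi * (dot k x - dot k y) + p = A - B by rewrite /A /B; ring.
have -> : 2 * pi * dot k x + (p - pi / 2) = A - pi / 2 by rewrite /A; ring.
by rewrite !cosBpihalf addr0 cosB; ring.
Qed.

Lemma is_partial_bernstein b N i f : trigpoly b f -> b i <= N%:R ->
  is_partial i f (fun x => segint 0 1 (fun s => bernstein_kernel N s * f (x + s *: e3 R i))).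
Proof.
move=> Tf bN; elim: Tf => [|h c k p Th IH [ik bk]] x.
  rewrite (_ : segint _ _ _ = 0); first exact: has_derive_cst.
  by rewrite -[RHS]segint01_cst; apply: eq_segint => s _; rewrite mulr0.
have Hh := cperiodic_trigpoly Th.
have /intrP[z kz] := ik i.
have zN : (`|z| <= N)%N.
  by rewrite -(ler_nat R) natr_absz intr_norm -kz (le_trans (bk i)).
have modeE : 2 * pi * k 0 i * mode k (p + pi / 2) x =
    segint 0 1 (fun s => bernstein_kernel N s * mode k p (x + s *: e3 R i)).
  transitivity (segint 0 1 (fun s =>
      bernstein_kernel N s * cos (2 * pi * z%:~R * s + (2 * pi * dot k x + p)))).
    by rewrite segint_bernstein_kernel_cos // /mode (addrA _ p) cosDpihalf kz; ring.
  by apply: eq_segint => s _; rewrite mode_line dot_e3r kz.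
rewrite (_ : segint _ _ _ =
    segint 0 1 (fun s => bernstein_kernel N s * h (x + s *: e3 R i)) +
    c * (2 * pi * k 0 i * mode k (p + pi / 2) x)).
  by apply: has_deriveD; [exact: IH|apply: has_deriveZ; exact: is_partial_mode].
rewrite modeE -segintZl; last by continuity.
rewrite -segintD; [|continuity..].
by apply: eq_segint => s _; ring.
Qed.

End TrigPoly.

(* Comparable to the distance from [y] to the integer lattice. *)
Definition lattice_dist (R : realType) (y : 'rV[R]_3) : R := \sum_(i < 3) `|sin (pi * y 0 i)|.

Lemma continuous_lattice_dist (R : realType) : continuous (@lattice_dist R).
Proof. by rewrite /lattice_dist; continuity. Qed.

#[global] Hint Resolve continuous_lattice_dist : continuity.

Section Bernstein.
Variable R : realType.
Local Notation pt := 'rV[R]_3.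
Variable nrm : (pt -> R) -> R.
Hypothesis tnorm : transl_norm nrm.
Implicit Types (f : pt -> R) (b : 'I_3 -> R).

Lemma lattice_dist_ge0 (y : pt) : 0 <= lattice_dist y.
Proof. exact: sumr_ge0. Qed.

Lemma tnorm_bernstein b N i f : trigpoly b f -> b i <= N%:R ->
  exists df, [/\ cperiodic df, is_partial i f df & nrm df <= 4 * pi * N%:R * nrm f].
Proof.
move=> Tf bN; have Hf := cperiodic_trigpoly Tf.
exists (fun x => segint 0 1 (fun s => bernstein_kernel N s * f (x + s *: e3 R i))); split.
- split=> [|x j]; first by continuity.
  by apply: eq_segint => s _; rewrite addrAC Hf.2.
- exact: is_partial_bernstein Tf bN.
- have := tnorm_average tnorm (W := bernstein_kernel N) (tau := fun s : R => s *: e3 R i)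
    (segint_is_radon (@ler01 R)) _ _ Hf.
  move=> /(_ _ _)/le_trans -> //; [continuity..|].
  by rewrite ler_wpM2r ?(tnorm_ge0 tnorm) // segint_norm_bernstein_kernel.
Qed.

Lemma tnorm_incr_unit i f df (h : R) : 0 <= h <= 1 ->
  is_partial i f df -> cperiodic f -> cperiodic df ->
  nrm (fun x => f (x + h *: e3 R i) - f x) <= `|sin (pi * h)| * nrm df.
Proof.
move=> /andP[h0 h1] pf Hf Hdf; case: (leP h (1 / 2)) => h2.
  apply: le_trans (tnorm_incr_partial tnorm h pf Hdf) _.
  rewrite ler_wpM2r ?(tnorm_ge0 tnorm) // (ger0_norm h0).
  by apply: le_trans (ler_norm _); apply: le_sin_pi; lra.
rewrite (_ : (fun x => _) = (fun x => f (x + (h - 1) *: e3 R i) - f x)); last first.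
  apply: funext => x.
  by rewrite -(Hf.2 (x + (h - 1) *: e3 R i) i) -addrA scalerBl scale1r subrK.
apply: le_trans (tnorm_incr_partial tnorm (h - 1) pf Hdf) _.
rewrite ler_wpM2r ?(tnorm_ge0 tnorm) // distrC ger0_norm; last by lra.
apply: le_trans (ler_norm _); have := @le_sin_pi R (1 - h).
by rewrite mulrBr mulr1 sinB sinpi cospi mul0r sub0r mulN1r opprK; apply; lra.
Qed.

Lemma incr_coordinates f (y : pt) : (fun x => f (x + y) - f x) = (fun x =>
  (f (x + y 0 ord0 *: e3 R ord0) - f x) +
  (f (x + y 0 ord0 *: e3 R ord0 + y 0 (lift ord0 ord0) *: e3 R (lift ord0 ord0))
     - f (x + y 0 ord0 *: e3 R ord0)) +
  (f (x + (y 0 ord0 *: e3 R ord0 + y 0 (lift ord0 ord0) *: e3 R (lift ord0 ord0))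
        + y 0 ord_max *: e3 R ord_max)
     - f (x + (y 0 ord0 *: e3 R ord0 + y 0 (lift ord0 ord0) *: e3 R (lift ord0 ord0))))).
Proof.
by apply: funext => x; rewrite {1}(vec3_coord y) vec3_basis !addrA; ring.
Qed.

Lemma tnorm_incr_trigpoly b N f (y : pt) :
  trigpoly b f -> (forall i, b i <= N%:R) -> cube y ->
  nrm (fun x => f (x + y) - f x) <= 4 * pi * N%:R * lattice_dist y * nrm f.
Proof.
move=> Tf bN cy; have Hf := cperiodic_trigpoly Tf.
pose D i x := f (x + y 0 i *: e3 R i) - f x.
have HD i : cperiodic (D i) by exact: cperiodic_incr.
have nD i z : nrm (fun x => D i (x + z)) <= `|sin (pi * y 0 i)| * (4 * pi * N%:R * nrm f).
  have [df [Hdf pdf ndf]] := tnorm_bernstein Tf (bN i).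
  apply: le_trans (tnorm_shift tnorm z (HD i)) _.
  by apply: le_trans (tnorm_incr_unit (cy i) pdf Hf Hdf) _; rewrite ler_wpM2l.
have -> : 4 * pi * N%:R * lattice_dist y * nrm f =
    \sum_(i < 3) `|sin (pi * y 0 i)| * (4 * pi * N%:R * nrm f).
  by rewrite /lattice_dist -mulr_suml; ring.
have HDs i z : cperiodic (fun x => D i (x + z)) by exact: cperiodic_shift.
rewrite big_ord3 incr_coordinates.
apply: le_trans (tnormD tnorm _ (HDs ord_max _)) _.
  by apply: cperiodicD; [exact: HD|exact: HDs].
apply: lerD; last exact: nD.
apply: le_trans (tnormD tnorm (HD ord0) (HDs _ _)) _; apply: lerD; last exact: nD.
by have := nD ord0 0; under [X in nrm X]eq_fun do rewrite addr0.
Qed.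

End Bernstein.

(** * The Jackson kernel *)

Section JacksonDefs.
Variable R : realType.
Local Notation pt := 'rV[R]_3.

Definition jackson_mass N : R := segint 0 1 (fun s => fejer N s ^+ 2).

Definition jackson1 N (s : R) : R := fejer N s ^+ 2 / jackson_mass N.

Definition jackson N (y : pt) : R := \prod_(i < 3) jackson1 N (y 0 i).

Definition lattice_sqdist (y : pt) : R := \sum_(i < 3) sin (pi * y 0 i) ^+ 2.

Definition scaled_dist N (y : pt) : R := 1 + N%:R * lattice_dist y.

Lemma continuous_jackson1 N : continuous (jackson1 N).
Proof. by rewrite /jackson1; continuity. Qed.

Lemma continuous_jackson N : continuous (jackson N).
Proof. by rewrite /jackson /jackson1; continuity. Qed.

Lemma continuous_lattice_sqdist : continuous lattice_sqdist.
Proof. by rewrite /lattice_sqdist; continuity. Qed.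

Lemma continuous_scaled_dist N : continuous (scaled_dist N).
Proof. by rewrite /scaled_dist; continuity. Qed.

End JacksonDefs.

#[global] Hint Resolve continuous_jackson1 continuous_jackson continuous_lattice_sqdist
  continuous_scaled_dist : continuity.

Section Jackson.
Variable R : realType.
Local Notation pt := 'rV[R]_3.
Implicit Types (y : pt) (N : nat).

Lemma torint_prod (g : 'I_3 -> R -> R) : (forall i, continuous (g i)) ->
  torint (fun y => \prod_(i < 3) g i (y 0 i)) = \prod_(i < 3) segint 0 1 (g i).
Proof.
move=> cg; have prod3 (c : 'I_3 -> R) :
    \prod_(i < 3) c i = c ord0 * (c (lift ord0 ord0) * c ord_max).
  rewrite !big_ord_recl big_ord0 mulr1; congr (_ * (_ * c _)); exact: val_inj.
rewrite torint_segint prod3 mulrC -[RHS]segintZl //; apply: eq_segint => a _.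
rewrite -mulrA mulrC -[RHS]segintZl //; apply: eq_segint => b _.
rewrite -mulrA mulrC -[RHS]segintZl //; apply: eq_segint => c _.
by rewrite prod3 !mxE /=; ring.
Qed.

Lemma jackson_mass_gt0 N : (0 < N)%N -> 0 < jackson_mass R N.
Proof.
move=> N0; rewrite /jackson_mass segint_fejer_sqr.
by rewrite divr_gt0 // addr_gt0 ?mulr_gt0 ?exprn_gt0 ?ltr0n.
Qed.

Lemma jackson1_ge0 N (s : R) : 0 <= jackson1 N s.
Proof.
rewrite divr_ge0 ?sqr_ge0 //.
by apply: (radon_ge0 (segint_is_radon (@ler01 R))) => [|r]; [continuity|exact: sqr_ge0].
Qed.

Lemma jackson_ge0 N y : 0 <= jackson N y.
Proof. by apply: prodr_ge0 => i _; exact: jackson1_ge0. Qed.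

Lemma even_kernel_jackson N : even_kernel (@jackson R N).
Proof.
split; first split; first by continuity.
- move=> y i; apply: eq_bigr => j _; rewrite !mxE eqxx /= /jackson1.
  by case: eqP => _; rewrite ?addr0 // fejerD1.
- by move=> y; apply: eq_bigr => i _; rewrite mxE /jackson1 fejerN.
Qed.

Lemma segint_jackson1 N : (0 < N)%N -> segint 0 1 (jackson1 N) = 1 :> R.
Proof.
move=> /jackson_mass_gt0 m0; under eq_segint => s _ do rewrite /jackson1 mulrC.
by rewrite segintZl ?mulVf ?gt_eqF //; continuity.
Qed.

Lemma torint_jackson N : (0 < N)%N -> torint (@jackson R N) = 1.
Proof.
move=> N0; rewrite /jackson (torint_prod (g := fun _ => jackson1 N)) => [|i].
  by rewrite big1 // => i _; exact: segint_jackson1.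
exact: continuous_jackson1.
Qed.

Lemma segint_jackson1_sin_sqr N : (0 < N)%N ->
  segint 0 1 (fun s => jackson1 N s * sin (pi * s) ^+ 2) <= 3 / 2 / N%:R ^+ 2 :> R.
Proof.
move=> N0; have m0 := jackson_mass_gt0 N0; have n0 : 0 < N%:R :> R by rewrite ltr0n.
under eq_segint => s _ do rewrite /jackson1 mulrAC [_ / _]mulrC.
rewrite segintZl; last by continuity.
rewrite mulrC ler_pdivrMr //; apply: le_trans (segint_fejer_sqr_sin_sqr R N) _.
rewrite /jackson_mass segint_fejer_sqr; set n : R := N%:R.
have -> : 3 / 2 / n ^+ 2 * ((2 * n ^+ 3 + n) / 3) = n + 1 / 2 / n by field; rewrite gt_eqF.
by rewrite lerDl !divr_ge0 // ltW.
Qed.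

Lemma torint_jackson_sin_sqr N i : (0 < N)%N ->
  torint (fun y : pt => jackson N y * sin (pi * y 0 i) ^+ 2) <= 3 / 2 / N%:R ^+ 2.
Proof.
move=> N0; pose g j (s : R) := jackson1 N s * (if j == i then sin (pi * s) ^+ 2 else 1).
rewrite (_ : torint _ = torint (fun y => \prod_(j < 3) g j (y 0 j))); last first.
  apply: eq_torint => y _; rewrite big_split; congr (_ * _).
  by rewrite (bigD1 i) //= eqxx big1 ?mulr1 // => j /negbTE ->.
rewrite torint_prod => [|j]; last by rewrite /g; case: eqP => _; continuity.
rewrite (bigD1 i) //= big1 ?mulr1 => [|j /negbTE ji].
  by under eq_segint => s _ do rewrite /g eqxx; exact: segint_jackson1_sin_sqr.
by under eq_segint => s _ do rewrite /g ji mulr1; exact: segint_jackson1.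
Qed.

Lemma lattice_sqdist_ge0 y : 0 <= lattice_sqdist y.
Proof. by apply: sumr_ge0 => i _; exact: sqr_ge0. Qed.

Lemma torint_jackson_sqdist N : (0 < N)%N ->
  torint (fun y : pt => jackson N y * lattice_sqdist y) <= 9 / 2 / N%:R ^+ 2.
Proof.
move=> N0; under [X in torint X]eq_fun do rewrite /lattice_sqdist mulr_sumr.
rewrite torint_sum => [|i]; last by continuity.
rewrite (_ : 9 / 2 / N%:R ^+ 2 = \sum_(i < 3) (3 / 2 / N%:R ^+ 2)).
  by apply: ler_sum => i _; exact: torint_jackson_sin_sqr.
by rewrite sumr_const card_ord -mulr_natr; ring.
Qed.

Lemma sqr_lattice_dist y : lattice_dist y ^+ 2 <= 3 * lattice_sqdist y.
Proof.
rewrite /lattice_dist /lattice_sqdist !big_ord3 -!(real_normK (num_real (sin _))).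
set a := `|_|; set b := `|_|; set c := `|_|.
have := sqr_ge0 (a - b); have := sqr_ge0 (a - c); have := sqr_ge0 (b - c); nra.
Qed.

Lemma torint_jackson_scaled_dist N : (0 < N)%N ->
  torint (fun y : pt => jackson N y * scaled_dist N y ^+ 2) <= 29.
Proof.
move=> N0; have n0 : 0 < N%:R :> R by rewrite ltr0n.
apply: (@le_trans _ _ (torint (fun y : pt =>
    2 * jackson N y + 6 * N%:R ^+ 2 * (jackson N y * lattice_sqdist y)))).
  apply: le_torint; [continuity..|move=> y _].
  have -> : 2 * jackson N y + 6 * N%:R ^+ 2 * (jackson N y * lattice_sqdist y) =
    jackson N y * (2 + 2 * (N%:R ^+ 2 * (3 * lattice_sqdist y))) by ring.
  rewrite ler_wpM2l ?jackson_ge0 // /scaled_dist.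
  have := ler_wpM2l (sqr_ge0 N%:R) (sqr_lattice_dist y); rewrite -exprMn.
  by have := sqr_ge0 (1 - N%:R * lattice_dist y); nra.
rewrite torintD; [|continuity..]; rewrite !torintZl; [|continuity..].
rewrite torint_jackson // mulr1 (_ : 29 = 2 + 6 * N%:R ^+ 2 * (9 / 2 / N%:R ^+ 2)).
  by rewrite lerD2l ler_wpM2l ?mulr_ge0 ?sqr_ge0 // torint_jackson_sqdist.
by field; rewrite gt_eqF.
Qed.

Lemma trigpoly_fejer_coord N i :
  trigpoly (fun j => (j == i)%:R * N%:R) (fun y : pt => fejer N (y 0 i)).
Proof.
have box (l : nat) : (l <= N)%N -> freq_box (fun j => (j == i)%:R * N%:R) (l%:R *: e3 R i).
  move=> lN; split=> j; rewrite !mxE eqxx /=; first by rewrite rpredM // ?natr_int.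
  case: eqP => _; last by rewrite mulr0 normr0 mul0r.
  by rewrite mulr1 mul1r ger0_norm // ler_nat.
apply: trigpoly_sum => m; apply: trigpolyD.
  by apply: trigpoly_ext (trigpoly_mode 0 (box 0%N (leq0n N))) => y; rewrite scale0r mode0 cos0.
apply: trigpolyZ; apply: trigpoly_sum => j.
have := trigpoly_mode 0 (box j.+1 (leq_trans (ltn_ord j) (ltnW (ltn_ord m)))).
by apply: trigpoly_ext => y; rewrite /mode dotZl dot_e3l addr0 mulrA.
Qed.

Lemma trigpoly_jackson N : trigpoly (fun _ => 2 * N%:R) (@jackson R N).
Proof.
have Tsqr i := trigpolyM (trigpoly_fejer_coord N i) (trigpoly_fejer_coord N i).
have Tprod := trigpolyM (trigpolyM (Tsqr ord0) (Tsqr (lift ord0 ord0))) (Tsqr ord_max).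
apply: trigpoly_ext (trigpolyZ ((jackson_mass R N)^-1 ^+ 3) (trigpoly_le _ Tprod)) => [y|i].
  rewrite /jackson !big_ord_recl big_ord0 /jackson1.
  by rewrite (_ : lift ord0 (lift ord0 ord0) = ord_max); [ring|exact: val_inj].
by elim/ord3P: i; rewrite /= ?mul0r ?mul1r ?addr0 ?add0r; lra.
Qed.

End Jackson.

(** * Mollification *)

Notation moll N := (conv (jackson N)).

Section Mollification.
Variable R : realType.
Local Notation pt := 'rV[R]_3.
Implicit Types (f g u : pt -> R) (x y : pt) (N : nat).

Lemma cperiodic_moll N u : cperiodic u -> cperiodic (moll N u).
Proof. by move=> Hu; apply: cperiodic_conv => //; continuity. Qed.

Lemma trigpoly_moll N u : cperiodic u -> trigpoly (fun _ => 2 * N%:R) (moll N u).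
Proof. by apply: trigpoly_conv; [exact: trigpoly_jackson|have [] := even_kernel_jackson R N]. Qed.

Lemma moll_adjoint N f g : cperiodic f -> cperiodic g ->
  torint (fun x => moll N f x * g x) = torint (fun x => f x * moll N g x).
Proof. exact: conv_adjoint (even_kernel_jackson R N). Qed.

Lemma moll_adjoint_sum N (u w : 'I_3 -> pt -> R) :
  (forall i, cperiodic (u i)) -> (forall i, cperiodic (w i)) ->
  \sum_(i < 3) torint (fun x => moll N (u i) x * moll N (w i) x) =
  torint (fun x => \sum_(i < 3) moll N (moll N (u i)) x * w i x).
Proof.
move=> Hu Hw; rewrite torint_sum => [|i]; last by continuity.
by apply: eq_bigr => i _; rewrite [RHS]moll_adjoint //; exact: cperiodic_moll.
Qed.

Lemma mollB N f g x : continuous f -> continuous g ->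
  moll N (fun x => f x - g x) x = moll N f x - moll N g x.
Proof. by apply: convB; continuity. Qed.

Lemma moll_sum N (I : Type) (r : seq I) (F : I -> pt -> R) x : (forall i, continuous (F i)) ->
  moll N (fun x => \sum_(i <- r) F i x) x = \sum_(i <- r) moll N (F i) x.
Proof. by apply: conv_sum; continuity. Qed.

Lemma moll_sub N u x : (0 < N)%N -> continuous u ->
  moll N u x - u x = torint (fun y => jackson N y * (u (x + y) - u x)).
Proof.
move=> N0 cu; rewrite -[X in _ - X]mulr1 -(torint_jackson R N0) -torintZl; last by continuity.
rewrite -torintB; [|continuity..].
by apply: eq_torint => y _; ring.
Qed.

Lemma tnorm_moll (nrm : (pt -> R) -> R) N f :
  transl_norm nrm -> (0 < N)%N -> cperiodic f -> nrm (moll N f) <= nrm f.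
Proof.
move=> tnorm N0 Hf; have cj : continuous (@jackson R N) by continuity.
apply: le_trans (tnorm_conv tnorm cj Hf) _.
rewrite (_ : torint _ = 1) ?mul1r // -(torint_jackson R N0).
by apply: eq_torint => y _; rewrite ger0_norm ?jackson_ge0.
Qed.

Lemma torint_jackson_norm_le N (g h : pt -> R) : continuous g -> continuous h ->
  (forall y, cube y -> `|g y| <= h y) ->
  `|torint (fun y => jackson N y * g y)| <= torint (fun y => jackson N y * h y).
Proof.
move=> cg ch gh; apply: le_trans (torint_norm _) _; first by continuity.
apply: le_torint; [continuity..|move=> y cy].
by rewrite normrM ger0_norm ?jackson_ge0 // ler_wpM2l ?jackson_ge0 // gh.
Qed.

Lemma moll_norm_le N u (M : R) x :
  (0 < N)%N -> cperiodic u -> (forall y, `|u y| <= M) -> `|moll N u x| <= M.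
Proof.
move=> N0 Hu uM; apply: le_trans (Lq_oo_ub (cperiodic_moll N Hu) x) _.
apply: le_trans (tnorm_moll (Lq_oo_transl_norm R) N0 Hu) _.
exact: Lq_oo_le.
Qed.

Definition moll_grad N f (i : 'I_3) x : R := 'D_(e3 R i) (moll N f) x.

Lemma moll_gradP N f i : cperiodic f ->
  is_partial i (moll N f) (moll_grad N f i) /\ cperiodic (moll_grad N f i).
Proof.
move=> Hf; have [df Tdf pdf] := is_partial_trigpoly i (trigpoly_moll N Hf).
rewrite (_ : moll_grad N f i = df); first by split=> //; exact: cperiodic_trigpoly Tdf.
exact: is_partial_val pdf.
Qed.

Lemma is_partial_moll_grad N f i : cperiodic f ->
  is_partial i (moll N f) (moll_grad N f i).
Proof. by move=> /(moll_gradP N i)[]. Qed.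

Lemma cperiodic_moll_grad N f i : cperiodic f -> cperiodic (moll_grad N f i).
Proof. by move=> /(moll_gradP N i)[]. Qed.

Definition jackson_grad N (i : 'I_3) : pt -> R := fun x => 'D_(e3 R i) (jackson N) x.

Lemma is_partial_jackson N i :
  is_partial i (jackson N) (jackson_grad N i) /\ cperiodic (jackson_grad N i).
Proof.
have [df Tdf pdf] := is_partial_trigpoly i (trigpoly_jackson R N).
rewrite /jackson_grad (is_partial_val pdf); split=> //; exact: cperiodic_trigpoly Tdf.
Qed.

Lemma continuous_jackson_grad N i : continuous (jackson_grad N i).
Proof. by have [_ []] := is_partial_jackson N i. Qed.

Lemma moll_gradE N f i x : cperiodic f ->
  moll_grad N f i x = torint (fun y => jackson_grad N i (x - y) * f y).
Proof.
move=> Hf; have [pj [cj _]] := is_partial_jackson N i.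
apply: has_derive_val; exact: (is_partial_conv_kernel (even_kernel_jackson R N) cj Hf pj).
Qed.

Lemma continuous_fun_moll_grad (X : topologicalType) N i (f : X -> pt -> R) (h : X -> pt) :
  continuous (fun z : X * pt => f z.1 z.2) -> (forall z, periodic3 (f z)) -> continuous h ->
  continuous (fun z => moll_grad N (f z) i (h z)).
Proof.
move=> cf pf ch; have cj := @continuous_jackson_grad N i.
rewrite (_ : (fun z => _) = (fun z => torint (fun y => jackson_grad N i (h z - y) * f z y))).
  by continuity.
apply: funext => z; rewrite moll_gradE //; split=> //; exact: continuous_slice cf.
Qed.

Lemma moll_grad_val N f df i : is_partial i (moll N f) df -> moll_grad N f i = df.
Proof. exact: is_partial_val. Qed.

Lemma moll_gradB N f g i x : cperiodic f -> cperiodic g ->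
  moll_grad N (fun x => f x - g x) i x = moll_grad N f i x - moll_grad N g i x.
Proof.
move=> Hf Hg; have pB := is_partialB (is_partial_moll_grad N i Hf) (is_partial_moll_grad N i Hg).
apply: has_derive_val; apply: (is_partial_ext _ pB) => y.
by rewrite mollB //; [exact: Hf.1|exact: Hg.1].
Qed.

Lemma lattice_sqdist_eq0 y : cube y -> lattice_sqdist y = 0 ->
  forall f x, periodic3 f -> f (x + y) = f x.
Proof.
move=> cy y0 f x pf.
have y_int i : exists z : int, y 0 i = z%:~R.
  have sin0 : sin (pi * y 0 i) == 0.
    rewrite -sqrf_eq0; move: y0 => /eqP; rewrite psumr_eq0; last by move=> j _; exact: sqr_ge0.
    by move=> /allP/(_ i); rewrite mem_index_enum /= => /(_ isT).
  have /andP[yi0 yi1] := cy i.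
  have [->|yn0] := eqVneq (y 0 i) 0; first by exists 0.
  have [->|yn1] := eqVneq (y 0 i) 1; first by exists 1.
  have p0 := @pi_gt0 R; suff : 0 < sin (pi * y 0 i) by rewrite (eqP sin0) ltxx.
  have y0' : 0 < y 0 i by rewrite lt_neqAle eq_sym yn0.
  have y1' : y 0 i < 1 by rewrite lt_neqAle yn1.
  by apply: sin_gt0_pi; apply/andP; split; nra.
apply: (periodic3_int_vec (z := fun i => projT1 (cid (y_int i))) pf) => i.
by rewrite mxE -(projT2 (cid (y_int i))).
Qed.

Lemma moll_sub_le N u (e C : R) x : (0 < N)%N -> cperiodic u ->
  (forall y, cube y -> `|u (x + y) - u x| <= e + C * lattice_sqdist y) -> 0 <= C ->
  `|moll N u x - u x| <= e + C * (9 / 2 / N%:R ^+ 2).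
Proof.
move=> N0 Hu uC C0; rewrite moll_sub //; last exact: Hu.1.
apply: le_trans (torint_jackson_norm_le N _ _ uC) _; [continuity..|].
under [X in torint X]eq_fun do rewrite mulrDr (mulrC _ e) (mulrCA _ C).
rewrite torintD; [|continuity..]; rewrite !torintZl; [|continuity..].
by rewrite torint_jackson // mulr1 lerD2l ler_wpM2l // torint_jackson_sqdist.
Qed.

Lemma moll_cvg_uniform (T : R) (f : pt -> R -> R) (e : R) : cperiodic_flow f -> 0 < e ->
  \forall N \near \oo, forall s x, 0 <= s <= T -> `|moll N (f^~ s) x - f x s| <= e.
Proof.
move=> Hf e0; have e2 : 0 < e / 2 by rewrite divr_gt0.
pose g (z : pt * pt * R) := `|f (z.1.1 + z.1.2) z.2 - f z.1.1 z.2|.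
pose d (z : pt * pt * R) := lattice_sqdist z.1.2.
have cK : compact ((@cube R `*` @cube R) `*` timeI 0 T).
  by apply: compact_setX; [apply: compact_setX; exact: cube_compact|exact: compact_timeI].
have [||||C C0 gC] := @compact_le_epsilon_add _ _ _ g d _ cK _ _ _ _ e2.
- by rewrite /g; continuity.
- by rewrite /d; continuity.
- by move=> z; exact: lattice_sqdist_ge0.
- move=> [[x y] s] /= [[cx cy] _]; rewrite /d /g /= => dz.
  by rewrite (lattice_sqdist_eq0 cy dz x (Hf.2 s)) subrr normr0.
exists (Num.truncn (9 * C / e)).+1 => // N /= NC s x sT.
have N0 : (0 < N)%N by exact: leq_trans NC.
have Hfs := cperiodic_at s Hf; have [x' cx' xE] := cube_representative x.
rewrite (xE _ Hfs.2) (xE _ (cperiodic_moll N Hfs).2).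
apply: le_trans (moll_sub_le (C := C) (e := e / 2) N0 Hfs _ C0) _.
  by move=> y cy; exact: (gC ((x', y), s)).
have n1 : 1 <= N%:R :> R by rewrite ler1n.
have Ce : 9 * C < N%:R * e.
  by rewrite -ltr_pdivrMr // (lt_le_trans (truncnS_gt _)) // ler_nat.
rewrite [leRHS]splitr lerD2l !mulrA ler_pdivrMr ?exprn_gt0 ?(lt_le_trans ltr01) //.
by nra.
Qed.

Lemma near_expn2 (P : nat -> Prop) :
  (\forall N \near \oo, P N) -> \forall k \near \oo, P (2 ^ k)%N.
Proof.
move=> [N0 _ HP]; exists N0 => // k /= N0k; apply: HP => /=.
by apply: leq_trans N0k (ltnW (ltn_expl k _)).
Qed.

Lemma moll_cvg u (e : R) : cperiodic u -> 0 < e ->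
  \forall N \near \oo, forall x, `|moll N u x - u x| <= e.
Proof.
move=> /cperiodic_flow_cst Hu e0; have := moll_cvg_uniform 0 Hu e0.
by apply: filterS => N uN x; apply: (uN 0); rewrite lexx.
Qed.

Lemma moll_inj f g : cperiodic f -> cperiodic g ->
  (forall N x, moll N f x = moll N g x) -> forall x, f x = g x.
Proof.
move=> Hf Hg fg x; apply/eqP; rewrite -subr_eq0 -normr_le0.
apply/ler_addgt0Pr => e e0; rewrite add0r.
have /filter_ex[N /(_ x)] := moll_cvg (cperiodicB Hf Hg) e0.
by rewrite mollB; [rewrite fg subrr sub0r normrN|exact: Hf.1|exact: Hg.1].
Qed.

Lemma torint_eq0 f : cperiodic f -> (forall x, 0 <= f x) -> torint f = 0 -> forall x, f x = 0.
Proof.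
move=> Hf f0 f_eq0 x; rewrite (moll_inj Hf (cperiodic_cst 0)) // => N y.
rewrite (@conv0 _ _ (fun _ => 0)) //; apply/eqP; rewrite eq_le; apply/andP; split; last first.
  by apply: torint_ge0 => [|z]; [continuity|rewrite mulr_ge0 ?jackson_ge0].
have [M jM] := cperiodic_bounded (even_kernel_jackson R N).1.
apply: (@le_trans _ _ (torint (fun z => M * f (y + z)))).
  apply: le_torint; [continuity..|move=> z _]; apply: ler_wpM2r => //.
  exact: le_trans (ler_norm _) (jM z).
rewrite torintZl; last by continuity.
by under [X in torint X]eq_fun do rewrite addrC; rewrite torint_shift // f_eq0 mulr0.
Qed.

End Mollification.

(** * Littlewood-Paley blocks *)

Definition LPdeg (n : nat) : nat := (3 * 2 ^ n.+1)%N.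

Definition LPindex (n : nat) : finType :=
  ('I_(2 * LPdeg n).+1 * 'I_(2 * LPdeg n).+1 * 'I_(2 * LPdeg n).+1)%type.

Section LPkernel.
Variable R : realType.
Local Notation pt := 'rV[R]_3.
Variables chi vphi : pt -> R.
Local Notation mult := (LPmult chi vphi).
Local Notation block := (LPblock chi vphi).
Implicit Types (u : pt -> R) (k : pt) (n : nat).

Definition LPfreq n (t : LPindex n) : pt :=
  vec3 (t.1.1%:R - (LPdeg n)%:R) (t.1.2%:R - (LPdeg n)%:R) (t.2%:R - (LPdeg n)%:R).

Definition LPkernel n (y : pt) : R := \sum_t mult n (LPfreq t) * mode (@LPfreq n t) 0 y.

Lemma freq_box_LPfreq n t : freq_box (fun _ => (LPdeg n)%:R) (@LPfreq n t).
Proof.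
have centered (a : 'I_(2 * LPdeg n).+1) : `|a%:R - (LPdeg n)%:R| <= (LPdeg n)%:R :> R.
  have : (a%:R <= (2 * LPdeg n)%:R :> R) by rewrite ler_nat -ltnS ltn_ord.
  by rewrite natrM ler_norml; have := ler0n R a; lra.
by split; elim/ord3P; rewrite !mxE //= rpredB ?natr_int.
Qed.

Lemma LPfreq_inj n : injective (@LPfreq n).
Proof.
move=> [[a b] c] [[a' b'] c'] /rowP abc; have coordE i := abc i.
have := coordE ord0; have := coordE (lift ord0 ord0); have := coordE ord_max.
rewrite !mxE /= => /addIr/eqP cc /addIr/eqP bb /addIr/eqP aa.
by move: aa bb cc; rewrite !eqr_nat => /eqP/val_inj -> /eqP/val_inj -> /eqP/val_inj ->.
Qed.

Lemma LPfreq_onto n k : freq_box (fun _ => (LPdeg n)%:R) k -> exists t, @LPfreq n t = k.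
Proof.
move=> [ik bk].
have index_of i : exists a : 'I_(2 * LPdeg n).+1, a%:R - (LPdeg n)%:R = k 0 i.
  have /intrP[z kz] := ik i; have := bk i; rewrite kz ler_norml => /andP[zl zu].
  have z_ge0 : 0 <= (LPdeg n)%:Z + z.
    by rewrite -(ler0z R) intrD -[_%:Z%:~R]/((LPdeg n)%:R : R); lra.
  have absE : (absz ((LPdeg n)%:Z + z))%:R = (LPdeg n)%:R + z%:~R :> R.
    by rewrite natr_absz ger0_norm // intrD.
  have lt_index : (absz ((LPdeg n)%:Z + z)%R < (2 * LPdeg n).+1)%N.
    by rewrite ltnS -(ler_nat R) absE natrM; lra.
  by exists (Ordinal lt_index); rewrite /= absE addrAC subrr add0r.
have [a ak] := index_of ord0; have [b bk'] := index_of (lift ord0 ord0).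
have [c ck] := index_of ord_max.
by exists (a, b, c); rewrite [RHS]vec3_coord /LPfreq ak bk' ck.
Qed.

Lemma even_kernel_LPkernel n : even_kernel (LPkernel n).
Proof.
have modeK (t : LPindex n) : even_kernel (mode (LPfreq t) 0).
  by apply: even_kernel_mode; have [] := freq_box_LPfreq t.
split; last by move=> y; apply: eq_bigr => t _; rewrite (modeK t).2.
by apply: cperiodic_sum => t; apply: cperiodicM; [exact: cperiodic_cst|exact: (modeK t).1].
Qed.

Lemma continuous_LPkernel n : continuous (LPkernel n).
Proof. exact: (even_kernel_LPkernel n).1.1. Qed.

Lemma trigpoly_LPkernel n : trigpoly (fun _ => (LPdeg n)%:R) (LPkernel n).
Proof.
by apply: trigpoly_sum => t; apply: trigpolyZ; apply: trigpoly_mode; exact: freq_box_LPfreq.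
Qed.

Lemma LPblockE n u : cperiodic u -> block n u = conv (LPkernel n) u.
Proof.
move=> Hu; apply: funext => x; rewrite conv_kernel_sum; [|by move=> t; continuity|by continuity].
rewrite /LPblock !pair_big; apply: eq_bigr => t _; congr (_ * _).
rewrite convE //; last by apply: even_kernel_mode; have [] := freq_box_LPfreq t.
rewrite torintE; congr intT3; apply: funext => y; rewrite mulrC /mode addr0.
by congr (cos (_ * _) * _); apply: eq_bigr => i _; rewrite !mxE.
Qed.

Lemma cperiodic_LPblock n u : cperiodic u -> cperiodic (block n u).
Proof.
by move=> Hu; rewrite LPblockE //; apply: cperiodic_conv => //; exact: continuous_LPkernel.
Qed.

Lemma trigpoly_LPblock n u : cperiodic u -> trigpoly (fun _ => (LPdeg n)%:R) (block n u).
Proof.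
move=> Hu; rewrite LPblockE //.
by apply: trigpoly_conv => //; [exact: trigpoly_LPkernel|exact: (even_kernel_LPkernel n).2].
Qed.

Lemma continuous_LPblock_flow n (f : pt -> R -> R) : cperiodic_flow f ->
  continuous (fun z : R * pt => block n (f^~ z.1) z.2).
Proof.
move=> Hf; have cK := @continuous_LPkernel n.
have -> : (fun z : R * pt => block n (f^~ z.1) z.2) =
    (fun z => conv (LPkernel n) (f^~ z.1) z.2).
  by apply: funext => z; rewrite LPblockE //; exact: cperiodic_at.
by continuity.
Qed.

Lemma LPblock_moll n N u : cperiodic u -> block n (moll N u) = moll N (block n u).
Proof.
move=> Hu; rewrite !LPblockE //; last exact: cperiodic_moll.
have cK := @continuous_LPkernel n; apply: funext => x.
by apply: conv_comm; continuity.
Qed.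

End LPkernel.

Section LittlewoodPaleySum.
Variable R : realType.
Local Notation pt := 'rV[R]_3.
Variables chi vphi : pt -> R.
Hypothesis LP : LP_pair chi vphi.
Local Notation mult := (LPmult chi vphi).
Local Notation block := (LPblock chi vphi).
Implicit Types (f u : pt -> R) (k x : pt) (n N : nat).

Lemma coord_le_eucl k i : `|k 0 i| <= eucl k.
Proof.
rewrite -sqrtr_sqr ler_sqrt; last by apply: sumr_ge0 => j _; exact: sqr_ge0.
by rewrite (bigD1 i) //= lerDl sumr_ge0 // => j _; exact: sqr_ge0.
Qed.

Lemma euclZ (c : R) k : 0 <= c -> eucl (c *: k) = c * eucl k.
Proof.
move=> c0; rewrite /eucl; under eq_bigr do rewrite mxE exprMn.
by rewrite -mulr_sumr sqrtrM ?sqr_ge0 // sqrtr_sqr ger0_norm.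
Qed.

Lemma euclN k : eucl (- k) = eucl k.
Proof. by rewrite /eucl; congr Num.sqrt; apply: eq_bigr => i _; rewrite mxE sqrrN. Qed.

Lemma LPmultN n k : mult n (- k) = mult n k.
Proof.
have [_ [_ [radial _]]] := LP; case: n => [|n] /=; first exact: (radial _ _ (euclN k)).1.
by apply: (radial _ _ _).2; rewrite scalerN; exact: euclN.
Qed.

Lemma vphi_scaled_support j k : vphi (2 ^- j *: k) != 0 ->
  2 ^+ j * (3 / 4) <= eucl k <= 2 ^+ j * (8 / 3).
Proof.
have [_ [_ [_ [_ [_ [_ [supp _]]]]]]] := LP => /supp.
have p2 : 0 < 2 ^+ j :> R by rewrite exprn_gt0.
by rewrite euclZ ?invr_ge0 ?exprn_ge0 // ler_pdivlMl // ler_pdivrMl.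
Qed.

Lemma LPmult_support n k : mult n k != 0 -> eucl k <= (LPdeg n)%:R.
Proof.
have [_ [_ [_ [_ [chi_supp _]]]]] := LP; rewrite /LPdeg natrM natrX.
case: n => [|n] /=; first by move=> /chi_supp; lra.
move=> /vphi_scaled_support /andP[_]; have : 0 < 2 ^+ n :> R by rewrite exprn_gt0.
by rewrite !exprS; lra.
Qed.

Lemma sum_LPmult_freq n k : int_vec k ->
  \sum_(t : LPindex n) mult n (LPfreq R t) * (LPfreq R t == k)%:R = mult n k.
Proof.
move=> ik; have [mk0|/LPmult_support kdeg] := eqVneq (mult n k) 0.
  by rewrite mk0 big1 // => t _; case: eqP => [->|_]; rewrite ?mk0 ?mul0r ?mulr0.
have [|t0 t0k] := @LPfreq_onto R n k.
  by split=> // i; exact: le_trans (coord_le_eucl k i) kdeg.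
rewrite (bigD1 t0) //= t0k eqxx mulr1 big1 ?addr0 // => t t_neq.
by rewrite -t0k (inj_eq (@LPfreq_inj R n)) (negbTE t_neq) mulr0.
Qed.

Lemma LPblock_mode n k p : int_vec k -> block n (mode k p) = (fun x => mult n k * mode k p x).
Proof.
move=> ik; apply: funext => x; rewrite LPblockE; last exact: cperiodic_mode.
rewrite conv_kernel_sum; [|by move=> t; continuity|by continuity].
transitivity (\sum_(t : LPindex n) (
    1 / 2 * mode k p x * (mult n (LPfreq R t) * (LPfreq R t == k)%:R) +
    1 / 2 * mode k p x * (mult n (LPfreq R t) * (LPfreq R t == - k)%:R))).
  by apply: eq_bigr => t _; rewrite conv_mode //; [ring|exact: (freq_box_LPfreq R t).1].
rewrite big_split /= -!mulr_sumr !sum_LPmult_freq ?LPmultN //; last exact: int_vecN.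
by field.
Qed.

Lemma sum_LPmult k : \forall N \near \oo, \sum_(n < N) mult n k = 1.
Proof.
have [_ [_ [_ [_ [_ [_ [_ partition]]]]]]] := LP.
pose S N := chi k + \sum_(j < N) vphi (2 ^- j *: k).
pose j0 := (Num.truncn (2 * eucl k)).+1.
have vphi0 j : (j0 <= j)%N -> vphi (2 ^- j *: k) = 0.
  move=> j0j; apply/eqP; apply: contraTT isT => /vphi_scaled_support /andP[+ _].
  have : 2 * eucl k < j0%:R by exact: truncnS_gt.
  have : j0%:R <= 2 ^+ j :> R.
    by rewrite -natrX ler_nat (leq_trans j0j) // ltnW // ltn_expl.
  by have := ler0n R j0; lra.
have S_stationary N : (j0 <= N)%N -> S N = S j0.
  move=> j0N; rewrite -(subnKC j0N) /S; elim: (N - j0)%N => [|d IH]; first by rewrite addn0.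
  by rewrite addnS big_ord_recr /= addrA IH vphi0 ?addr0 // leq_addr.
have S1 : S j0 = 1.
  apply: (@cvg_unique _ (@norm_hausdorff R R) (S @ \oo)); last exact: partition.
  by apply: cvg_near_cst; exists j0 => // N /= j0N; exact: S_stationary.
exists j0.+1 => // -[//|N] /= j0N.
by rewrite big_ord_recl /= -[RHS]S1 -(S_stationary N).
Qed.

Lemma sum_LPblock_trigpoly b f : trigpoly b f ->
  \forall N \near \oo, forall x, \sum_(n < N) block n f x = f x.
Proof.
elim=> [|h c k p Th IH [ik _]].
  apply: nearW => N x; rewrite big1 // => n _.
  by rewrite LPblockE ?conv0 //; exact: cperiodic_cst.
have Hh := cperiodic_trigpoly Th.
apply: filterS2 IH (sum_LPmult k) => N sum_h sum_mult x.
transitivity (\sum_(n < N) (block n h x + c * mode k p x * mult n k)).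
  apply: eq_bigr => n _; have cK := @continuous_LPkernel R chi vphi n.
  have Hm : cperiodic (mode k p) by exact: cperiodic_mode.
  rewrite !LPblockE //; last first.
    by apply: cperiodicD => //; apply: cperiodicM => //; exact: cperiodic_cst.
  rewrite convD; [|continuity..]; rewrite convZ; [|continuity..].
  by rewrite -(LPblockE _ _ _ Hm) LPblock_mode //; ring.
by rewrite big_split /= sum_h -mulr_sumr sum_mult mulr1.
Qed.

Lemma sum_moll_LPblock N u : cperiodic u ->
  \forall m \near \oo, forall x, \sum_(n < m) moll N (block n u) x = moll N u x.
Proof.
move=> Hu; apply: filterS (sum_LPblock_trigpoly (trigpoly_moll N Hu)) => m sum_blocks x.
by rewrite -sum_blocks; apply: eq_bigr => n _; rewrite LPblock_moll.
Qed.

End LittlewoodPaleySum.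

(** * Besov regularity: increments and gradients *)

Section Decay.
Variable R : realType.
Implicit Types (n J N : nat).

Definition cbrt2 : R := 2 `^ (1 / 3).

(* The frequency [2 ^ n] interacts with the scale [2 ^ - J] up to this factor. *)
Definition decay n J : R := cbrt2^-1 ^+ `|n - J|.

Definition decay_sum : R := 2 / (1 - cbrt2^-1).

Lemma cbrt2_gt0 : 0 < cbrt2. Proof. exact: powR_gt0. Qed.

Lemma cbrt2_cubed : cbrt2 ^+ 3 = 2.
Proof. by rewrite -powR_mulrn ?powR_ge0 // -powRrM (_ : 1 / 3 * 3 = 1) ?powRr1 //; field. Qed.

Lemma cbrt2_gt1 : 1 < cbrt2.
Proof.
rewrite ltNge; apply/negP => /(exprn_ile1 3 (ltW cbrt2_gt0)).
by rewrite cbrt2_cubed; lra.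
Qed.

Lemma cbrt2V_lt1 : cbrt2^-1 < 1.
Proof. by rewrite invf_lt1 ?cbrt2_gt0 ?cbrt2_gt1. Qed.

Lemma expn2_cbrt2 n : 2 ^+ n = cbrt2 ^+ (2 * n) * cbrt2 ^+ n.
Proof. by rewrite -exprD -mulSnr exprM cbrt2_cubed. Qed.

Lemma wgtE n : wgt R n = cbrt2 ^+ n / cbrt2.
Proof.
rewrite -powR_mulrn ?(ltW cbrt2_gt0) // -powRrM /wgt /cbrt2 -powRN -powRD; last by apply/implyP.
by congr powR; field.
Qed.

Lemma wgt_gt0 n : 0 < wgt R n. Proof. by rewrite wgtE divr_gt0 ?exprn_gt0 ?cbrt2_gt0. Qed.

Lemma decay_ge0 n J : 0 <= decay n J.
Proof. by rewrite exprn_ge0 // invr_ge0 ltW ?cbrt2_gt0. Qed.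

Lemma decay_sum_gt0 : 0 < decay_sum.
Proof. by rewrite divr_gt0 // subr_gt0 cbrt2V_lt1. Qed.

Lemma sum_geometric_dist (q : R) N J : 0 <= q < 1 ->
  \sum_(n < N) q ^+ `|n - J| <= 2 / (1 - q).
Proof.
move=> /andP[q0 q1]; have q1' : 0 < 1 - q by rewrite subr_gt0.
pose S N : R := \sum_(n < N) q ^+ `|n - J|.
have S_rec m : S m.+1 = S m + q ^+ `|m - J| by rewrite /S big_ord_recr.
have below m : (m <= J.+1)%N -> (1 - q) * S m <= q ^+ (J.+1 - m).
  elim: m => [|m IH] mJ; first by rewrite /S big_ord0 mulr0 exprn_ge0.
  rewrite S_rec subSS distnEr // mulrDr; have := IH (ltnW mJ); rewrite subSn // exprS.
  by lra.
have above d : (1 - q) * S (J.+1 + d)%N <= 2 - q ^+ d.+1.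
  elim: d => [|d IH].
    by have := below J.+1 (leqnn _); rewrite addn0 subnn expr0 expr1; lra.
  rewrite addnS S_rec mulrDr; move: IH; rewrite addSnnS distnEl ?leq_addr // addKn.
  by rewrite !(exprS _ d.+1); lra.
rewrite ler_pdivlMr // mulrC -/(S N); have [NJ|JN] := leqP N J.+1.
  apply: le_trans (below _ NJ) _; apply: le_trans (exprn_ile1 _ q0 (ltW q1)) _.
  by rewrite ler1n.
rewrite -(subnKC (ltnW JN)); apply: le_trans (above _) _.
by rewrite gerBl exprn_ge0.
Qed.

Lemma sum_decay_le N J : \sum_(n < N) decay n J <= decay_sum.
Proof. by apply: sum_geometric_dist; rewrite invr_ge0 (ltW cbrt2_gt0) cbrt2V_lt1. Qed.

Lemma min_expn2_decay n J :
  Num.min (2 ^+ n) (2 ^+ J) / cbrt2 ^+ n <= cbrt2 ^+ (2 * J) * decay n J.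
Proof.
have e0 := cbrt2_gt0; have en m : cbrt2 ^+ m != 0 by rewrite gt_eqF ?exprn_gt0.
rewrite /decay exprVn; have [nJ|/ltnW Jn] := leqP n J.
  rewrite min_l ?ler_eXn2l ?ltr1n // distnEr // expn2_cbrt2 mulfK //.
  rewrite ler_pdivlMr ?exprn_gt0 // -exprD ler_weXn2l ?(ltW cbrt2_gt1) //.
  by lia.
rewrite min_r ?ler_eXn2l ?ltr1n // distnEl // expn2_cbrt2.
by rewrite -[in X in _ / X <= _](subnKC Jn) exprD invfM mulrA mulfK.
Qed.

Lemma sum_decay_cvg0 (a : nat -> R) (A e : R) : (forall n, 0 <= a n <= A) ->
  a @ \oo --> (0 : R) -> 0 < e ->
  \forall J \near \oo, forall N, \sum_(n < N) decay n J * a n <= e.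
Proof.
move=> aA /cvgrPdist_le a_cvg0 e0; have s0 := decay_sum_gt0.
have q0 : 0 <= cbrt2^-1 by rewrite invr_ge0 ltW ?cbrt2_gt0.
have A0 : 0 <= A by have /andP[] := aA 0%N; exact: le_trans.
pose d := e / 2 / decay_sum; have d0 : 0 < d by rewrite divr_gt0 // divr_gt0.
have [n0 _ tail_le] := a_cvg0 _ d0.
have : (fun k : nat => A * cbrt2^-1 ^+ k) @ \oo --> (0 : R).
  rewrite -(mulr0 A); apply: cvgM; first exact: cvg_cst.
  by apply: cvg_expr; rewrite ger0_norm // cbrt2V_lt1.
move=> /cvgrPdist_le/(_ _ d0) [k0 _ /(_ k0 (leqnn k0)) head_le].
exists (n0 + k0)%N => // J /= J_ge N.
have n0J : (n0 <= J)%N by exact: leq_trans (leq_addr _ _) J_ge.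
have {}head_le : A * cbrt2^-1 ^+ (J - n0) <= d.
  move: head_le; rewrite sub0r normrN ger0_norm ?mulr_ge0 ?exprn_ge0 //; apply: le_trans.
  by apply: ler_wpM2l => //; apply: ler_wiXn2l; rewrite ?(ltW cbrt2V_lt1) // leq_subRL.
(* frequencies below [n0] see the scale [J] through [n0] *)
apply: (@le_trans _ _ (\sum_(n < N) (d * decay n n0 + d * decay n J))).
  apply: ler_sum => n _; have /andP[an0 anA] := aA n; have [n_lt|n_ge] := ltnP n n0.
    apply: ler_wpDr; first by rewrite mulr_ge0 ?decay_ge0 ?ltW.
    have -> : decay n J = cbrt2^-1 ^+ (J - n0) * decay n n0.
      rewrite /decay !distnEr ?(ltnW n_lt) ?(leq_trans (ltnW n_lt)) // -exprD; congr (_ ^+ _).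
      by lia.
    rewrite mulrAC ler_wpM2r ?decay_ge0 // mulrC; apply: le_trans head_le.
    by rewrite ler_wpM2r ?exprn_ge0.
  apply: ler_wpDl; first by rewrite mulr_ge0 ?decay_ge0 ?ltW.
  rewrite mulrC ler_wpM2r ?decay_ge0 //.
  by have := tail_le n n_ge; rewrite sub0r normrN ger0_norm.
have d_sum j : d * \sum_(n < N) decay n j <= e / 2.
  by apply: le_trans (ler_wpM2l (ltW d0) (sum_decay_le N j)) _; rewrite divfK // gt_eqF.
by rewrite big_split -!mulr_sumr [leRHS]splitr lerD.
Qed.

End Decay.

Definition besov_coef (R : realType) (chi vphi : 'rV[R]_3 -> R) (nrm : ('rV[R]_3 -> R) -> R)
  (u : 'rV[R]_3 -> R) (n : nat) : R := wgt R n * nrm (LPblock chi vphi n u).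

Section BesovEstimates.
Variable R : realType.
Local Notation pt := 'rV[R]_3.
Variables chi vphi : pt -> R.
Hypothesis LP : LP_pair chi vphi.
Variable nrm : (pt -> R) -> R.
Hypothesis tnorm : transl_norm nrm.
Local Notation block := (LPblock chi vphi).
Local Notation coef := (besov_coef chi vphi nrm).
Implicit Types (f u : pt -> R) (x y : pt) (n J N : nat).

Definition bernstein_const : R := 24 * pi * cbrt2 R.

Lemma bernstein_const_gt0 : 0 < bernstein_const.
Proof. by rewrite !mulr_gt0 ?pi_gt0 ?cbrt2_gt0. Qed.

Lemma besov_coef_ge0 u n : 0 <= coef u n.
Proof. by rewrite mulr_ge0 ?(tnorm_ge0 tnorm) // ltW ?wgt_gt0. Qed.

Lemma LPdegE n : (LPdeg n)%:R = 6 * 2 ^+ n :> R.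
Proof. by rewrite /LPdeg natrM natrX exprS; ring. Qed.

Lemma tnorm_LPblock_incr n J u y : cperiodic u -> cube y ->
  nrm (fun x => block n u (x + y) - block n u x) <=
  24 * pi * (2 ^- J + lattice_dist y) * (Num.min (2 ^+ n) (2 ^+ J) * nrm (block n u)).
Proof.
move=> Hu cy; have d0 := lattice_dist_ge0 y; have p2 := @pi_ge2 R.
have J0 : 0 < 2 ^+ J :> R by rewrite exprn_gt0.
have JV0 : 0 <= 2 ^- J :> R by rewrite invr_ge0 ltW.
have nb := tnorm_ge0 tnorm (block n u).
rewrite mulrA; have [nJ|/ltnW Jn] := leqP n J.
  have := tnorm_incr_trigpoly tnorm (trigpoly_LPblock chi vphi n Hu) (fun _ => lexx _) cy.
  move=> /le_trans -> //; rewrite LPdegE min_l ?ler_eXn2l ?ltr1n //; apply: ler_wpM2r => //.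
  rewrite (_ : _ * lattice_dist y = 24 * pi * lattice_dist y * 2 ^+ n); last by ring.
  by rewrite ler_wpM2r ?exprn_ge0 // ler_wpM2l ?lerDr // mulr_ge0 // pi_ge0.
apply: le_trans (tnorm_incr tnorm y (cperiodic_LPblock chi vphi n Hu)) _.
rewrite min_r ?ler_eXn2l ?ltr1n //; apply: ler_wpM2r => //.
rewrite (_ : _ * 2 ^+ J = 24 * pi + 24 * pi * lattice_dist y * 2 ^+ J); last first.
  by field; rewrite gt_eqF.
apply: (@le_trans _ _ (24 * pi)); first by lra.
by rewrite lerDl !mulr_ge0 ?pi_ge0 // ltW.
Qed.

Lemma tnorm_moll_grad_LPblock n J u i : cperiodic u ->
  nrm (moll_grad (2 ^ J) (block n u) i) <=
  24 * pi * (Num.min (2 ^+ n) (2 ^+ J) * nrm (block n u)).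
Proof.
move=> Hu; have Hb := cperiodic_LPblock chi vphi n Hu; have N0 : (0 < 2 ^ J)%N by rewrite expn_gt0.
have p0 := @pi_ge0 R; have nb := tnorm_ge0 tnorm (block n u).
rewrite mulrA; have [nJ|/ltnW Jn] := leqP n J.
  have [db [Hdb pdb ndb]] :=
    tnorm_bernstein tnorm (i := i) (trigpoly_LPblock chi vphi n Hu) (lexx _).
  rewrite (_ : moll_grad _ _ _ = moll (2 ^ J) db); last first.
    apply: moll_grad_val; apply: is_partial_conv pdb; [|exact: Hb.1|exact: Hdb.1].
    exact: continuous_jackson.
  apply: le_trans (tnorm_moll tnorm N0 Hdb) _; apply: le_trans ndb _.
  by rewrite LPdegE min_l ?ler_eXn2l ?ltr1n // ler_wpM2r //; lra.
have deg : 2 * (2 ^ J)%:R <= (2 * 2 ^ J)%:R :> R by rewrite natrM.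
have [db [Hdb pdb ndb]] := tnorm_bernstein tnorm (i := i) (trigpoly_moll (2 ^ J) Hb) deg.
rewrite (moll_grad_val pdb) min_r ?ler_eXn2l ?ltr1n //; apply: le_trans ndb _.
have J0 : 0 <= 2 ^+ J :> R by rewrite exprn_ge0.
apply: ler_pM (tnorm_moll tnorm N0 Hb); rewrite ?mulr_ge0 ?(tnorm_ge0 tnorm) //.
by rewrite natrM natrX; have := mulr_ge0 p0 J0; lra.
Qed.

Lemma sum_min_LPblock J N u :
  \sum_(n < N) Num.min (2 ^+ n) (2 ^+ J) * nrm (block n u) <=
  cbrt2 R * cbrt2 R ^+ (2 * J) * \sum_(n < N) decay R n J * coef u n.
Proof.
rewrite mulr_sumr; apply: ler_sum => n _; have e0 := cbrt2_gt0 R.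
have -> : nrm (block n u) = cbrt2 R / cbrt2 R ^+ n * coef u n.
  rewrite /besov_coef wgtE mulrA (_ : _ / _ * _ = 1) ?mul1r //.
  by field; rewrite !gt_eqF ?exprn_gt0.
move: (coef u n) (besov_coef_ge0 u n) => a a0.
rewrite [leLHS]mulrA [leRHS]mulrA ler_wpM2r // mulrCA -[leRHS]mulrA ler_pM2l //.
exact: min_expn2_decay.
Qed.

Lemma besov_moll_incr u A J y N : (0 < N)%N -> cperiodic u ->
  (forall n, coef u n <= A) -> cube y ->
  nrm (fun x => moll N u (x + y) - moll N u x) <=
  bernstein_const * decay_sum R * A / cbrt2 R ^+ J * scaled_dist (2 ^ J) y.
Proof.
move=> N0 Hu uA cy; have e0 := cbrt2_gt0 R; have d0 := lattice_dist_ge0 y.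
have A0 : 0 <= A by exact: le_trans (besov_coef_ge0 u 0) (uA 0%N).
have Hb n := cperiodic_LPblock chi vphi n Hu.
pose incr n x := block n u (x + y) - block n u x.
have Hincr n : cperiodic (incr n) by exact: cperiodic_incr.
have [m] := filter_ex (sum_moll_LPblock LP N Hu) => moll_sum.
rewrite (_ : (fun x => _) = (fun x => \sum_(n < m) moll N (incr n) x)); last first.
  apply: funext => x; rewrite -!moll_sum -sumrB; apply: eq_bigr => n _.
  by rewrite conv_incr //; [exact: continuous_jackson|exact: (Hb n).1].
apply: le_trans (tnorm_sum tnorm (fun n : 'I_m => cperiodic_moll N (Hincr n))) _.
pose c : R := 24 * pi * (2 ^- J + lattice_dist y).
have c0 : 0 <= c by rewrite !mulr_ge0 ?pi_ge0 // addr_ge0 // invr_ge0 exprn_ge0.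
apply: (@le_trans _ _ (c * \sum_(n < m) Num.min (2 ^+ n) (2 ^+ J) * nrm (block n u))).
  rewrite mulr_sumr; apply: ler_sum => n _.
  by apply: le_trans (tnorm_moll tnorm N0 (Hincr n)) _; exact: tnorm_LPblock_incr.
apply: le_trans (ler_wpM2l c0 (sum_min_LPblock J m u)) _.
have decay_coef : \sum_(n < m) decay R n J * coef u n <= decay_sum R * A.
  apply: (@le_trans _ _ ((\sum_(n < m) decay R n J) * A)); last first.
    by rewrite ler_wpM2r // sum_decay_le.
  by rewrite mulr_suml; apply: ler_sum => n _; rewrite ler_wpM2l ?decay_ge0.
apply: le_trans (ler_wpM2l c0 (ler_wpM2l _ decay_coef)) _.
  by rewrite mulr_ge0 ?exprn_ge0 // ltW.
rewrite le_eqVlt; apply/orP; left; apply/eqP.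
rewrite /c /bernstein_const /scaled_dist natrX expn2_cbrt2.
by field; rewrite !gt_eqF ?exprn_gt0.
Qed.

Lemma besov_incr u A J y : cperiodic u -> (forall n, coef u n <= A) -> cube y ->
  nrm (fun x => u (x + y) - u x) <=
  bernstein_const * decay_sum R * A / cbrt2 R ^+ J * scaled_dist (2 ^ J) y.
Proof.
move=> Hu uA cy; apply/ler_addgt0Pr => e e0.
have e2 : 0 < e / 2 by rewrite divr_gt0.
have [N [N0 close]] := filter_ex (filterI (nbhs_infty_gt 0) (moll_cvg Hu e2)).
have Hm := cperiodic_moll N Hu.
rewrite (_ : (fun x => _) = (fun x => (moll N u (x + y) - moll N u x) +
   ((u (x + y) - moll N u (x + y)) - (u x - moll N u x)))); last first.
  by apply: funext => x; ring.
apply: le_trans (tnormD tnorm (cperiodic_incr _ Hm) _) _.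
  by apply: (cperiodic_incr (f := fun x => u x - moll N u x)); exact: cperiodicB.
apply: lerD; first exact: besov_moll_incr.
apply: (tnorm_le_sup tnorm); first by continuity.
move=> x _; apply: le_trans (ler_normB _ _) _; rewrite [leRHS]splitr.
by apply: lerD; rewrite distrC.
Qed.

Lemma besov_moll_grad u i J : cperiodic u -> exists m,
  nrm (moll_grad (2 ^ J) u i) <=
  bernstein_const * cbrt2 R ^+ (2 * J) * \sum_(n < m) decay R n J * coef u n.
Proof.
move=> Hu; have Hb n := cperiodic_LPblock chi vphi n Hu.
have [m] := filter_ex (sum_moll_LPblock LP (2 ^ J) Hu) => moll_sum; exists m.
rewrite (_ : moll_grad _ _ _ = (fun x => \sum_(n < m) moll_grad (2 ^ J) (block n u) i x)).
  apply: le_trans (tnorm_sum tnorm (fun n : 'I_m => cperiodic_moll_grad (2 ^ J) i (Hb n))) _.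
  apply: (@le_trans _ _ (24 * pi * \sum_(n < m) Num.min (2 ^+ n) (2 ^+ J) * nrm (block n u))).
    rewrite mulr_sumr; apply: ler_sum => n _; exact: tnorm_moll_grad_LPblock.
  have p0 : 0 <= 24 * pi :> R by rewrite mulr_ge0 // pi_ge0.
  by apply: le_trans (ler_wpM2l p0 (sum_min_LPblock J m u)) _; rewrite !mulrA.
apply: moll_grad_val => x; rewrite -(funext moll_sum).
apply: (has_derive_sum (F := fun (n : 'I_m) x => moll (2 ^ J) (block n u) x)
  (dF := fun n : 'I_m => moll_grad (2 ^ J) (block n u) i x)) => n.
exact: is_partial_moll_grad.
Qed.

End BesovEstimates.

(** * The commutator flux *)

Section Commutator.
Variable R : realType.
Local Notation pt := 'rV[R]_3.
Implicit Types (f w : pt -> R) (x y : pt) (N : nat).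

Definition commutator N w f x : R :=
  moll N (fun y => w y * f y) x - moll N w x * moll N f x.

Definition weighted_osc N f x : R :=
  torint (fun y => jackson N y * (scaled_dist N y * `|f (x + y) - f x|)).

Lemma scaled_dist_ge1 N y : 1 <= scaled_dist N y.
Proof. by rewrite lerDl mulr_ge0 ?lattice_dist_ge0. Qed.

Lemma scaled_dist_ge0 N y : 0 <= scaled_dist N y.
Proof. exact: le_trans ler01 (scaled_dist_ge1 N y). Qed.

Lemma scaled_dist_coef_ge0 N y (a B : R) : 0 <= a -> a <= B * scaled_dist N y -> 0 <= B.
Proof.
by move=> a0 /(le_trans a0); rewrite pmulr_lge0 // (lt_le_trans ltr01) ?scaled_dist_ge1.
Qed.

Lemma continuous_weighted_osc N f : continuous f -> continuous (weighted_osc N f).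
Proof. by move=> cf; rewrite /weighted_osc; continuity. Qed.

Lemma weighted_osc_ge0 N f x : continuous f -> 0 <= weighted_osc N f x.
Proof.
move=> cf; apply: torint_ge0 => [|y]; first by continuity.
by rewrite !mulr_ge0 ?jackson_ge0 ?scaled_dist_ge0.
Qed.

Lemma continuous_commutator N w f : continuous w -> continuous f -> continuous (commutator N w f).
Proof. by move=> cw cf; rewrite /commutator; continuity. Qed.

(* The identity of Constantin, E and Titi. *)
Lemma commutatorE N w f x : (0 < N)%N -> continuous w -> continuous f ->
  commutator N w f x =
  torint (fun y => jackson N y * ((w (x + y) - w x) * (f (x + y) - f x))) -
  (moll N w x - w x) * (moll N f x - f x).
Proof.
move=> N0 cw cf.
have -> : torint (fun y => jackson N y * ((w (x + y) - w x) * (f (x + y) - f x))) =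
    moll N (fun y => w y * f y) x - f x * moll N w x - w x * moll N f x + w x * f x.
  rewrite -[w x * f x]mulr1 -(torint_jackson R N0) -!torintZl; [|continuity..].
  rewrite -torintB; [|continuity..]; rewrite -torintB; [|continuity..].
  by rewrite -torintD; [|continuity..]; apply: eq_torint => y _; ring.
by rewrite /commutator; ring.
Qed.

Lemma commutator_norm_le N w f (B : R) x : (0 < N)%N -> continuous w -> continuous f ->
  (forall y, cube y -> `|w (x + y) - w x| <= B * scaled_dist N y) ->
  `|commutator N w f x| <= 30 * B * weighted_osc N f x.
Proof.
move=> N0 cw cf w_incr; have osc0 := weighted_osc_ge0 N x cf.
have B0 : 0 <= B := scaled_dist_coef_ge0 (normr_ge0 _) (w_incr 0 (@cube0 R)).
have product_le : `|torint (fun y => jackson N y * ((w (x + y) - w x) * (f (x + y) - f x)))| <=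
    B * weighted_osc N f x.
  rewrite -torintZl; last by continuity.
  apply: le_trans (@torint_jackson_norm_le _ N _
    (fun y => B * scaled_dist N y * `|f (x + y) - f x|) _ _ _) _; [continuity..| |].
    by move=> y cy; rewrite normrM ler_wpM2r // w_incr.
  by rewrite le_eqVlt; apply/orP; left; apply/eqP; apply: eq_torint => y _; ring.
have w_close : `|moll N w x - w x| <= 29 * B.
  rewrite moll_sub // mulrC; apply: le_trans (ler_wpM2l B0 (torint_jackson_scaled_dist R N0)).
  rewrite -torintZl; last by continuity.
  under [X in _ <= torint X]eq_fun do rewrite mulrCA.
  apply: torint_jackson_norm_le; [continuity..|move=> y cy].
  by apply: le_trans (w_incr y cy) _; rewrite ler_wpM2l // ler_eXnr ?scaled_dist_ge1.
have f_close : `|moll N f x - f x| <= weighted_osc N f x.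
  rewrite moll_sub //; apply: torint_jackson_norm_le; [continuity..|move=> y _].
  by rewrite ler_peMl ?scaled_dist_ge1.
rewrite commutatorE //; apply: le_trans (ler_normB _ _) _.
rewrite (_ : 30 * B * _ = B * weighted_osc N f x + 29 * B * weighted_osc N f x); last by ring.
by apply: lerD => //; rewrite normrM; apply: ler_pM.
Qed.

Lemma l2norm_weighted_osc N f (D : R) : (0 < N)%N -> continuous f ->
  (forall y, cube y -> l2norm (fun x => f (x + y) - f x) <= D * scaled_dist N y) ->
  l2norm (weighted_osc N f) <= 29 * D.
Proof.
move=> N0 cf f_incr; have mass := torint_jackson_scaled_dist R N0.
have D0 : 0 <= D := scaled_dist_coef_ge0 (l2norm_ge0 _) (f_incr 0 (@cube0 R)).
pose sq_osc x := torint (fun y : pt => jackson N y * `|f (x + y) - f x| ^+ 2).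
have osc_le x : weighted_osc N f x ^+ 2 <= 29 * sq_osc x.
  apply: le_trans (radon_CauchySchwarz (torint_is_radon R) _ _ _ (jackson_ge0 N)) _.
  1-3: by continuity.
  apply: ler_wpM2r mass.
  by apply: torint_ge0 => [|y]; [continuity|rewrite mulr_ge0 ?jackson_ge0 ?exprn_ge0].
have incr_le y : cube y ->
    torint (fun x => `|f (x + y) - f x| ^+ 2) <= D ^+ 2 * scaled_dist N y ^+ 2.
  move=> cy; rewrite -exprMn; under [X in torint X]eq_fun do rewrite real_normK ?num_real //.
  rewrite -sqr_l2norm; last by continuity.
  by apply: lerXn2r (f_incr y cy); rewrite nnegrE ?l2norm_ge0 ?mulr_ge0 ?scaled_dist_ge0.
apply: l2norm_le; first by rewrite mulr_ge0.
apply: (@le_trans _ _ (torint (fun x => 29 * sq_osc x))).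
  by apply: le_torint => [| |x _]; [rewrite /weighted_osc; continuity|rewrite /sq_osc; continuity|].
rewrite torintZl; last by rewrite /sq_osc; continuity.
rewrite exprMn expr2 -mulrA ler_wpM2l // /sq_osc.
rewrite (radon_torint (torint_is_radon R)); last by continuity.
apply: (@le_trans _ _ (torint (fun y => D ^+ 2 * (jackson N y * scaled_dist N y ^+ 2)))).
  apply: le_torint; [continuity..|move=> y cy].
  rewrite torintZl; last by continuity.
  by rewrite mulrCA ler_wpM2l ?jackson_ge0 ?incr_le.
rewrite torintZl; last by continuity.
by rewrite mulrC ler_wpM2r ?sqr_ge0.
Qed.

Lemma l2norm_commutator N w f (B D : R) : (0 < N)%N -> continuous w -> continuous f ->
  (forall x y, cube y -> `|w (x + y) - w x| <= B * scaled_dist N y) ->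
  (forall y, cube y -> l2norm (fun x => f (x + y) - f x) <= D * scaled_dist N y) ->
  l2norm (commutator N w f) <= 870 * B * D.
Proof.
move=> N0 cw cf w_incr f_incr.
have B30 : 0 <= 30 * B.
  by rewrite mulr_ge0 // (scaled_dist_coef_ge0 (normr_ge0 _) (w_incr 0 0 (@cube0 R))).
apply: (@le_trans _ _ (30 * B * l2norm (weighted_osc N f))).
  apply: le_l2normZ => //; [exact: continuous_commutator|exact: continuous_weighted_osc|move=> x].
  rewrite (ger0_norm (weighted_osc_ge0 N x cf)); apply: commutator_norm_le => // y.
  exact: w_incr.
apply: le_trans (ler_wpM2l B30 (l2norm_weighted_osc N0 cf f_incr)) _.
by rewrite (_ : 30 * B * (29 * D) = 870 * B * D) //; ring.
Qed.

End Commutator.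

Record C2_with (R : realType) (b db d2b : R -> R) : Prop := C2With {
  C2_deriv : is_deriv b db;
  C2_deriv2 : is_deriv db d2b;
  C2_continuous2 : continuous d2b
}.

Section Flux.
Variable R : realType.
Local Notation pt := 'rV[R]_3.
Implicit Types (f : pt -> R) (v : 'I_3 -> pt -> R) (N : nat).

Definition flux v (d2b : R -> R) N f : R :=
  \sum_(i < 3) torint (fun x =>
    d2b (moll N f x) * moll_grad N f i x * moll N (fun y => v i y * f y) x).

Definition moll_div N v x : R := \sum_(i < 3) moll_grad N (v i) i x.

Lemma torint_transport (b db : R -> R) (w dw : 'I_3 -> pt -> R) f (df : 'I_3 -> pt -> R) :
  is_deriv b db -> continuous db -> cperiodic f ->
  (forall i, is_partial i f (df i)) -> (forall i, continuous (df i)) ->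
  (forall i, cperiodic (w i)) -> (forall i, is_partial i (w i) (dw i)) ->
  (forall i, continuous (dw i)) -> (forall x, \sum_(i < 3) dw i x = 0) ->
  \sum_(i < 3) torint (fun x => w i x * (db (f x) * df i x)) = 0.
Proof.
move=> db_b cdb Hf pf cdf Hw pw cdw dw0; have cb := is_deriv_continuous db_b.
rewrite (eq_bigr (fun i => torint (fun x => - (dw i x * b (f x))))) => [|i _].
  rewrite -torint_sum => [|i]; last by continuity.
  by apply: torint0 => x; rewrite sumrN -mulr_suml dw0 mul0r oppr0.
rewrite torintN; last by continuity.
apply: torint_by_parts (pw i) (is_partial_comp db_b (pf i)) _ _ _ _ => //; [|by continuity].
exact: cperiodic_comp.
Qed.

(* As [moll N (v i)] is divergence free, subtracting [moll N (v i) * moll N f] from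
   [moll N (v i * f)] does not change the flux. *)
Lemma flux_commutator v (b db d2b : R -> R) N f : C2_with b db d2b -> cperiodic f ->
  (forall i, cperiodic (v i)) -> (forall x, moll_div N v x = 0) ->
  flux v d2b N f =
  \sum_(i < 3) torint (fun x => d2b (moll N f x) * moll_grad N f i x * commutator N (v i) f x).
Proof.
move=> [db_b d2b_db cd2b] Hf Hv dv; have Hm := cperiodic_moll N Hf.
have cdb := is_deriv_continuous d2b_db.
have Hmv i := cperiodic_moll N (Hv i).
have Hg i := cperiodic_moll_grad N i Hf; have Hgv i := cperiodic_moll_grad N i (Hv i).
have primitive : is_deriv (fun z => z * db z - b z) (fun z => z * d2b z).
  move=> z; rewrite (_ : z * d2b z = 1 * db z + z * d2b z - db z); last by ring.
  by apply: has_deriveD; [apply: has_deriveM; [exact: has_derive_id|]|apply: has_deriveN].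
have := torint_transport primitive _ Hm (fun i => is_partial_moll_grad N i Hf)
  (fun i => (Hg i).1) Hmv (fun i => is_partial_moll_grad N i (Hv i)) (fun i => (Hgv i).1) dv.
move=> transport; rewrite -[LHS]subr0 -[X in _ - X]transport; last by continuity.
rewrite -sumrB; apply: eq_bigr => i _; rewrite -torintB; [|continuity..].
by apply: eq_torint => x _; rewrite /commutator; ring.
Qed.

Lemma continuous_flux (v : 'I_3 -> pt -> R -> R) (d2b : R -> R) N (f : pt -> R -> R) :
  continuous d2b -> (forall i, cperiodic_flow (v i)) -> cperiodic_flow f ->
  continuous (fun s => flux (fun i => (v i)^~ s) d2b N (f^~ s)).
Proof.
move=> cd2b Hv [cf pf]; apply: continuous_fun_sum => i; have [cv pv] := Hv i.
have cgrad : continuous (fun z : R * pt => moll_grad N (f^~ z.1) i z.2).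
  by apply: (continuous_fun_moll_grad (f := fun (z : R * pt) y => f y z.1)) => //; continuity.
by continuity.
Qed.

Section FluxBound.
Variables chi vphi : pt -> R.
Hypothesis LP : LP_pair chi vphi.

Definition flux_const : R := 2610 * bernstein_const R ^+ 3 * decay_sum R ^+ 2.

Lemma flux_const_gt0 : 0 < flux_const.
Proof.
have K0 := bernstein_const_gt0 R; have S0 := decay_sum_gt0 R.
by rewrite /flux_const -mulrA pmulr_rgt0 ?ltr0n // mulr_gt0 // exprn_gt0.
Qed.

(* The powers of [2 ^ J] balance: [2 ^ (2 J / 3)] from the gradient of [f] against
   [2 ^ (- J / 3)] from each of the increments of [v i] and [f]. *)
Lemma flux_le v (b db d2b : R -> R) J f (B2 V A E : R) :
  C2_with b db d2b -> cperiodic f -> (forall i, cperiodic (v i)) ->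
  (forall x, moll_div (2 ^ J) v x = 0) ->
  (forall x, `|d2b (moll (2 ^ J) f x)| <= B2) ->
  (forall i n, besov_coef chi vphi (@Lq R +oo%E) (v i) n <= V) ->
  (forall n, besov_coef chi vphi (@l2norm R) f n <= A) ->
  (forall m, \sum_(n < m) decay R n J * besov_coef chi vphi (@l2norm R) f n <= E) ->
  `|flux v d2b (2 ^ J) f| <= flux_const * B2 * V * A * E.
Proof.
move=> b_C2 Hf Hv dv d2b_le vV fA fE; have [_ _ cd2b] := b_C2.
have N0 : (0 < 2 ^ J)%N by rewrite expn_gt0.
have e0 := cbrt2_gt0 R; have K0 := ltW (bernstein_const_gt0 R).
have tL2 := l2norm_transl_norm R; have tLoo := Lq_oo_transl_norm R.
have Hm := cperiodic_moll (2 ^ J) Hf; have Hg i := cperiodic_moll_grad (2 ^ J) i Hf.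
have ccomm i : continuous (commutator (2 ^ J) (v i) f).
  by apply: continuous_commutator; [exact: (Hv i).1|exact: Hf.1].
pose c := bernstein_const R * decay_sum R / cbrt2 R ^+ J.
have v_incr i x y : cube y -> `|v i (x + y) - v i x| <= c * V * scaled_dist (2 ^ J) y.
  move=> cy; apply: le_trans (Lq_oo_ub (cperiodic_incr y (Hv i)) x) _.
  by rewrite /c (mulrAC _ _ V); exact: (besov_incr LP tLoo J (Hv i) (vV i) cy).
have f_incr y : cube y -> l2norm (fun x => f (x + y) - f x) <= c * A * scaled_dist (2 ^ J) y.
  by move=> cy; rewrite /c (mulrAC _ _ A); exact: (besov_incr LP tL2 J Hf fA cy).
have comm_le i := l2norm_commutator N0 (Hv i).1 Hf.1 (v_incr i) f_incr.
have grad_le i : l2norm (moll_grad (2 ^ J) f i) <= bernstein_const R * cbrt2 R ^+ (2 * J) * E.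
  have [m grad_m] := besov_moll_grad LP tL2 i J Hf; apply: le_trans grad_m _.
  by rewrite ler_wpM2l // mulr_ge0 // exprn_ge0 // ltW.
have B20 : 0 <= B2 by exact: le_trans (normr_ge0 _) (d2b_le 0).
rewrite (flux_commutator b_C2 Hf Hv dv).
pose term := B2 * (bernstein_const R * cbrt2 R ^+ (2 * J) * E) * (870 * (c * V) * (c * A)).
apply: (@le_trans _ _ (\sum_(i < 3) term)).
  apply: le_trans (ler_norm_sum _ _ _) _; apply: ler_sum => i _.
  apply: le_trans (l2norm_CauchySchwarz _ (ccomm i)) _; first by continuity.
  apply: ler_pM (comm_le i); rewrite ?l2norm_ge0 //.
  apply: le_trans (ler_wpM2l B20 (grad_le i)); apply: le_l2normZ => //; [continuity..|move=> x].
  by rewrite normrM ler_wpM2r.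
rewrite sumr_const card_ord -[leLHS]mulr_natl le_eqVlt; apply/orP; left; apply/eqP.
by rewrite /term /c /flux_const mulnC exprM; field; rewrite gt_eqF ?exprn_gt0.
Qed.

Section FluxLimit.
Variables (v : 'I_3 -> pt -> R) (f : pt -> R) (b db d2b : R -> R) (B2 V : R).
Hypothesis b_C2 : C2_with b db d2b.
Hypothesis Hf : cperiodic f.
Hypothesis Hv : forall i, cperiodic (v i).
Hypothesis div_free : forall N x, moll_div N v x = 0.
Hypothesis d2b_le : forall J x, `|d2b (moll (2 ^ J) f x)| <= B2.
Hypothesis v_le : forall i n, besov_coef chi vphi (@Lq R +oo%E) (v i) n <= V.
Local Notation coef := (besov_coef chi vphi (@l2norm R) f).

Lemma flux_bound_ge0 : 0 <= flux_const * B2 * V.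
Proof.
have V0 : 0 <= V by exact: le_trans (besov_coef_ge0 _ _ (Lq_oo_transl_norm R) _ _) (v_le ord0 0).
have B20 : 0 <= B2 by exact: le_trans (normr_ge0 _) (d2b_le 0 0).
by rewrite mulr_ge0 // mulr_ge0 // ltW // flux_const_gt0.
Qed.

Lemma flux_le_sqr J (A : R) : (forall n, coef n <= A) ->
  `|flux v d2b (2 ^ J) f| <= flux_const * B2 * V * decay_sum R * A ^+ 2.
Proof.
move=> fA; rewrite [leRHS](_ : _ = flux_const * B2 * V * A * (decay_sum R * A)); last by ring.
have A0 : 0 <= A by exact: le_trans (besov_coef_ge0 _ _ (l2norm_transl_norm R) _ _) (fA 0%N).
apply: (flux_le b_C2) => // m; apply: (@le_trans _ _ ((\sum_(n < m) decay R n J) * A)).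
  by rewrite mulr_suml; apply: ler_sum => n _; rewrite ler_wpM2l ?decay_ge0.
by rewrite ler_wpM2r // sum_decay_le.
Qed.

Lemma flux_cvg0 : coef @ \oo --> (0 : R) -> (fun J => flux v d2b (2 ^ J) f) @ \oo --> (0 : R).
Proof.
move=> coef_cvg0; have c0 := flux_bound_ge0.
have [A fA] : exists A, forall n, coef n <= A.
  have [M [_ coefM]] := cvg_seq_bounded (cvgP _ coef_cvg0).
  exists (M + 1) => n; apply: le_trans (ler_norm _) _; apply: coefM => //.
  by rewrite ltrDl.
have coef0 n : 0 <= coef n <= A by rewrite fA andbT (besov_coef_ge0 _ _ (l2norm_transl_norm R)).
have A0 : 0 <= A by have /andP[] := coef0 0%N; exact: le_trans.
pose c : R := flux_const * B2 * V * A; have c1 : 0 < c + 1 by rewrite ltr_wpDl // mulr_ge0.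
apply/cvgrPdist_le => e e0; have e1 : 0 < e / (c + 1) by rewrite divr_gt0.
apply: filterS (sum_decay_cvg0 coef0 coef_cvg0 e1) => J sum_le; rewrite sub0r normrN.
apply: le_trans (flux_le b_C2 Hf Hv (div_free _) (d2b_le J) v_le fA sum_le) _.
by rewrite -/c mulrA ler_pdivrMr // mulrC ler_wpM2l ?lerDl // ltW.
Qed.

End FluxLimit.

End FluxBound.

End Flux.

(** * Testing the weak formulation *)

Section TimeBump.
Variable R : realType.
Implicit Types (P : {poly R}) (a l s : R).

(* The functions [P(1 / (a - s)) exp (- l / (a - s))], extended by [0] for [s >= a], are stable
   under differentiation and vanish to infinite order at [a]. *)
Definition bump a l P s : R :=
  if s < a then P.[(a - s)^-1] * expR (- (l * (a - s)^-1)) else 0.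

Definition bump_deriv l P : {poly R} := 'X^2 * (P^`() - l *: P).

Lemma bump_ge a l P s : a <= s -> bump a l P s = 0.
Proof. by move=> a_le; rewrite /bump ltNge a_le. Qed.

Lemma poly_expR_bounded l P : 0 < l -> exists2 C, 0 <= C &
  forall u, 0 < u -> `|P.[u] * expR (- (l * u))| <= C * u ^- 2.
Proof.
move=> l0; exists (\sum_(i < size P) `|P`_i| * ((i.+2)`!%:R / l ^+ i.+2)).
  by apply: sumr_ge0 => i _; rewrite mulr_ge0 // divr_ge0 // exprn_ge0 // ltW.
move=> u u0; have lu : 0 <= l * u by rewrite mulr_ge0 // ltW.
rewrite horner_coef mulr_suml [leRHS]mulr_suml; apply: le_trans (ler_norm_sum _ _ _) _.
apply: ler_sum => i _; rewrite -mulrA normrM -[leRHS]mulrA ler_wpM2l //.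
rewrite ger0_norm ?mulr_ge0 ?expR_ge0 ?exprn_ge0 ?(ltW u0) //.
rewrite expRN ler_pdivrMr ?expR_gt0 // mulrAC ler_pdivlMr ?exprn_gt0 // -exprD addn2.
rewrite mulrAC ler_pdivlMr ?exprn_gt0 // -exprMn (mulrC u) -ler_pdivrMl ?ltr0n ?fact_gt0 //.
by apply: le_trans (expR_ge1Dxn i.+1 lu); rewrite [leLHS]mulrC lerDr.
Qed.

Lemma bump_le_sqr a l P : 0 < l ->
  exists2 C, 0 <= C & forall s, `|bump a l P s| <= C * (s - a) ^+ 2.
Proof.
move=> l0; have [C C0 PC] := poly_expR_bounded P l0; exists C => // s.
have [a_le|s_lt] := leP a s; first by rewrite bump_ge // normr0 mulr_ge0 // sqr_ge0.
have u0 : 0 < (a - s)^-1 by rewrite invr_gt0 subr_gt0.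
by have := PC _ u0; rewrite exprVn invrK -(sqrrN (s - a)) opprB /bump s_lt.
Qed.

Lemma has_derive_flat (f : R -> R) x C :
  (forall s, `|f s| <= C * (s - x) ^+ 2) -> has_derive f x (1 : R) 0.
Proof.
move=> fC; have fx : f x = 0.
  by have := fC x; rewrite subrr expr0n mulr0 normr_le0 => /eqP.
pose q h := h^-1 * f (h + x).
have q_le h : `|q h| <= C * `|h|.
  have [->|h0] := eqVneq h 0; first by rewrite /q invr0 mul0r !normr0 mulr0.
  rewrite /q normrM normfV mulrC ler_pdivrMr ?normr_gt0 //.
  by have := fC (h + x); rewrite addrK -real_normK ?num_real // expr2 mulrA.
have q0 : q 0 = 0 by rewrite /q invr0 mul0r.
rewrite -q0; apply: has_derive_slope => [h|].
  rewrite fx subr0 [h *: 1]mulr1 /q mulrA.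
  by have [->|h0] := eqVneq h 0; [rewrite add0r fx mulr0|rewrite mulfV ?mul1r].
rewrite /prop_for /continuous_at q0; apply/cvgrPdist_le => e e0.
have cC : continuous (fun h : R => C * `|h|) by continuity.
have /cvgrPdist_le/(_ e e0) := cC 0; apply: filterS => h.
rewrite normr0 mulr0 !sub0r !normrN; apply: le_trans; apply: le_trans (q_le h) _.
exact: ler_norm.
Qed.

Lemma has_derive_bump_lt a l P s : s < a ->
  has_derive (bump a l P) s (1 : R) (bump a l (bump_deriv l P) s).
Proof.
move=> s_lt; have as0 : a - s != 0 by rewrite subr_eq0 gt_eqF.
have bump_near : \forall t \near s, P.[(a - t)^-1] * expR (- (l * (a - t)^-1)) = bump a l P t.
  by near=> t; rewrite /bump ifT //; near: t; exact: lt_nbhsl.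
apply: (near_eq_is_derive bump_near).
have d_inv : has_derive (fun t => (a - t)^-1) s (1 : R) ((a - s) ^- 2).
  rewrite -[X in has_derive _ _ _ X](_ : - (a - s) ^- 2 * (0 - 1) = _); last by ring.
  apply: (has_derive_inv (f := fun t => a - t)) => //.
  by apply: has_deriveD; [exact: has_derive_cst|apply: has_deriveN; exact: has_derive_id].
have d_poly : has_derive (fun t => P.[(a - t)^-1]) s (1 : R) (P^`().[(a - s)^-1] * (a - s) ^- 2).
  by apply: (has_derive_comp (g := horner P) d_inv); exact: is_derive_poly.
have d_exp : has_derive (fun t => expR (- (l * (a - t)^-1))) s (1 : R)
    (expR (- (l * (a - s)^-1)) * - (l * (a - s) ^- 2)).
  apply: (@has_derive_comp R (fun t => - (l * (a - t)^-1)) expR); last exact: is_derive_expR.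
  by apply: has_deriveN; apply: has_deriveZ.
have := has_deriveM d_poly d_exp; congr has_derive.
by rewrite /bump s_lt /bump_deriv hornerM hornerXn hornerD hornerN hornerZ -exprVn; ring.
Unshelve. all: by end_near. Qed.

Lemma is_deriv_bump a l P : 0 < l -> is_deriv (bump a l P) (bump a l (bump_deriv l P)).
Proof.
move=> l0 s; have [s_lt|s_gt|->] := ltgtP s a; first exact: has_derive_bump_lt.
- have bump_near : \forall t \near s, 0 = bump a l P t.
    by near=> t; rewrite bump_ge // ltW //; near: t; exact: lt_nbhsr.
  rewrite bump_ge ?(ltW s_gt) //.
  exact: (near_eq_is_derive bump_near (has_derive_cst _ _ _)).
- rewrite bump_ge //; have [C _ bumpC] := bump_le_sqr a P l0; exact: has_derive_flat bumpC.
Unshelve. all: by end_near. Qed.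

Lemma continuous_bump a l P : 0 < l -> continuous (bump a l P).
Proof. by move=> l0; exact: (is_deriv_continuous (is_deriv_bump a P l0)). Qed.

Local Notation beta a l := (bump a l 1).
Local Notation dbeta a l := (bump a l (bump_deriv l 1)).

Lemma bump1E a l s : s < a -> beta a l s = expR (- (l * (a - s)^-1)).
Proof. by move=> s_lt; rewrite /bump s_lt hornerC mul1r. Qed.

Lemma bump1_derivE a l s : s < a ->
  dbeta a l s = - (l * (a - s) ^- 2 * expR (- (l * (a - s)^-1))).
Proof.
move=> s_lt; rewrite /bump s_lt /bump_deriv derivC sub0r.
by rewrite hornerM hornerXn hornerN hornerZ hornerC -exprVn; ring.
Qed.

Lemma bump1_deriv_le0 a l s : 0 < l -> 0 <= - dbeta a l s.
Proof.
move=> l0; have [a_le|s_lt] := leP a s; first by rewrite bump_ge // oppr0.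
by rewrite bump1_derivE // opprK !mulr_ge0 ?expR_ge0 ?invr_ge0 ?sqr_ge0 // ltW.
Qed.

Lemma bump1_deriv_sqr_le a l s : 0 < l -> - dbeta a l s * (s - a) ^+ 2 <= l.
Proof.
move=> l0; have [a_le|s_lt] := leP a s; first by rewrite bump_ge // oppr0 mul0r ltW.
have as0 : a - s != 0 by rewrite subr_eq0 gt_eqF.
rewrite bump1_derivE // [leLHS](_ : _ = l * expR (- (l * (a - s)^-1))); last by field.
rewrite ler_piMr ?(ltW l0) // -expR0 ler_expR oppr_le0 mulr_ge0 ?(ltW l0) // invr_ge0.
by rewrite subr_ge0 ltW.
Qed.

Lemma segint_bump1_deriv a l T : 0 < l -> a <= T -> 0 <= T ->
  segint 0 T (dbeta a l) = - beta a l 0.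
Proof.
move=> l0 aT T0; have db := is_deriv_bump a 1 l0.
rewrite (segint_deriv T0 _ db); last exact: continuous_bump.
by rewrite bump_ge // sub0r.
Qed.

(* The measure [- dbeta a l ds] has mass about [1] and concentrates at [a] as [l] tends to [0]. *)
Lemma segint_bump1_deriv_close (T a l e C : R) (H : R -> R) : 0 < l -> 0 < a <= T ->
  continuous H -> 0 <= C ->
  (forall s, timeI 0 T s -> `|H s - H a| <= e + C * (s - a) ^+ 2) ->
  `|segint 0 T (fun s => - dbeta a l s * (H s - H a))| <= e * beta a l 0 + C * l * T.
Proof.
move=> l0 /andP[a0 aT] cH C0 HC; have T0 : 0 <= T by rewrite ltW // (lt_le_trans a0).
have cd := @continuous_bump a l (bump_deriv l 1) l0; have rT := segint_is_radon T0.
apply: le_trans (radon_norm rT _) _; first by continuity.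
apply: (@le_trans _ _ (segint 0 T (fun s => e * - dbeta a l s + C * l))).
  apply: le_segint; [continuity..|move=> s sT].
  rewrite normrM (ger0_norm (bump1_deriv_le0 a s l0)).
  apply: le_trans (ler_wpM2l (bump1_deriv_le0 a s l0) (HC s sT)) _.
  by rewrite mulrDr (mulrC _ e) lerD2l mulrCA ler_wpM2l // bump1_deriv_sqr_le.
rewrite (radonD rT); [|continuity..]; rewrite (radonZl rT); last by continuity.
by rewrite (radonN rT) // segint_bump1_deriv // opprK segint_cst // subr0.
Qed.

Lemma bump1_orthogonal_eq0 (T a : R) (H : R -> R) : 0 < a <= T -> continuous H ->
  (forall l, 0 < l -> segint 0 T (fun s => dbeta a l s * H s) = 0) -> H a = 0.
Proof.
move=> aT cH orthogonal; have /andP[a0 a_le] := aT; have T0 : 0 < T by exact: lt_le_trans a_le.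
apply/eqP; rewrite -normr_le0; apply/ler_addgt0Pr => e e0; rewrite add0r.
have [||||C C0 HC] := @compact_le_epsilon_add R R (timeI 0 T) (fun s => `|H s - H a|)
  (fun s => (s - a) ^+ 2) (e / 4) (@compact_timeI R 0 T) _ _ (fun s => sqr_ge0 _).
- by continuity.
- by continuity.
- by move=> s _ /eqP; rewrite sqrf_eq0 subr_eq0 => /eqP ->; rewrite subrr normr0.
- by rewrite divr_gt0.
have CT : 0 < C * T + 1 by rewrite ltr_wpDl // mulr_ge0 // ltW.
pose l := Num.min (a / 2) (e / 4 / (C * T + 1)).
have l0 : 0 < l by rewrite lt_min !divr_gt0.
have mass_ge : 1 / 2 <= beta a l 0.
  rewrite bump1E // subr0; apply: le_trans (expR_ge1Dx _).
  have : l * a^-1 <= 1 / 2 by rewrite ler_pdivrMr // ge_min; apply/orP; left; lra.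
  by lra.
have mass_le : beta a l 0 <= 1.
  by rewrite bump1E // subr0 -expR0 ler_expR oppr_le0 divr_ge0 // ltW.
have ClT : C * l * T <= e / 4.
  have : l <= e / 4 / (C * T + 1) by rewrite ge_min lexx orbT.
  by rewrite ler_pdivlMr //; nra.
have rT := segint_is_radon (ltW T0); have cd := @continuous_bump a l (bump_deriv l 1) l0.
have := segint_bump1_deriv_close l0 aT cH C0 HC.
rewrite (_ : segint _ _ _ = - (H a * beta a l 0)); last first.
  transitivity (segint 0 T (fun s => H a * dbeta a l s - dbeta a l s * H s)).
    by apply: eq_segint => s _; ring.
  rewrite (radonB rT); [|continuity..]; rewrite (radonZl rT) //.
  by rewrite segint_bump1_deriv ?orthogonal ?subr0 ?mulrN // ltW.
rewrite normrN normrM (ger0_norm (le_trans _ mass_ge)); last by lra.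
by have := normr_ge0 (H a); nra.
Qed.

End TimeBump.

Section AlmostEverywhere.
Variable R : realType.
Local Notation mu := (@lebesgue_measure R).

Lemma ae_onI (T : R) (P Q : R -> Prop) : ae_on T P -> ae_on T Q -> ae_on T (fun t => P t /\ Q t).
Proof.
move=> [N [N0 NP]] [M [M0 MQ]]; exists (N `|` M); split; first exact: negligibleU.
by move=> t tT tNM; split; [apply: NP|apply: MQ] => // tN; apply: tNM; [left|right].
Qed.

Lemma ae_onS (T : R) (P Q : R -> Prop) :
  (forall t, 0 <= t <= T -> P t -> Q t) -> ae_on T P -> ae_on T Q.
Proof. by move=> PQ [N [N0 NP]]; exists N; split=> // t tT tN; apply: PQ => //; exact: NP. Qed.

Lemma ae_on_ord3 T (P : 'I_3 -> R -> Prop) :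
  (forall i, ae_on T (P i)) -> ae_on T (fun t => forall i, P i t).
Proof.
move=> aeP; have := ae_onI (aeP ord0) (ae_onI (aeP (lift ord0 ord0)) (aeP ord_max)).
by apply: ae_onS => t _ [P0 [P1 P2]]; elim/ord3P.
Qed.

Lemma itv_not_negligible (c e : R) : c < e -> ~ mu.-negligible `[c, e]%classic.
Proof.
move=> ce itv0; have : mu `[c, e]%classic = 0%E by apply/negligibleP => //; exact: measurable_itv.
by rewrite lebesgue_measure_itv /= lte_fin ce -EFinD => -[/eqP]; rewrite subr_eq0 gt_eqF.
Qed.

Lemma ae_on_continuous_eq0 (T : R) (g : R -> R) : 0 < T -> continuous g ->
  ae_on T (fun t => g t = 0) -> forall t, 0 <= t <= T -> g t = 0.
Proof.
move=> T0 cg [N [N_negl gN]] t /andP[t0 tT]; apply/eqP; rewrite -normr_le0.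
apply/ler_addgt0Pr => e e0; rewrite add0r.
have /cvgrPdist_lt/(_ e e0)/nbhs_ballP[d /= d0 close] := cg t.
pose c := Num.max 0 (t - d / 2); pose b := Num.min T (t + d / 2).
have cb : c < b by rewrite gt_max !lt_min; do 2 (apply/andP; split); lra.
have [s sN] : exists s, (c <= s <= b) /\ ~ N s.
  apply: contrapT => all_N; apply: (itv_not_negligible cb); apply: negligibleS N_negl => s.
  by rewrite /= in_itv /= => cs; apply: contrapT => sN; apply: all_N; exists s.
have [/andP[]] := sN; rewrite ge_max le_min => /andP[s0 ts] /andP[sT st] nNs.
have ball_s : ball t d s by rewrite /ball /= ltr_norml; apply/andP; split; lra.
by have := close s ball_s; rewrite (gN s _ nNs) ?s0 // subr0 => /ltW.
Qed.

(* The Du Bois-Reymond lemma, for the tests [bump a l 1] only. *)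
Lemma weak_primitive (T hin : R) (h G : R -> R) : 0 < T -> continuous h -> continuous G ->
  (forall a l, 0 < a < T -> 0 < l ->
    - (hin * bump a l 1 0) - segint 0 T (fun s => bump a l (bump_deriv l 1) s * h s) =
    segint 0 T (fun s => bump a l 1 s * G s)) ->
  forall t, 0 <= t <= T -> h t = hin + segint 0 t G.
Proof.
move=> T0 ch cG weak t tT; have /andP[t0 _] := tT; rewrite segint_primitive //.
have dP := is_deriv_primitive cG; have cP := is_deriv_continuous dP.
pose H s := h s - primitive G s + (primitive G 0 - hin).
have cH : continuous H by rewrite /H; continuity.
suff : H t = 0 by rewrite /H; lra.
apply: (ae_on_continuous_eq0 T0 cH) tT; exists ([set 0] `|` [set T]); split.
  by apply: negligibleU; apply/negligibleP => //; exact: lebesgue_measure_set1.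
move=> a /andP[a0 aT] a_end; have a0' : 0 < a.
  by rewrite lt_neqAle a0 andbT; apply: contra_notN a_end => /eqP <-; left.
have aT' : a < T by rewrite lt_neqAle aT andbT; apply: contra_notN a_end => /eqP ->; right.
apply: (@bump1_orthogonal_eq0 _ T) => [||l l0]; [by rewrite a0'|by []|].
have rT := segint_is_radon (ltW T0); have db := is_deriv_bump a 1 l0.
have cb := @continuous_bump _ a l 1 l0; have cd := @continuous_bump _ a l (bump_deriv l 1) l0.
have by_parts : segint 0 T (fun s => bump a l (bump_deriv l 1) s * primitive G s) +
    segint 0 T (fun s => bump a l 1 s * G s) = - (bump a l 1 0 * primitive G 0).
  rewrite -(radonD rT); [|continuity..].
  rewrite (segint_deriv (ltW T0) _ (fun s => has_deriveM (db s) (dP s))); last by continuity.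
  by rewrite bump_ge // mul0r sub0r.
transitivity (segint 0 T (fun s => bump a l (bump_deriv l 1) s * h s -
    bump a l (bump_deriv l 1) s * primitive G s +
    (primitive G 0 - hin) * bump a l (bump_deriv l 1) s)).
  by apply: eq_segint => s _; rewrite /H; ring.
rewrite (radonD rT); [|continuity..]; rewrite (radonB rT); [|continuity..].
rewrite (radonZl rT) // segint_bump1_deriv ?(ltW T0) //.
have := weak a l; rewrite a0' aT' => /(_ isT l0).
by move: by_parts; lra.
Qed.

End AlmostEverywhere.

Section SmoothTests.
Variable R : realType.
Local Notation pt := 'rV[R]_3.
Implicit Types (A g : pt -> R).

Lemma smooth_xt_class (C : (pt -> R -> R) -> Prop) :
  (forall f, C f -> [/\ continuous (fun z : pt * R => f z.1 z.2),
     forall d x s, derivable_dir d f x s & forall d, C (dirD d f)]) ->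
  forall f, C f -> smooth_xt f.
Proof.
move=> C_stable f Cf l; have Cl : C (Defs.iterD l f).
  by elim: l => //= d l IH; have [_ _] := C_stable _ IH; exact.
by have [] := C_stable _ Cl.
Qed.

Lemma dx_tensor i A dA (beta : R -> R) : is_partial i A dA ->
  dx i (fun x s => A x * beta s) = (fun x s => dA x * beta s).
Proof.
move=> pA; apply: funext => x; apply: funext => s.
exact: has_derive_val (is_partialZr (beta s) pA x).
Qed.

Lemma dt_tensor A (beta dbeta : R -> R) : is_deriv beta dbeta ->
  dt (fun x s => A x * beta s) = (fun x s => A x * dbeta s).
Proof.
move=> d_beta; apply: funext => x; apply: funext => s.
by apply: has_derive_val; apply: has_deriveZ; exact: d_beta.
Qed.

Lemma smooth_xt_tensor (B : (R -> R) -> Prop) b A beta :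
  (forall f, B f -> exists2 df, B df & is_deriv f df) -> trigpoly b A -> B beta ->
  smooth_xt (fun x s => A x * beta s).
Proof.
move=> B_deriv TA Bbeta.
apply: (smooth_xt_class (C := fun f => exists A beta,
    [/\ trigpoly b A, B beta & f = (fun x s => A x * beta s)])); last by exists A, beta.
move=> _ [{TA}A [{Bbeta}beta [TA Bbeta ->]]]; have [cA _] := cperiodic_trigpoly TA.
have [dbeta Bdbeta d_beta] := B_deriv _ Bbeta; have cb := is_deriv_continuous d_beta.
split; first by continuity.
- move=> [i|] x s /=; last first.
    by apply: has_derive_derivable; apply: has_deriveZ; exact: d_beta.
  have [dA _ pA] := is_partial_trigpoly i TA.
  exact: has_derive_derivable (is_partialZr (beta s) pA x).
- move=> [i|]; last by exists A, dbeta; split => //; exact: dt_tensor.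
  have [dA TdA pA] := is_partial_trigpoly i TA; exists dA, beta; split => //.
  exact: dx_tensor.
Qed.

Lemma smooth_xt_trigpoly_bump b A (a l : R) P : 0 < l -> trigpoly b A ->
  smooth_xt (fun x s => A x * bump a l P s).
Proof.
move=> l0 TA; apply: (smooth_xt_tensor (B := fun f => exists P, f = bump a l P)) TA _.
  2: by exists P.
by move=> _ [Q ->]; exists (bump a l (bump_deriv l Q)); [eexists|exact: is_deriv_bump].
Qed.

Lemma smooth_x_trigpoly b A : trigpoly b A -> smooth_x A.
Proof.
move=> TA; rewrite /smooth_x; under [X in smooth_xt X]eq_fun do under eq_fun do rewrite -[A _]mulr1.
apply: (smooth_xt_tensor (B := fun f => exists c, f = (fun _ => c))) TA _; last by exists 1.
by move=> _ [c ->]; exists (fun _ => 0); [exists 0|move=> s; exact: has_derive_cst].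
Qed.

Lemma smooth_x_continuous g : smooth_x g -> continuous g.
Proof.
move=> /(_ [::])[c _].
apply: (continuous_fun_comp2 (g := fun x (_ : R) => g x) (h := id) (k := fun _ => 0) c).
1-2: by continuity.
Qed.

Lemma smooth_x_partial g i : smooth_x g -> is_partial i g (dx0 i g) /\ continuous (dx0 i g).
Proof.
move=> sg; split; first by move=> x; have [_ /(_ (Some i) x 0)] := sg [::]; split.
have [c _] := sg [:: Some i].
apply: (continuous_fun_comp2 (g := fun x (_ : R) => dx0 i g x) (h := id) (k := fun _ => 0) c).
1-2: by continuity.
Qed.

End SmoothTests.

(** * Balance laws of the mollified solution *)

Ltac periodicity :=
  move=> ?;
  match goal with
  | H : cperiodic_flow _ |- periodic3 _ => exact: (proj2 H _)
  | H : forall i, cperiodic_flow _ |- periodic3 _ => exact: (proj2 (H _) _)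
  | H : cperiodic _ |- periodic3 _ => exact: (proj2 H)
  | H : forall i, cperiodic _ |- periodic3 _ => exact: (proj2 (H _))
  end.

#[global] Hint Extern 1 (continuous (fun _ => moll_grad _ _ _ _)) =>
  solve [apply: continuous_fun_moll_grad; [continuity|periodicity|continuity]] : continuity.

Section ChainRules.
Variable R : realType.

Lemma chain_rule_segint (b db h G : R -> R) (h0 t : R) :
  is_deriv b db -> continuous db -> continuous G -> 0 <= t ->
  (forall s, 0 <= s <= t -> h s = h0 + segint 0 s G) ->
  b (h t) = b h0 + segint 0 t (fun s => db (h s) * G s).
Proof.
move=> db_b cdb cG t0 hE; pose H s := h0 + (primitive G s - primitive G 0).
have hH s : 0 <= s <= t -> h s = H s.
  by move=> st; have /andP[s0 _] := st; rewrite hE // segint_primitive.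
have dH : is_deriv H G.
  move=> s; rewrite -[G s]add0r -[G s]subr0; apply: has_deriveD; first exact: has_derive_cst.
  by apply: has_deriveD; [exact: is_deriv_primitive|apply: has_deriveN; exact: has_derive_cst].
have cH := is_deriv_continuous dH.
rewrite (@eq_segint _ 0 t _ (fun s => db (H s) * G s)) => [|s st]; last by rewrite hH.
rewrite (@segint_deriv _ 0 t _ (fun s => b (H s))) //; last 2 first.
- by continuity.
- by move=> s; apply: has_derive_comp; [exact: dH|exact: db_b].
by rewrite hH ?t0 ?lexx // {3}/H subrr addr0; ring.
Qed.

(* Each of the two arguments of [D] contributes [F s s], by symmetry. *)
Lemma has_derive_diagonal (T : R) (D F : R -> R -> R) (C : R -> R) s :
  continuous (fun z : R * R => F z.1 z.2) -> (forall s r, D s r = D r s) ->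
  (forall s r, 0 <= s <= T -> 0 <= r <= T -> D s r = C r + segint 0 s (F^~ r)) ->
  0 < s < T -> has_derive (fun s => D s s) s (1 : R) (2 * F s s).
Proof.
move=> cF Dsym DE /andP[s0 sT]; have cFr r : continuous (F^~ r) by continuity.
have slope r h : 0 <= s + h <= T -> 0 <= r <= T ->
    D (s + h) r - D s r = h * segint 0 1 (fun y => F (s + y * h) r).
  move=> shT rT; have /andP[sh0 _] := shT.
  rewrite !DE ?(ltW s0) ?(ltW sT) // opprD addrACA subrr add0r.
  rewrite (segint_primitive sh0) // (segint_primitive (ltW s0)) //.
  by have /= <- := segint_slope s h (cFr r) (is_deriv_primitive (cFr r)); ring.
pose q h := segint 0 1 (fun y => F (s + y * h) (s + h)) + segint 0 1 (fun y => F (s + y * h) s).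
have -> : 2 * F s s = q 0.
  rewrite /q addr0; under eq_segint => y _ do rewrite mulr0 addr0.
  by rewrite segint01_cst; ring.
apply: has_derive_slope_near; last first.
  have cq : continuous q by rewrite /q; continuity.
  exact: cq.
near=> h; rewrite [h *: 1]mulr1 (addrC h).
have h_small : `|h| < Num.min s (T - s).
  near: h; apply/nbhs_ballP; exists (Num.min s (T - s)); first by rewrite /= lt_min s0 subr_gt0.
  by move=> h; rewrite /ball /= sub0r normrN.
move: h_small; rewrite lt_min !ltr_norml => /andP[/andP[hs _] /andP[_ hT]].
have shT : 0 <= s + h <= T by apply/andP; split; lra.
have sT' : 0 <= s <= T by rewrite !ltW.
by rewrite /q mulrDr -!slope // (Dsym (s + h) s); ring.
Unshelve. all: by end_near. Qed.

End ChainRules.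

(* A weak solution frozen outside [0, T], with its integrals written as [torint] and [segint]. *)
Record continuous_solution (R : realType) (T : R) (vin : 'I_3 -> 'rV[R]_3 -> R)
    (thin : 'rV[R]_3 -> R) (v : 'I_3 -> 'rV[R]_3 -> R -> R) (th : 'rV[R]_3 -> R -> R) : Prop :=
  ContinuousSolution {
  sol_vin : forall i, smooth_x (vin i) /\ periodic3 (vin i);
  sol_thin : smooth_x thin /\ periodic3 thin;
  sol_div_vin : forall x, \sum_(i < 3) dx0 i (vin i) x = 0;
  sol_velocity : forall i, cperiodic_flow (v i);
  sol_temperature : cperiodic_flow th;
  sol_div : ae_on T (fun t => forall psi, smooth_x psi -> periodic3 psi ->
    torint (fun x => \sum_(i < 3) v i x t * dx0 i psi x) = 0);
  sol_weak_velocity : forall phi, test_vector T phi ->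
    - torint (fun x => \sum_(i < 3) vin i x * phi i x 0)
    - segint 0 T (fun s => torint (fun x => \sum_(i < 3) dt (phi i) x s * v i x s))
    = segint 0 T (fun s => torint (fun x =>
        \sum_(i < 3) \sum_(j < 3) dx j (phi i) x s * (v i x s * v j x s) +
        th x s * phi ord_max x s));
  sol_weak_temperature : forall phi, test_scalar T phi ->
    - torint (fun x => thin x * phi x 0)
    - segint 0 T (fun s => torint (fun x => dt phi x s * th x s))
    = segint 0 T (fun s => torint (fun x => (\sum_(i < 3) v i x s * dx i phi x s) * th x s))
}.

Section TimeExtension.
Variable R : realType.
Local Notation pt := 'rV[R]_3.
Variable T : R.
Hypothesis T0 : 0 < T.
Implicit Types (f : pt -> R -> R) (s t : R).

Definition clamp s : R := Num.max 0 (Num.min s T).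

(* Freezing a field outside [0, T] makes it continuous on the whole time line. *)
Definition extend f : pt -> R -> R := fun x s => f x (clamp s).

Lemma clamp_id s : 0 <= s <= T -> clamp s = s.
Proof. by move=> /andP[s0 sT]; rewrite /clamp (min_idPl sT) (max_idPr s0). Qed.

Lemma clamp_itv s : 0 <= clamp s <= T.
Proof. by rewrite /clamp le_max lexx /= ge_max (ltW T0) /= ge_min lexx orbT. Qed.

Lemma continuous_clamp : continuous clamp.
Proof.
move=> s; apply: (@continuous_max R R (cst 0) (fun s => Num.min s T)); first exact: cvg_cst.
by apply: continuous_min; [exact: cvg_id|exact: cvg_cst].
Qed.

Lemma continuous_within_comp (X Y : topologicalType) (A : set Y) (g : Y -> R) (h : X -> Y) :
  {within A, continuous g} -> continuous h -> (forall x, A (h x)) -> continuous (fun x => g (h x)).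
Proof.
move=> /subspace_continuousP cg ch hA x; apply: cvg_comp (cg _ (hA x)) => P gP.
have : nbhs x [set y | A (h y) -> P (h y)] := ch x _ (gP : nbhs (h x) [set y | A y -> P y]).
by apply: filterS => y; apply; exact: hA.
Qed.

Lemma cperiodic_flow_extend f : cont_T3 T f -> cperiodic_flow (extend f).
Proof.
move=> [cf pf]; have cc := continuous_clamp; split; last by move=> s; apply: pf; exact: clamp_itv.
apply: (continuous_within_comp cf (h := fun z : pt * R => (z.1, clamp z.2))); first by continuity.
by move=> z; exact: clamp_itv.
Qed.

Lemma L_besov_extend chi vphi r q f : L_besov chi vphi r q T f -> L_besov chi vphi r q T (extend f).
Proof.
move=> [coefs Lr]; split; first by apply: ae_onS coefs => t tT; rewrite /extend clamp_id.
case: r Lr => [r||] Lr; last by case: Lr.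
  rewrite /Ltime (_ : (\int[_]_(t in _) _)%E =
    (\int[@lebesgue_measure R]_(t in timeI 0 T) (besov_norm chi vphi q (f^~ t) `^ r))%E).
    exact: Lr.
  by apply: eq_integral => t /[!inE] tT; rewrite /extend clamp_id.
by have [M norm_le] := Lr; exists M; apply: ae_onS norm_le => t tT; rewrite /extend clamp_id.
Qed.

Lemma continuous_solution_extend vin thin v th : weak_solution T vin thin v th ->
  continuous_solution T vin thin (fun i => extend (v i)) (extend th).
Proof.
move=> [vin_in [thin_in [div_in [cv [cth [div_v [weak_v weak_th]]]]]]]; split=> //.
- by move=> i; exact: cperiodic_flow_extend.
- exact: cperiodic_flow_extend.
- apply: ae_onS div_v => t tT div_t psi spsi ppsi.
  by rewrite /extend (clamp_id tT) torintE; exact: div_t.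
- move=> phi phi_test; under [X in _ - X]eq_segint => s sT do rewrite /extend (clamp_id sT).
  under [RHS]eq_segint => s sT do rewrite /extend (clamp_id sT).
  by rewrite torintE !segint_torintE; exact: weak_v.
- move=> phi phi_test; under [X in _ - X]eq_segint => s sT do rewrite /extend (clamp_id sT).
  under [RHS]eq_segint => s sT do rewrite /extend (clamp_id sT).
  by rewrite torintE !segint_torintE; exact: weak_th.
Qed.

End TimeExtension.

Section Solution.
Variable R : realType.
Local Notation pt := 'rV[R]_3.
Variables (T : R) (vin : 'I_3 -> pt -> R) (thin : pt -> R).
Variables (v : 'I_3 -> pt -> R -> R) (th : pt -> R -> R).
Hypothesis T0 : 0 < T.
Hypothesis sol : continuous_solution T vin thin v th.
Implicit Types (A u : 'I_3 -> pt -> R) (N : nat) (x : pt) (s t r : R).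
Local Notation vel t := (fun i => (v i)^~ t).

Let Hv : forall i, cperiodic_flow (v i) := sol_velocity sol.
Let Hth : cperiodic_flow th := sol_temperature sol.

Lemma cperiodic_vin i : cperiodic (vin i).
Proof. by have [sv pv] := sol_vin sol i; split=> //; exact: smooth_x_continuous. Qed.

Lemma cperiodic_thin : cperiodic thin.
Proof. by have [sth pth] := sol_thin sol; split=> //; exact: smooth_x_continuous. Qed.

Lemma temperature_tested b (A : pt -> R) (dA : 'I_3 -> pt -> R) t :
  trigpoly b A -> (forall i, is_partial i A (dA i)) -> 0 <= t <= T ->
  torint (fun x => A x * th x t) = torint (fun x => A x * thin x) +
    segint 0 t (fun s => torint (fun x => (\sum_(i < 3) v i x s * dA i x) * th x s)).
Proof.
move=> TA pA; have HA := cperiodic_trigpoly TA; have Hthin := cperiodic_thin.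
have cdA i := continuous_partial_trigpoly TA (pA i).
apply: (@weak_primitive _ T _ (fun t => torint (fun x => A x * th x t))) => // [||a l aT l0].
- by continuity.
- by continuity.
have db := is_deriv_bump a 1 l0.
pose phi x s := A x * bump a l 1 s.
have phi_test : test_scalar T phi.
  split; first exact: smooth_xt_trigpoly_bump TA.
  split; first by move=> s x i; rewrite /phi HA.2.
  by exists a; split=> [|x s a_le]; [case/andP: aT|rewrite /phi bump_ge ?mulr0].
have := sol_weak_temperature sol phi_test; rewrite (dt_tensor A db).
rewrite (_ : torint _ = torint (fun x => A x * thin x) * bump a l 1 0); last first.
  rewrite mulrC -torintZl; last by continuity.
  by apply: eq_torint => x _; rewrite /phi; ring.
rewrite (@eq_segint _ 0 T (fun s => torint _)
    (fun s => bump a l (bump_deriv l 1) s * torint (fun x => A x * th x s))); last first.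
  move=> s _; rewrite -torintZl; last by continuity.
  by apply: eq_torint => x _; ring.
move=> ->; apply: eq_segint => s _; rewrite -torintZl; last by continuity.
apply: eq_torint => x _; rewrite mulrA mulr_sumr; congr (_ * _).
by apply: eq_bigr => i _; rewrite (dx_tensor _ (pA i)); ring.
Qed.

Definition momentum_source A (dA : 'I_3 -> 'I_3 -> pt -> R) s : R := torint (fun x =>
  \sum_(i < 3) \sum_(j < 3) dA i j x * (v i x s * v j x s) + th x s * A ord_max x).

Lemma velocity_tested b A (dA : 'I_3 -> 'I_3 -> pt -> R) t :
  (forall i, trigpoly b (A i)) -> (forall i j, is_partial j (A i) (dA i j)) ->
  (forall x, \sum_(i < 3) dA i i x = 0) -> 0 <= t <= T ->
  torint (fun x => \sum_(i < 3) A i x * v i x t) =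
  torint (fun x => \sum_(i < 3) A i x * vin i x) + segint 0 t (momentum_source A dA).
Proof.
move=> TA pA dA0; have HA i := cperiodic_trigpoly (TA i); have Hvin := cperiodic_vin.
have cdA i j := continuous_partial_trigpoly (TA i) (pA i j).
pose source s x := \sum_(i < 3) \sum_(j < 3) dA i j x * (v i x s * v j x s) + th x s * A ord_max x.
have csource : continuous (fun z : R * pt => source z.1 z.2).
  apply: continuous_funD; last by continuity.
  apply: continuous_fun_sum => i; apply: continuous_fun_sum => j.
  by have cij := cdA i j; continuity.
pose tested t := torint (fun x => \sum_(i < 3) A i x * v i x t).
apply: (@weak_primitive _ T _ tested) => // [||a l aT l0].
- by rewrite /tested; continuity.
- exact: continuous_torint csource.
have db := is_deriv_bump a 1 l0.
pose phi i x s := A i x * bump a l 1 s.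
have dphi i j x s : dx j (phi i) x s = dA i j x * bump a l 1 s by rewrite (dx_tensor _ (pA i j)).
have phi_test : test_vector T phi.
  split=> [i|].
    split=> [|s x j]; first exact: (smooth_xt_trigpoly_bump _ _ l0 (TA i)).
    by rewrite /phi (HA i).2.
  split; last by move=> x s _; under eq_bigr do rewrite dphi; rewrite -mulr_suml dA0 mul0r.
  by exists a; split=> [|i x s a_le]; [case/andP: aT|rewrite /phi bump_ge ?mulr0].
have := sol_weak_velocity sol phi_test.
rewrite (_ : torint _ = torint (fun x => \sum_(i < 3) A i x * vin i x) * bump a l 1 0); last first.
  rewrite mulrC -torintZl; last by continuity.
  by apply: eq_torint => x _; rewrite mulr_sumr; apply: eq_bigr => i _; rewrite /phi; ring.
rewrite (@eq_segint _ 0 T (fun s => torint _)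
    (fun s => bump a l (bump_deriv l 1) s * tested s)); last first.
  move=> s _; rewrite /tested -torintZl; last by continuity.
  apply: eq_torint => x _; rewrite mulr_sumr; apply: eq_bigr => i _.
  by rewrite (dt_tensor (A i) db); ring.
move=> ->; apply: eq_segint => s _; rewrite -torintZl; last first.
  exact: (continuous_slice (F := source) csource).
apply: eq_torint => x _; rewrite mulrDr mulr_sumr; congr (_ + _); last by rewrite /phi; ring.
by apply: eq_bigr => i _; rewrite mulr_sumr; apply: eq_bigr => j _; rewrite dphi; ring.
Qed.

Lemma moll_div_velocity N t x : 0 <= t <= T -> moll_div N (vel t) x = 0.
Proof.
move: t; apply: (ae_on_continuous_eq0 T0); first by rewrite /moll_div; continuity.
have [Z [Z_negl div_free]] := sol_div sol.
exists Z; split=> // t tT nZt; have Tj := trigpoly_reflect x (trigpoly_jackson R N).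
have := div_free t tT nZt _ (smooth_x_trigpoly Tj) (cperiodic_trigpoly Tj).2.
have cj := @continuous_jackson_grad R N.
rewrite (_ : torint _ = - moll_div N (vel t) x).
  by move/eqP; rewrite oppr_eq0 => /eqP.
have Ht i := cperiodic_at t (Hv i).
rewrite /moll_div; under eq_bigr => i _ do rewrite moll_gradE //.
rewrite -torint_sum => [|i]; last by continuity.
rewrite -torintN; last by continuity.
apply: eq_torint => y _; rewrite -sumrN; apply: eq_bigr => i _.
have pj := is_partial_reflect x (is_partial_jackson R N i).1.
by rewrite /dx0 (has_derive_val (pj y)); ring.
Qed.

Lemma velocity_moll_tested N u t : (forall i, cperiodic (u i)) -> (forall x, moll_div N u x = 0) ->
  0 <= t <= T ->
  \sum_(i < 3) torint (fun x => moll N (u i) x * moll N (v i ^~ t) x) =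
  \sum_(i < 3) torint (fun x => moll N (u i) x * moll N (vin i) x) +
  segint 0 t (momentum_source (fun i => moll N (moll N (u i)))
    (fun i j => moll N (moll_grad N (u i) j))).
Proof.
move=> Hu du tT; have Hm i := cperiodic_moll N (Hu i).
have Hg i j := cperiodic_moll_grad N j (Hu i).
rewrite (moll_adjoint_sum N Hu (fun i => cperiodic_at t (Hv i))).
rewrite (moll_adjoint_sum N Hu cperiodic_vin).
apply: (velocity_tested (b := fun _ => 2 * N%:R)) => // [i|i j|x].
- exact: trigpoly_moll.
- apply: is_partial_conv (is_partial_moll_grad N j (Hu i)); [|exact: (Hm i).1|exact: (Hg i j).1].
  exact: continuous_jackson.
- rewrite -moll_sum => [|i]; last exact: (Hg i i).1.
  by rewrite conv0 // => y; exact: du.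
Qed.

Lemma moll_div_vin N x : moll_div N vin x = 0.
Proof.
have Hvin := cperiodic_vin.
have smooth_vin i := smooth_x_partial i (sol_vin sol i).1.
have pv i := (smooth_vin i).1; have cdv i := (smooth_vin i).2.
rewrite /moll_div (eq_bigr (fun i => moll N (dx0 i (vin i)) x)) => [|i _]; last first.
  by rewrite (moll_grad_val (is_partial_conv _ _ _ (pv i))) //; continuity.
by rewrite -moll_sum // conv0 // => y; exact: (sol_div_vin sol).
Qed.

(* Test the difference of [v] and [vin] at time [0] with its own mollification. *)
Lemma velocity_initial i x : v i x 0 = vin i x.
Proof.
have T00 : (0 : R) <= 0 <= T by rewrite lexx ltW.
pose w j x := v j x 0 - vin j x; have Hvin := cperiodic_vin.
have Hw j : cperiodic (w j) by apply: cperiodicB; [exact: cperiodic_at|exact: Hvin].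
have Hmw N j := cperiodic_moll N (Hw j).
have dw N y : moll_div N w y = 0.
  have := moll_div_velocity N y T00; have := moll_div_vin N y; rewrite /moll_div => vin0 v0.
  rewrite (eq_bigr (fun j => moll_grad N (v j ^~ 0) j y - moll_grad N (vin j) j y)) => [|j _].
    by rewrite sumrB v0 vin0 subrr.
  by rewrite moll_gradB //; exact: cperiodic_at.
have moll_w N j : torint (fun x => moll N (w j) x ^+ 2) = 0.
  have energy0 : \sum_(j < 3) torint (fun x => moll N (w j) x ^+ 2) = 0.
    have /eqP := velocity_moll_tested Hw (dw N) T00.
    rewrite segint_set1 addr0 -subr_eq0 -sumrB => /eqP {2}<-.
    apply: eq_bigr => k _; have Hk := cperiodic_at 0 (Hv k); rewrite -torintB; [|continuity..].
    by apply: eq_torint => y _; rewrite /w mollB; [ring|exact: Hk.1|exact: (Hvin k).1].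
  move/eqP: energy0; rewrite psumr_eq0 => [|k _]; last first.
    by apply: torint_ge0 => [|y]; [continuity|exact: sqr_ge0].
  by move=> /allP/(_ j); rewrite mem_index_enum => /(_ isT) /eqP.
suff : w i x = 0 by rewrite /w; lra.
apply: (moll_inj (Hw i) (cperiodic_cst 0)) => N y; rewrite [RHS](@conv0 _ _ (fun _ => 0)) //.
apply/eqP; rewrite -sqrf_eq0; apply/eqP.
apply: (torint_eq0 (f := fun y => moll N (w i) y ^+ 2)) => //.
  by apply: (cperiodic_comp (b := fun z => z ^+ 2)) => //; continuity.
by move=> z; exact: sqr_ge0.
Qed.

Lemma moll_temperature N x t : 0 <= t <= T ->
  moll N (th^~ t) x = moll N thin x +
  segint 0 t (fun s => - \sum_(i < 3) moll_grad N (fun y => v i y s * th y s) i x).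
Proof.
move=> tT; have Ht := cperiodic_at t Hth; have Hthin := cperiodic_thin.
have Hvth i s : cperiodic (fun y => v i y s * th y s).
  by apply: cperiodicM; exact: cperiodic_at.
have cj := @continuous_jackson_grad R N; have eK := even_kernel_jackson R N.
rewrite !convE //.
have pj i := is_partial_reflect x (is_partial_jackson R N i).1.
rewrite (temperature_tested (trigpoly_reflect x (trigpoly_jackson R N)) pj tT); congr (_ + _).
apply: eq_segint => s _; have Hs i := cperiodic_at s (Hv i); have Hths := cperiodic_at s Hth.
under [in RHS]eq_bigr => i _ do rewrite moll_gradE //.
rewrite -torint_sum => [|i]; last by continuity.
rewrite -torintN; last by continuity.
apply: eq_torint => y _; rewrite -sumrN mulr_suml; apply: eq_bigr => i _; ring.
Qed.

Lemma temperature_balance (b db d2b : R -> R) N t : C2_with b db d2b -> 0 <= t <= T ->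
  torint (fun x => b (moll N (th^~ t) x)) =
  torint (fun x => b (moll N thin x)) + segint 0 t (fun s => flux (vel s) d2b N (th^~ s)).
Proof.
move=> [db_b d2b_db cd2b] tT; have /andP[t0 t_le] := tT.
have cb := is_deriv_continuous db_b; have cdb := is_deriv_continuous d2b_db.
have Hthin := cperiodic_thin; have Hvth i : cperiodic_flow (fun x s => v i x s * th x s).
  split=> [|s]; first by continuity.
  exact: (cperiodicM (cperiodic_at s (Hv i)) (cperiodic_at s Hth)).2.
pose G x s := - \sum_(i < 3) moll_grad N (fun y => v i y s * th y s) i x.
have cG : continuous (fun z : pt * R => G z.1 z.2).
  apply: continuous_funN; apply: continuous_fun_sum => i.
  apply: (continuous_fun_moll_grad (f := fun (z : pt * R) y => v i y z.2 * th y z.2)).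
  - by continuity.
  - by move=> z; exact: (Hvth i).2.
  - by continuity.
have pointwise x : b (moll N (th^~ t) x) =
    b (moll N thin x) + segint 0 t (fun s => db (moll N (th^~ s) x) * G x s).
  apply: (chain_rule_segint (h := fun s => moll N (th^~ s) x)) => //.
    exact: continuous_slice cG.
  by move=> s /andP[s0 st]; apply: moll_temperature; rewrite s0 (le_trans st).
rewrite (eq_torint (fun x _ => pointwise x)) torintD; [|by continuity|]; last first.
  by apply: (continuous_segint (F := fun x s => db (moll N (th^~ s) x) * G x s)) => //; continuity.
congr (_ + _); rewrite (radon_segint (torint_is_radon R)) //; last by continuity.
apply: eq_segint => s _; have Hs := cperiodic_at s Hth; have Hvs i := cperiodic_at s (Hvth i).
have Hm := cperiodic_moll N Hs; have Hg i := cperiodic_moll_grad N i (Hvs i).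
have Hgth i := cperiodic_moll_grad N i Hs; have Hmv i := cperiodic_moll N (Hvs i).
under eq_torint => x _ do rewrite /G mulrN mulr_sumr -sumrN.
rewrite torint_sum => [|i]; last by continuity.
apply: eq_bigr => i _; rewrite torintN; last by continuity.
apply/eqP; rewrite eqr_oppLR; apply/eqP.
apply: (torint_by_parts (f := fun x => db (moll N (th^~ s) x))
  (is_partial_comp d2b_db (is_partial_moll_grad N i Hs)) (is_partial_moll_grad N i (Hvs i))) => //.
- exact: cperiodic_comp.
- by continuity.
- exact: (Hg i).1.
Qed.

Definition buoyancy_work N s : R :=
  torint (fun x => th x s * moll N (moll N (v ord_max ^~ s)) x).

Definition mollified_source N s r : R :=
  momentum_source (fun i => moll N (moll N (v i ^~ r)))
    (fun i j => moll N (moll_grad N (v i ^~ r) j)) s.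

Lemma continuous_mollified_source N : continuous (fun z : R * R => mollified_source N z.1 z.2).
Proof.
apply: (continuous_torint (F := fun (z : R * R) x => _)).
apply: continuous_funD; last by continuity.
by do 2 apply: continuous_fun_sum => ?; continuity.
Qed.

Lemma mollified_source_diag N s : mollified_source N s s =
  \sum_(i < 3) flux (vel s) (fun _ => 1) N (v i ^~ s) + buoyancy_work N s.
Proof.
have Hs i := cperiodic_at s (Hv i); have Hths := cperiodic_at s Hth.
have Hg i j := cperiodic_moll_grad N j (Hs i).
have Hmg i j := cperiodic_moll N (Hg i j).
have cterm i j : continuous (fun x => moll N (moll_grad N (v i ^~ s) j) x * (v i x s * v j x s)).
  by apply: continuous_funM; [exact: (Hmg i j).1|continuity].
rewrite /mollified_source /momentum_source torintD; last 2 first.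
- by do 2 apply: continuous_fun_sum => ?.
- by continuity.
congr (_ + _); rewrite torint_sum => [|i]; last by apply: continuous_fun_sum => j.
apply: eq_bigr => i _; rewrite torint_sum //; apply: eq_bigr => j _.
rewrite moll_adjoint //; last exact: cperiodicM.
apply: eq_torint => x _; rewrite mul1r; congr (_ * conv _ _ _).
by apply: funext => y; rewrite mulrC.
Qed.

Lemma velocity_balance N t : 0 <= t <= T ->
  \sum_(i < 3) torint (fun x => moll N (v i ^~ t) x ^+ 2) =
  \sum_(i < 3) torint (fun x => moll N (vin i) x ^+ 2) +
  2 * (\sum_(i < 3) segint 0 t (fun s => flux (vel s) (fun _ => 1) N (v i ^~ s)) +
       segint 0 t (buoyancy_work N)).
Proof.
move=> /andP[t0 tT].
pose D s r := \sum_(i < 3) torint (fun x => moll N (v i ^~ r) x * moll N (v i ^~ s) x).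
have Dsqr s : D s s = \sum_(i < 3) torint (fun x => moll N (v i ^~ s) x ^+ 2) by [].
have cD : continuous (fun s => D s s) by rewrite /D; continuity.
have cF := @continuous_mollified_source N.
have cF2 : continuous (fun s => 2 * mollified_source N s s) by continuity.
have dD s : 0 < s < t -> has_derive (fun s => D s s) s (1 : R) (2 * mollified_source N s s).
  move=> /andP[s0 st]; apply: (has_derive_diagonal (T := T) (D := D)
    (C := fun r => \sum_(i < 3) torint (fun x => moll N (v i ^~ r) x * moll N (vin i) x))) => //.
  - by move=> s' r; apply: eq_bigr => i _; apply: eq_torint => x _; rewrite mulrC.
  - move=> s' r sT rT; apply: velocity_moll_tested sT => [i|x]; first exact: cperiodic_at.
    exact: moll_div_velocity.
  - by rewrite s0 (lt_le_trans st).
rewrite -Dsqr (_ : \sum_(i < 3) torint (fun x => moll N (vin i) x ^+ 2) = D 0 0); last first.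
  by rewrite Dsqr; apply: eq_bigr => i _; rewrite (funext (velocity_initial i)).
apply/eqP; rewrite addrC -subr_eq -(segint_FTC t0 cF2 cD dD) segintZl; last by continuity.
have rt := segint_is_radon t0.
have cflux i : continuous (fun s => flux (vel s) (fun _ => 1) N (v i ^~ s)).
  by apply: continuous_flux => //; continuity.
rewrite -(radon_sum rt) // -(radonD rt); [|by continuity|by rewrite /buoyancy_work; continuity].
by apply/eqP; congr (_ * _); apply: eq_segint => s _; exact: mollified_source_diag.
Qed.

End Solution.

(** * Passage to the limit *)

Section AeOn.
Variable R : realType.
Local Notation mu := (@lebesgue_measure R).
Implicit Types (T t : R) (P : R -> Prop).

Lemma ae_on_timeI T t P : t <= T -> ae_on T P -> {ae mu, forall s, timeI 0 t s -> P s}.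
Proof.
move=> tT [N [N0 NP]]; apply: negligibleS N0 => s /= notP; apply: contrapT => sN; apply: notP.
by move=> /andP[s0 st]; apply: NP => //; rewrite s0 (le_trans st).
Qed.

Lemma le_integral_nonmeasurable (D : set R) (f g : R -> \bar R) :
  (forall x, D x -> (0 <= f x)%E) -> (forall x, D x -> (f x <= g x)%E) ->
  (\int[mu]_(x in D) f x <= \int[mu]_(x in D) g x)%E.
Proof.
move=> f0 fg; rewrite !ge0_integralE //; last by move=> x Dx; exact: le_trans (f0 x Dx) (fg x Dx).
apply: ereal_sup_le => _ [h hf <-]; exists h => // x; apply: le_trans (hf x) _.
by rewrite /patch; case: ifPn => // /[!inE]; exact: fg.
Qed.

Lemma segint_cvg0_dominated T t (F : nat -> R -> R) (G : R -> \bar R) :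
  t <= T -> (forall k, continuous (F k)) -> mu.-integrable (timeI 0 T) G ->
  ae_on T (fun s => F^~ s @ \oo --> (0 : R) /\ forall k, (`|F k s|%:E <= G s)%E) ->
  (fun k => segint 0 t (F k)) @ \oo --> (0 : R).
Proof.
move=> tT cF iG /(ae_on_timeI tT) aeF; have ae_filter := ae_filter_ringOfSetsType mu.
have [] := @dominated_convergence _ _ R mu (timeI 0 t) (@measurable_timeI R 0 t)
  (fun k s => (F k s)%:E) (cst 0%E) G.
- by move=> k; have /integrableP[] := @continuous_integrable_timeI R 0 t (F k) (cF k).
- exact: measurable_cst.
- apply: filterS aeF => s Fs st; apply: cvg_EFin; first by near=> k.
  by have [] := Fs st.
- apply: integrableS iG; [exact: measurable_timeI|exact: measurable_timeI|move=> s /andP[s0 st]].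
  by rewrite /timeI /= s0 (le_trans st).
- by apply: filterS aeF => s Fs k st; have [_ /(_ k)] := Fs st.
move=> _ _; rewrite integral0_eq // => int_cvg.
rewrite (_ : (fun k => _) = fine \o (fun k => \int[mu]_(s in timeI 0 t) (F k s)%:E)%E).
  exact: (@fine_cvg _ _ _ _ _ 0 int_cvg).
by apply: funext => k; rewrite segintE.
Unshelve. all: by end_near. Qed.

Definition square_dominated T (a : nat -> R -> R) : Prop := exists G : R -> \bar R,
  mu.-integrable (timeI 0 T) G /\
  ae_on T (fun t => (forall n, ((a n t ^+ 2)%:E <= G t)%E) /\ a^~ t @ \oo --> (0 : R)).

Lemma Ltime_square_dominated (r : \bar R) T (a : nat -> R -> R) (g : R -> \bar R) :
  (2%:E <= r)%E -> (forall n, continuous (a n)) -> (forall n t, 0 <= a n t) ->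
  (forall n t, ((a n t)%:E <= g t)%E) -> Ltime r T g ->
  ae_on T (fun t => a^~ t @ \oo --> (0 : R)) ->
  square_dominated T a.
Proof.
move=> r2 ca a0 ag Lg a_cvg0; case: r r2 Lg => [r||//] r2 /= Lg; last first.
  have [M gM] := Lg; exists (EFin \o cst (M ^+ 2)); split.
    by apply: continuous_integrable_timeI; exact: continuous_fun_cst.
  apply: ae_onS (ae_onI gM a_cvg0) => t tT [gtM at0]; split => // n.
  have aM : a n t <= M by rewrite -lee_fin; exact: le_trans (ag n t) gtM.
  by rewrite /= lee_fin lerXn2r // nnegrE // (le_trans (a0 n t)).
rewrite lee_fin in r2; have r0 : 0 < r by lra.
pose H (t : R) : \bar R := esups (fun n => (a n t `^ r)%:E) 0%N.
have aH n t : ((a n t `^ r)%:E <= H t)%E by apply: ereal_sup_ubound; exists n.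
have H0 t : (0 <= H t)%E by apply: le_trans (aH 0%N t); rewrite lee_fin powR_ge0.
have iH : mu.-integrable (timeI 0 T) H.
  apply/integrableP; split.
    apply: measurable_fun_esups => n; apply/measurable_EFinP.
    apply: (@measurableT_comp _ _ _ _ _ _ (@powR R ^~ r)) => //.
    by apply: measurable_funTS; exact: continuous_measurable_fun.
  apply: le_lt_trans Lg; apply: le_integral_nonmeasurable => t _ //; rewrite gee0_abs //.
  apply: ge_ereal_sup => _ [n _ <-]; rewrite -poweR_EFin.
  apply: gt0_ler_poweR; rewrite ?(ltW r0) // in_itv /= leey andbT ?lee_fin //.
  by apply: le_trans (ag 0%N t); rewrite lee_fin.
have i1 : mu.-integrable (timeI 0 T) (EFin \o cst (1 : R)).
  by apply: continuous_integrable_timeI; exact: continuous_fun_cst.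
exists (fun t => ((1 : R)%:E + H t)%E); split.
  apply: (@integrableD _ _ _ mu (timeI 0 T) _ (EFin \o cst (1 : R)) H) => //.
  exact: measurable_timeI.
apply: ae_onS a_cvg0 => t tT at0; split => // n.
apply: (@le_trans _ _ (1%:E + (a n t `^ r)%:E)%E); last exact: leeD2l.
rewrite -EFinD lee_fin; have [a1|a1] := leP (a n t) 1.
  by rewrite ler_wpDr ?powR_ge0 // expr_le1.
by rewrite -powR_mulrn // ler_wpDl // ler_powR // ltW.
Qed.

End AeOn.

Section LebesgueNorms.
Variable R : realType.
Local Notation pt := 'rV[R]_3.
Implicit Types (f : pt -> R).

Lemma continuous_powR_norm (r : R) : 0 < r -> continuous (fun z : R => `|z| `^ r).
Proof.
move=> r0 z; have [->|z0] := eqVneq z 0.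
  apply/cvgrPdist_le => e e0; rewrite normr0 powR0 ?gt_eqF //.
  have d0 : 0 < e `^ r^-1 by rewrite powR_gt0.
  apply/nbhs_ballP; exists (e `^ r^-1) => // y; rewrite /ball /= !sub0r !normrN => yd.
  rewrite ger0_norm ?powR_ge0 //; apply: le_trans (ge0_ler_powR (ltW r0) _ _ (ltW yd)) _.
  - by rewrite nnegrE.
  - by rewrite nnegrE ltW.
  - by rewrite -powRrM mulVf ?gt_eqF // powRr1 // ltW.
have nz : \forall y \near z, y != 0 := cvgr_neq0 z cvg_id z0.
rewrite /continuous_at /powR (negbTE (_ : `|z| != 0)) ?normr_eq0 //.
apply: (@cvg_trans _ ((fun y : R => expR (r * ln `|y|)) @ z)).
  apply: near_eq_cvg; near=> y; rewrite ifF //; apply/negbTE; rewrite normr_eq0; near: y.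
  exact: nz.
apply: (@cvg_comp _ _ _ (fun y : R => r * ln `|y|) expR); last exact: continuous_expR.
apply: cvgM; first exact: cvg_cst.
apply: (@cvg_comp _ _ _ (fun y : R => `|y|) (@ln R)); last first.
  by apply: continuous_ln; rewrite normr_gt0.
exact: norm_continuous.
Unshelve. all: by end_near. Qed.

Lemma le_powR_young (m s : R) : 1 <= m -> 0 <= s -> s <= s `^ m / m + (1 - m^-1).
Proof.
move=> m1 s0; have m0 : 0 < m by lra.
have [->|mn1] := eqVneq m 1; first by rewrite powRr1 // invr1 mulr1 subrr addr0.
have mi : m^-1 < 1 by rewrite invf_lt1 // lt_neqAle eq_sym mn1.
have q0 : 0 < 1 - m^-1 by rewrite subr_gt0.
have := @conjugate_powR R s 1 m (1 - m^-1)^-1 s0 ler01 m0.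
rewrite invr_gt0 => /(_ q0); rewrite invrK addrCA subrr addr0 => /(_ erefl).
by rewrite powR1 mulr1 mul1r.
Qed.

Lemma sqr_le_powR (q lam x : R) : 2 <= q -> 0 < lam ->
  x ^+ 2 <= lam ^+ 2 * (2 / q * lam `^ (- q)) * `|x| `^ q + lam ^+ 2 * (1 - 2 / q).
Proof.
move=> q2 l0; have q0 : 0 < q by lra.
have u0 : 0 <= `|x| / lam by rewrite divr_ge0 // ltW.
have powE : ((`|x| / lam) ^+ 2) `^ (q / 2) = lam `^ (- q) * `|x| `^ q.
  rewrite -(powR_mulrn 2 u0) -powRrM (_ : 2%:R * (q / 2) = q); last by field.
  rewrite powRM //; last by rewrite invr_ge0 ltW.
  by rewrite mulrC -(powR_inv1 (ltW l0)) -powRrM mulN1r.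
have -> : x ^+ 2 = lam ^+ 2 * (`|x| / lam) ^+ 2.
  by rewrite -exprMn mulrCA mulfV ?gt_eqF // mulr1 real_normK // num_real.
have q2_ge1 : 1 <= q / 2 by rewrite ler_pdivlMr // mul1r.
apply: le_trans (ler_wpM2l (sqr_ge0 lam) (le_powR_young q2_ge1 (sqr_ge0 _))) _.
rewrite powE le_eqVlt; apply/orP; left; apply/eqP.
by field; rewrite gt_eqF.
Qed.

Lemma powR_Lq (q : R) f : 0 < q -> continuous f ->
  Lq q%:E f `^ q = torint (fun x => `|f x| `^ q).
Proof.
move=> q0 cf; rewrite /Lq -torintE -powRrM mulVf ?gt_eqF // powRr1 //.
apply: torint_ge0 => [|x]; last exact: powR_ge0.
exact: continuous_fun_comp (continuous_powR_norm q0) cf.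
Qed.

Lemma l2norm_le_Lq q f : (2%:E <= q)%E -> cperiodic f -> l2norm f <= Lq q f.
Proof.
case: q => [q||//] q2 Hf; last first.
  apply: (tnorm_le_sup (l2norm_transl_norm R)) => [|x _]; [exact: Hf.1|exact: Lq_oo_ub].
rewrite lee_fin in q2; have q0 : 0 < q by lra.
have cfq := continuous_fun_comp (continuous_powR_norm q0) Hf.1.
set L := Lq _ _; have L0 : 0 <= L by exact: powR_ge0.
apply/ler_addgt0Pr => e e0; set lam := L + e; have l0 : 0 < lam by rewrite /lam; lra.
have mean_le1 : lam `^ (- q) * torint (fun x => `|f x| `^ q) <= 1.
  rewrite -powR_Lq //; last exact: Hf.1.
  rewrite powRN mulrC ler_pdivrMr ?powR_gt0 // mul1r.
  by apply: ge0_ler_powR; rewrite ?nnegrE ?(ltW q0) ?(ltW l0) // lerDl ltW.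
apply: l2norm_le; first exact: ltW.
apply: (@le_trans _ _ (torint (fun x =>
    lam ^+ 2 * (2 / q * lam `^ (- q)) * `|f x| `^ q + lam ^+ 2 * (1 - 2 / q)))).
  by apply: le_torint; [continuity..|move=> x _; exact: sqr_le_powR].
rewrite torintD; [|continuity..]; rewrite torintZl; last by continuity.
have c0 : 0 <= lam ^+ 2 * (2 / q) by rewrite mulr_ge0 ?sqr_ge0 // divr_ge0 // ltW.
by rewrite torint_cst; have := ler_wpM2l c0 mean_le1; rewrite mulr1 !mulrA; lra.
Qed.

End LebesgueNorms.

Section FluxInTime.
Variable R : realType.
Local Notation pt := 'rV[R]_3.
Variables chi vphi : pt -> R.
Hypothesis LP : LP_pair chi vphi.
Local Notation block := (LPblock chi vphi).
Local Notation coef := (besov_coef chi vphi (@l2norm R)).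
Implicit Types (f : pt -> R -> R) (v : 'I_3 -> pt -> R -> R).

Lemma continuous_besov_coef n f : cperiodic_flow f -> continuous (fun t => coef (f^~ t) n).
Proof.
move=> Hf; have cb := @continuous_LPblock_flow R chi vphi n f Hf; rewrite /besov_coef /l2norm.
apply: continuous_funM; first by continuity.
by apply: continuous_fun_comp; [exact: sqrt_continuous|continuity].
Qed.

Lemma L_besov_square_dominated (r q : \bar R) T f : (2%:E <= q)%E -> (2%:E <= r)%E ->
  cperiodic_flow f -> L_besov chi vphi r q T f ->
  square_dominated T (fun n t => coef (f^~ t) n).
Proof.
move=> q2 r2 Hf [coefs_cvg0 Lr].
have Hb n t := cperiodic_LPblock chi vphi n (cperiodic_at t Hf).
have coef_ge0 n t : 0 <= coef (f^~ t) n by exact: besov_coef_ge0 (l2norm_transl_norm R) _ _.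
have coef_le n t : coef (f^~ t) n <= wgt R n * Lq q (block n (f^~ t)).
  by rewrite ler_wpM2l ?l2norm_le_Lq // ltW // wgt_gt0.
apply: (Ltime_square_dominated r2) Lr _ => // [n|n t|].
- exact: continuous_besov_coef.
- apply: le_ereal_sup_tmp; exists (wgt R n * Lq q (block n (f^~ t)))%:E; first by exists n.
  by rewrite lee_fin.
- apply: ae_onS coefs_cvg0 => t tT [_ Lq_cvg0].
  apply: (@squeeze_cvgr _ _ _ _ (fun _ => 0) (fun n => wgt R n * Lq q (block n (f^~ t)))) => //.
    by near=> n; rewrite coef_ge0 coef_le.
  exact: cvg_cst.
Unshelve. all: by end_near. Qed.

Lemma L_besov_oo_bound T v : (forall i, L_besov chi vphi +oo%E +oo%E T (v i)) ->
  exists V, ae_on T (fun s => forall i n, besov_coef chi vphi (@Lq R +oo%E) (v i ^~ s) n <= V).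
Proof.
move=> Bv; have bound i := cid (Bv i).2.
exists (\sum_(i < 3) `|projT1 (bound i)|); apply: ae_on_ord3 => i.
apply: ae_onS (projT2 (bound i)) => s _ norm_le n; apply: (@le_trans _ _ (projT1 (bound i))).
  by rewrite -lee_fin; apply: le_trans norm_le; apply: ereal_sup_ubound; exists n.
by apply: le_trans (ler_norm _) _; rewrite (bigD1 i) //= lerDl sumr_ge0.
Qed.

Lemma continuous_norm_le_on (M : R) (g : R -> R) : continuous g ->
  exists B, forall z, `|z| <= M -> `|g z| <= B.
Proof.
move=> cg; have [B gB] := continuous_compact_norm_le (@compact_timeI R (- M) M) cg.
by exists B => z zM; apply: gB; rewrite /timeI /= -ler_norml.
Qed.

Lemma segint_flux_cvg0 T t v f (b db d2b : R -> R) :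
  C2_with b db d2b -> (forall i, cperiodic_flow (v i)) -> cperiodic_flow f ->
  (forall N s x, 0 <= s <= T -> moll_div N (fun i => v i ^~ s) x = 0) ->
  (forall i, L_besov chi vphi +oo%E +oo%E T (v i)) ->
  square_dominated T (fun n t => coef (f^~ t) n) -> t <= T ->
  (fun k => segint 0 t (fun s => flux (fun i => v i ^~ s) d2b (2 ^ k) (f^~ s))) @ \oo --> (0 : R).
Proof.
move=> b_C2 Hv Hf div_free Bv [G [iG aeG]] tT; have [_ _ cd2b] := b_C2.
have [V v_le] := L_besov_oo_bound Bv; have [M fM] := cperiodic_flow_bounded T Hf.
have [B2 d2bM] := continuous_norm_le_on M cd2b.
have d2b_le s J x : 0 <= s <= T -> `|d2b (moll (2 ^ J) (f^~ s) x)| <= B2.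
  move=> sT; apply: d2bM; apply: moll_norm_le => [||y]; [by rewrite expn_gt0|exact: cperiodic_at|].
  exact: fM.
pose c := `|flux_const R * B2 * V| * decay_sum R + 1.
have c0 : 0 < c by rewrite ltr_wpDl // mulr_ge0 // ltW // decay_sum_gt0.
apply: (segint_cvg0_dominated (G := fun s => (c%:E * G s)%E) tT).
- by move=> k; exact: continuous_flux.
- by apply: integrableZl => //; exact: measurable_timeI.
apply: ae_onS (ae_onI v_le aeG) => s sT [v_le_s [coef_sqr_le coef_cvg0]].
have Hfs := cperiodic_at s Hf; have Hvs i := cperiodic_at s (Hv i).
have div_s N x := div_free N s x sT; have d2b_s J x := d2b_le s J x sT.
split; first exact: (flux_cvg0 LP b_C2 Hfs Hvs div_s d2b_s v_le_s coef_cvg0).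
move=> k; case EG : (G s) coef_sqr_le => [g||] coef_sqr_le; last by have := coef_sqr_le 0%N.
  have coef_le n : coef (f^~ s) n <= Num.sqrt g.
    rewrite -[leLHS]ger0_norm ?(besov_coef_ge0 _ _ (l2norm_transl_norm R)) //.
    by rewrite -sqrtr_sqr ler_wsqrtr // -lee_fin.
  have g0 : 0 <= g by rewrite -lee_fin; apply: le_trans (coef_sqr_le 0%N); rewrite lee_fin sqr_ge0.
  rewrite -EFinM lee_fin.
  apply: le_trans (flux_le_sqr LP b_C2 Hfs Hvs div_s d2b_s v_le_s k coef_le) _.
  rewrite sqr_sqrtr // ler_wpM2r // /c -[leLHS]addr0 lerD // ler_wpM2r ?ler_norm //.
  by rewrite ltW // decay_sum_gt0.
by rewrite gt0_muley ?lte_fin // leey.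
Qed.

End FluxInTime.

(** * Conservation laws *)

Section MollificationLimits.
Variable R : realType.
Local Notation pt := 'rV[R]_3.
Implicit Types (u : pt -> R) (f g : pt -> R -> R).

Lemma continuous_modulus_on (M e : R) (b : R -> R) : continuous b -> 0 < e ->
  exists2 C, 0 <= C & forall y z, `|y| <= M -> `|z| <= M -> `|b y - b z| <= e + C * `|y - z|.
Proof.
move=> cb e0; have cK := compact_setX (@compact_timeI R (- M) M) (@compact_timeI R (- M) M).
have [||||C C0 bC] := @compact_le_epsilon_add R (R * R)%type _ (fun z => `|b z.1 - b z.2|)
  (fun z => `|z.1 - z.2|) e cK _ _ _ _ e0.
- by continuity.
- by continuity.
- by move=> z; exact: normr_ge0.
- by move=> z _ /normr0_eq0/eqP; rewrite subr_eq0 => /eqP ->; rewrite subrr normr0.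
exists C => // y z yM zM; apply: (bC (y, z)).
by split; rewrite /timeI /= -ler_norml.
Qed.

Lemma torint_comp_moll_cvg (b : R -> R) u : continuous b -> cperiodic u ->
  (fun k => torint (fun x => b (moll (2 ^ k) u x))) @ \oo --> torint (fun x => b (u x)).
Proof.
move=> cb Hu; have [M uM] := cperiodic_bounded Hu.
apply/cvgrPdist_le => e e0; have e2 : 0 < e / 2 by rewrite divr_gt0.
have [C C0 bC] := continuous_modulus_on M cb e2; have C1 : 0 < C + 1 by rewrite ltr_wpDl.
have e1 : 0 < e / 2 / (C + 1) by rewrite divr_gt0.
apply: filterS (near_expn2 (moll_cvg Hu e1)) => k close.
have N0 : (0 < 2 ^ k)%N by rewrite expn_gt0.
rewrite distrC -torintB; [|continuity..]; apply: torint_norm_le => [|x _]; first by continuity.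
apply: le_trans (bC _ _ (moll_norm_le x N0 Hu uM) (uM x)) _; rewrite [leRHS]splitr lerD2l.
apply: le_trans (ler_wpM2l C0 (close x)) _.
by rewrite mulrA ler_pdivrMr // mulrC ler_wpM2l ?lerDl // ltW.
Qed.

Lemma moll_moll_cvg_uniform (T : R) f (e : R) : cperiodic_flow f -> 0 < e ->
  \forall N \near \oo, forall s x, 0 <= s <= T -> `|moll N (moll N (f^~ s)) x - f x s| <= e.
Proof.
move=> Hf e0; have e2 : 0 < e / 2 by rewrite divr_gt0.
apply: filterS2 (nbhs_infty_gt 0) (moll_cvg_uniform T Hf e2) => N N0 close s x sT.
have Hs := cperiodic_at s Hf; have Hm := cperiodic_moll N Hs.
rewrite -(subrKA (moll N (f^~ s) x)) [e]splitr; apply: le_trans (ler_normD _ _) _.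
apply: lerD (close s x sT); rewrite -mollB; [|exact: Hm.1|exact: Hs.1].
by apply: moll_norm_le => // [|y]; [exact: cperiodicB|exact: close].
Qed.

Lemma segint_torint_moll_moll_cvg (t : R) f g : 0 <= t -> cperiodic_flow f -> cperiodic_flow g ->
  (fun k => segint 0 t (fun s => torint (fun x => g x s * moll (2 ^ k) (moll (2 ^ k) (f^~ s)) x)))
  @ \oo --> segint 0 t (fun s => torint (fun x => g x s * f x s)).
Proof.
move=> t0 Hf Hg; have [M gM] := cperiodic_flow_bounded t Hg.
have M0 : 0 <= M by apply: le_trans (normr_ge0 _) (gM 0 0 _); rewrite lexx.
apply/cvgrPdist_le => e e0; have Mt : 0 < M * t + 1 by rewrite ltr_wpDl // mulr_ge0.
have e1 : 0 < e / (M * t + 1) by rewrite divr_gt0.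
apply: filterS (near_expn2 (moll_moll_cvg_uniform t Hf e1)) => k close.
have rt := segint_is_radon t0; rewrite distrC -(radonB rt); [|continuity..].
apply: (@le_trans _ _ (M * (e / (M * t + 1)) * (t - 0))).
  apply: segint_norm_le => // [|s st]; first by continuity.
  have Hfs := cperiodic_at s Hf; have Hgs := cperiodic_at s Hg.
  rewrite -torintB; [|continuity..]; apply: torint_norm_le => [|x _]; first by continuity.
  by rewrite -mulrBr normrM; apply: ler_pM => //; [exact: gM|exact: close].
rewrite subr0 (_ : _ * t = M * t * e / (M * t + 1)); last by ring.
by rewrite ler_pdivrMr // mulrC ler_wpM2l ?lerDl // ltW.
Qed.

End MollificationLimits.

Section Moments.
Variable R : realType.
Local Notation pt := 'rV[R]_3.
Implicit Types (u w : pt -> R).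

Lemma Bernoulli_pos_part (q : R) n : 0 <= q -> n%:R * ((q - 1 + `|q - 1|) / 2) <= q ^+ n.
Proof.
move=> q0; have [q1|/ltW q1] := leP q 1.
  by rewrite ler0_norm ?subr_le0 // subrr mul0r mulr0 exprn_ge0.
rewrite ger0_norm ?subr_ge0 // (_ : (_ + _) / 2 = q - 1); last by field.
elim: n => [|n IH]; first by rewrite mul0r.
by rewrite exprS -natr1; have := exprn_ege1 n q1; nra.
Qed.

(* If [|u| > lam] somewhere then the moments of [u / lam] are unbounded. *)
Lemma norm_le_of_moments u (lam : R) : 0 < lam -> cperiodic u ->
  (forall n, torint (fun x => (u x / lam) ^+ (2 * n)) <= 1) -> forall x, `|u x| <= lam.
Proof.
move=> l0 Hu moment_le1 x.
pose g x := ((u x / lam) ^+ 2 - 1 + `|(u x / lam) ^+ 2 - 1|) / 2.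
have Hg : cperiodic g.
  by apply: (cperiodic_comp (b := fun z => ((z / lam) ^+ 2 - 1 + `|(z / lam) ^+ 2 - 1|) / 2)) => //;
    continuity.
have g0 y : 0 <= g y.
  by rewrite divr_ge0 // -lerBlDl sub0r -normrN ler_norm.
have mean_le n : n%:R * torint g <= 1.
  apply: le_trans (moment_le1 n); rewrite -torintZl; last exact: Hg.1.
  apply: le_torint; [by apply: continuous_funM; [continuity|exact: Hg.1]|by continuity|move=> y _].
  by rewrite exprM Bernoulli_pos_part ?sqr_ge0.
have mean0 : torint g = 0.
  apply/eqP; rewrite eq_le torint_ge0 ?andbT //; last exact: Hg.1.
  rewrite leNgt; apply/negP => gpos; have := mean_le (Num.truncn (torint g)^-1).+1.
  by apply/negP; rewrite -ltNge -ltr_pdivrMr // div1r; exact: truncnS_gt.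
have := torint_eq0 Hg g0 mean0 x; rewrite /g => pos_part0.
have : (u x / lam) ^+ 2 <= 1 by have := ler_norm ((u x / lam) ^+ 2 - 1); lra.
rewrite -real_normK ?num_real // expr_le1 // normrM normfV (gtr0_norm l0).
by rewrite ler_pdivrMr // mul1r.
Qed.

Lemma Lq_oo_le_moments u w : cperiodic u -> cperiodic w ->
  (forall n, torint (fun x => u x ^+ (2 * n)) = torint (fun x => w x ^+ (2 * n))) ->
  Lq +oo u <= Lq +oo w.
Proof.
move=> Hu Hw momentE; apply/ler_addgt0Pr => e e0; set lam := Lq +oo w + e.
have l0 : 0 < lam by have := Lq_oo_ge0 w; rewrite /lam; lra.
apply: Lq_oo_le => x _; apply: norm_le_of_moments => // n.
have scale (f : pt -> R) : cperiodic f ->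
    torint (fun x => (f x / lam) ^+ (2 * n)) = lam ^- (2 * n) * torint (fun x => f x ^+ (2 * n)).
  move=> Hf; rewrite -torintZl; last by continuity.
  by apply: eq_torint => y _; rewrite expr_div_n mulrC.
rewrite scale // momentE -scale // -[leRHS](torint_cst 1).
apply: le_torint; [by continuity|by continuity|move=> y _].
rewrite exprM exprn_ile1 ?sqr_ge0 // -real_normK ?num_real // expr_le1 // normrM normfV.
by rewrite (gtr0_norm l0) ler_pdivrMr // mul1r (le_trans (Lq_oo_ub Hw y)) // lerDl ltW.
Qed.

Lemma has_derive_shifted_powR (d r z : R) : 0 < d ->
  has_derive (fun z : R => (z ^+ 2 + d) `^ r) z (1 : R)
    (r * (z ^+ 2 + d) `^ (r - 1) * (2 * z)).
Proof.
move=> d0; have base_gt0 : 0 < z ^+ 2 + d by rewrite ltr_wpDl // sqr_ge0.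
apply: (has_derive_comp (f := fun z => z ^+ 2 + d) (g := fun y => y `^ r)).
  rewrite -[2 * z]addr0; apply: has_deriveD; last exact: has_derive_cst.
  exact: (has_derive_expn 2).
exact: is_derive1_powR.
Qed.

Lemma C2_shifted_powR (d r : R) : 0 < d ->
  exists db d2b, C2_with (fun z : R => (z ^+ 2 + d) `^ r) db d2b.
Proof.
move=> d0; pose P r z := (z ^+ 2 + d) `^ r.
have dP r' : is_deriv (P r') (fun z => r' * P (r' - 1) z * (2 * z)).
  by move=> z; exact: has_derive_shifted_powR.
have d2z z : has_derive (fun z : R => 2 * z) z (1 : R) (2 * 1).
  by apply: has_deriveZ; exact: has_derive_id.
exists (fun z => r * P (r - 1) z * (2 * z)).
exists (fun z => r * ((r - 1) * P (r - 1 - 1) z * (2 * z)) * (2 * z) + r * P (r - 1) z * (2 * 1)).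
split; first exact: dP.
- by move=> z; apply: has_deriveM; [apply: has_deriveZ; exact: dP|exact: d2z].
- have cP r' := is_deriv_continuous (dP r').
  by have c1 := cP (r - 1); have c2 := cP (r - 1 - 1); continuity.
Qed.

Lemma torint_powR_norm_eq (p : R) u w : 0 < p -> cperiodic u -> cperiodic w ->
  (forall d, 0 < d ->
    torint (fun x => (u x ^+ 2 + d) `^ (p / 2)) = torint (fun x => (w x ^+ 2 + d) `^ (p / 2))) ->
  torint (fun x => `|u x| `^ p) = torint (fun x => `|w x| `^ p).
Proof.
move=> p0 Hu Hw regularized; have p2 : 0 < p / 2 by rewrite divr_gt0.
have cp := continuous_powR_norm p2.
pose Phi (f : pt -> R) (d : R) := torint (fun x : pt => `|f x ^+ 2 + `|d| | `^ (p / 2)).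
have cPhi f : cperiodic f -> continuous (Phi f).
  move=> Hf; apply: continuous_torint.
  by apply: (continuous_fun_comp (h := fun z : R * pt => f z.2 ^+ 2 + `|z.1|) cp); continuity.
have Phi0 f : Phi f 0 = torint (fun x => `|f x| `^ p).
  apply: eq_torint => x _; rewrite normr0 addr0 ger0_norm ?sqr_ge0 // -real_normK ?num_real //.
  by rewrite -powR_mulrn // -powRrM; congr powR; field.
have PhiE f d : 0 < d -> Phi f d = torint (fun x => (f x ^+ 2 + d) `^ (p / 2)).
  move=> d0; apply: eq_torint => x _.
  by rewrite (gtr0_norm d0) ger0_norm // addr_ge0 ?sqr_ge0 // ltW.
rewrite -!Phi0; apply: (@cvg_unique _ (@norm_hausdorff R R) (Phi u @ 0^'+)).
  by apply: cvg_at_right_filter; exact: cPhi.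
apply: (@cvg_trans _ (Phi w @ 0^'+)); last by apply: cvg_at_right_filter; exact: cPhi.
apply: near_eq_cvg; near=> d; have d0 : 0 < d by [].
by rewrite !PhiE // regularized.
Unshelve. all: by end_near. Qed.

End Moments.

Lemma cvgn_sum (R : realType) (I : Type) (r : seq I) (a : I -> nat -> R) (l : I -> R) :
  (forall i, a i @ \oo --> l i) ->
  (fun k => \sum_(i <- r) a i k) @ \oo --> \sum_(i <- r) l i.
Proof. by move=> al; apply: cvg_big => //; exact: add_continuous. Qed.

Section Conservation.
Variable R : realType.
Local Notation pt := 'rV[R]_3.
Variables chi vphi : pt -> R.
Hypothesis LP : LP_pair chi vphi.
Variables (T : R) (vin : 'I_3 -> pt -> R) (thin : pt -> R).
Variables (v : 'I_3 -> pt -> R -> R) (th : pt -> R -> R).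
Hypothesis T0 : 0 < T.
Hypothesis sol : continuous_solution T vin thin v th.
Hypothesis v_besov : forall i, L_besov chi vphi +oo%E +oo%E T (v i).
Implicit Types (t : R).

Let Hv : forall i, cperiodic_flow (v i) := sol_velocity sol.
Let Hth : cperiodic_flow th := sol_temperature sol.

Lemma temperature_conserved (b db d2b : R -> R) t : C2_with b db d2b ->
  square_dominated T (fun n t => besov_coef chi vphi (@l2norm R) (th^~ t) n) -> 0 <= t <= T ->
  torint (fun x => b (th x t)) = torint (fun x => b (thin x)).
Proof.
move=> b_C2 th_dom tT; have [db_b _ _] := b_C2; have cb := is_deriv_continuous db_b.
have /andP[_ t_le] := tT.
have flux_cvg := segint_flux_cvg0 LP b_C2 Hv Hth
  (fun N s x => moll_div_velocity T0 sol N x) v_besov th_dom t_le.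
have := torint_comp_moll_cvg cb (cperiodic_at t Hth).
under eq_fun => k do rewrite (temperature_balance T0 sol (2 ^ k) b_C2 tT).
move=> th_cvg; have rhs_cvg := cvgD (torint_comp_moll_cvg cb (cperiodic_thin sol)) flux_cvg.
by rewrite addr0 in rhs_cvg; exact: (cvg_unique (@norm_hausdorff R R) th_cvg (rhs_cvg _)).
Qed.

Lemma velocity_energy t : 0 <= t <= T ->
  torint (fun x => \sum_(i < 3) v i x t ^+ 2) = torint (fun x => \sum_(i < 3) vin i x ^+ 2)
    + 2 * segint 0 t (fun s => torint (fun x => th x s * v ord_max x s)).
Proof.
move=> tT; have /andP[t0 t_le] := tT.
have half_sqr : C2_with (fun z : R => 2^-1 * z ^+ 2) (fun z => z) (fun _ => 1).
  split=> [z|z|]; [|exact: has_derive_id|by continuity].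
  rewrite -[X in has_derive _ _ _ X](_ : 2^-1 * (2%:R * z ^+ 1) = z); last by field.
  by apply: has_deriveZ; exact: has_derive_expn.
have v_dom i := L_besov_square_dominated (leey _) (leey _) (Hv i) (v_besov i).
have flux_cvg i := segint_flux_cvg0 LP half_sqr Hv (Hv i)
  (fun N s x => moll_div_velocity T0 sol N x) v_besov (v_dom i) t_le.
have csqr : continuous (fun z : R => z ^+ 2) by continuity.
have energy_cvg (w : 'I_3 -> pt -> R) : (forall i, cperiodic (w i)) ->
    (fun k => \sum_(i < 3) torint (fun x => moll (2 ^ k) (w i) x ^+ 2)) @ \oo -->
    torint (fun x => \sum_(i < 3) w i x ^+ 2).
  move=> Hw; rewrite torint_sum => [|i]; last by continuity.
  by apply: cvgn_sum => i; exact: torint_comp_moll_cvg csqr (Hw i).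
have := energy_cvg _ (fun i => cperiodic_at t (Hv i)).
under eq_fun => k do rewrite (velocity_balance T0 sol (2 ^ k) tT).
move=> v_cvg; apply: (cvg_unique (@norm_hausdorff R R) v_cvg).
apply: cvgD; first exact: energy_cvg (cperiodic_vin sol).
apply: cvgM; first exact: cvg_cst.
have flux_sum_cvg : (fun k => \sum_(i < 3)
    segint 0 t (fun s => flux (fun j => v j ^~ s) (fun _ => 1) (2 ^ k) (v i ^~ s))) @ \oo -->
    (\sum_(i < 3) 0 : R).
  by apply: cvgn_sum => i; exact: flux_cvg.
have := cvgD flux_sum_cvg (segint_torint_moll_moll_cvg t0 (Hv ord_max) Hth).
by rewrite big1 // add0r; exact.
Qed.

Lemma temperature_Lq (p : \bar R) t : (1 <= p)%E ->
  square_dominated T (fun n t => besov_coef chi vphi (@l2norm R) (th^~ t) n) -> 0 <= t <= T ->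
  Lq p (th^~ t) = Lq p thin.
Proof.
move=> p1 th_dom tT; have Ht := cperiodic_at t Hth; have Hthin := cperiodic_thin sol.
case: p p1 => [p||//] p1.
  rewrite lee_fin in p1; have p0 : 0 < p by lra.
  rewrite /Lq -!torintE; congr powR; apply: torint_powR_norm_eq => // d d0.
  have [db [d2b b_C2]] := C2_shifted_powR (p / 2) d0.
  exact: (temperature_conserved b_C2).
have moments n : torint (fun x => th x t ^+ (2 * n)) = torint (fun x => thin x ^+ (2 * n)).
  set m := (2 * n)%N; apply: (temperature_conserved (b := fun z => z ^+ m)
    (db := fun z => m%:R * z ^+ m.-1) (d2b := fun z => m%:R * (m.-1%:R * z ^+ m.-2))) => //.
  split=> [z|z|]; [exact: has_derive_expn|by apply: has_deriveZ; exact: has_derive_expn|].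
  by continuity.
by apply/eqP; rewrite eq_le; apply/andP; split; apply: Lq_oo_le_moments.
Qed.

End Conservation.

Lemma conj_exp_ge2 (R : realType) (p : \bar R) :
  (1 <= p)%E -> (p < 2%:E)%E -> (2%:E <= conj_exp p)%E.
Proof.
case: p => [p||] //=; rewrite lee_fin lte_fin => p1 p2.
have [//|p_neq1] := eqVneq p 1; first by rewrite leey.
have p0 : 0 < p - 1 by rewrite subr_gt0 lt_neqAle eq_sym p_neq1.
by rewrite lee_fin ler_pdivlMr //; lra.
Qed.

Theorem theorem1p2 (R : realType) (chi vphi : 'rV[R]_3 -> R)
  (T : R) (vin : 'I_3 -> 'rV[R]_3 -> R) (thin : 'rV[R]_3 -> R)
  (v : 'I_3 -> 'rV[R]_3 -> R -> R) (th : 'rV[R]_3 -> R -> R) (p : \bar R) :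
  LP_pair chi vphi ->
  0 < T ->
  weak_solution T vin thin v th ->
  (1 <= p)%E ->
  (forall i, L_besov chi vphi +oo%E +oo%E T (v i)) ->
  C_Lq p T th ->
  ((p < 2%:E)%E -> L_besov chi vphi 2%:E (conj_exp p) T th) ->
  ((2%:E <= p)%E -> L_besov chi vphi p p T th) ->
  forall t, 0 <= t <= T ->
    intT3 (fun x => \sum_(i < 3) v i x t ^+ 2)
      = intT3 (fun x => \sum_(i < 3) vin i x ^+ 2)
        + 2 * \int[@lebesgue_measure R]_(s in timeI 0 t) intT3 (fun x => th x s * v ord_max x s)
    /\ Lq p (th^~ t) = Lq p thin.
Proof.
move=> LP T0 wsol p1 v_besov _ th_besov_lt2 th_besov_ge2 t tT.
have sol := continuous_solution_extend T0 wsol; have Hth := sol_temperature sol.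
have v_besov' i := L_besov_extend (v_besov i).
have th_dom : square_dominated T (fun n t => besov_coef chi vphi (@l2norm R) ((extend T th)^~ t) n).
  have [p2|p2] := ltP p 2%:E.
    have conj_ge2 := conj_exp_ge2 p1 p2.
    exact: (L_besov_square_dominated conj_ge2 (lexx _) Hth (L_besov_extend (th_besov_lt2 p2))).
  exact: (L_besov_square_dominated p2 p2 Hth (L_besov_extend (th_besov_ge2 p2))).
split; last by have := temperature_Lq LP T0 sol v_besov' p1 th_dom tT; rewrite /extend clamp_id.
have within_T s : 0 <= s <= t -> 0 <= s <= T.
  by case/andP: tT => _ t_le /andP[-> /le_trans ->].
have := velocity_energy LP T0 sol v_besov' tT; rewrite /extend (clamp_id tT).
under eq_segint => s st do rewrite (clamp_id (within_T s st)).
by rewrite !torintE segint_torintE.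
Qed.
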